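(* (1) There exist a contact circle bundle $(E,\alpha)$ and two Legendrian knots in $(E,\alpha)$ that are smoothly isotopic but not Legendrian isotopic, and that have nontrivial degree in the fiber. (2) There exist a contact circle bundle $\pi:(E,\alpha)\to F$ and two Legendrian knots in $(E,\alpha)$ that are smoothly isotopic but not Legendrian isotopic, and whose projections to the base $F$ represent a nontrivial homology class in $H_1(F)$.
   Context: A contact circle bundle is the unit circle bundle $\pi:E\to F$ of a Hermitian line bundle over a closed Riemann surface $F$, with $\alpha$ the real-valued restriction to $E$ of a unitary connection form (equal to $1$ on the generator of the circle action) whose real curvature form $\Omega$, defined by $d\alpha=-\pi^*\Omega$, is strictly negative on $F$. Then $\alpha$ is a contact form whose kernel $\xi$ is transverse to the fibers and whose Reeb field is tangent to the fibers. A Legendrian knot is an embedded circle in $E$ everywhere tangent to $\xi$; two Legendrian knots are Legendrian isotopic if they are isotopic through Legendrian knots, and smoothly isotopic if they are isotopic as smooth knots in $E$. ''Nontrivial degree in the fiber'' means that the knot represents a nontrivial homology class in $H_1(E)$ that is a multiple of the class of the fiber. *)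

(* Defs.v *)
From HB Require Import structures.
From mathcomp Require Import all_boot all_order all_algebra.
From mathcomp Require Import complex freeg.
From mathcomp Require Import all_classical all_reals all_analysis.

Set Implicit Arguments.
Unset Strict Implicit.
Unset Printing Implicit Defensive.

Import Order.TTheory GRing.Theory Num.Theory.
Import numFieldNormedType.Exports.

Local Open Scope classical_set_scope.
Local Open Scope ring_scope.

Section smooth.
Context {R : realType}.

Definition iter_derive {V W : normedModType R} (f : V -> W) (vs : seq V) :
    V -> W :=
  foldr (fun (v : V) (g : V -> W) (x : V) => 'D_v g x) f vs.

(* Intended for V finite-dimensional and U open: f is C^oo on U iff all its
   iterated directional derivatives exist and are continuous on U. *)
Definition smooth_on {V W : normedModType R} (U : set V) (f : V -> W) : Prop :=
  forall (vs : seq V) (x : V), U x ->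
    {for x, continuous (iter_derive f vs)} /\
    (forall v : V, derivable (iter_derive f vs) x v).

Definition dot2 (a b : 'rV[R]_2) : R := \sum_i a 0 i * b 0 i.

Definition wedge2 (a b : 'rV[R]_2) : R := a 0 0 * b 0 1 - a 0 1 * b 0 0.

Definition rot90 (a : 'rV[R]_2) : 'rV[R]_2 :=
  \row_(i < 2) if i == 0 then - a 0 1 else a 0 0.

(* Under this identification of C with R^2, multiplication by 'i is rot90 and
   Im (z^* * w) is wedge2. *)
Definition reim (z : R[i]) : 'rV[R]_2 :=
  \row_(i < 2) if i == 0 then complex.Re z else complex.Im z.

End smooth.

Notation e_x := (delta_mx 0 0 : 'rV_2).
Notation e_y := (delta_mx 0 1 : 'rV_2).

(* The complex structure is given by any holomorphic atlas, not necessarily a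
   maximal one.  [crd c] and [pos c] are total functions, meaningful only on
   [dom c] and on [crd c @` dom c] respectively. *)
Record riemann_surface (R : realType) := RiemannSurface {
  surf :> topologicalType;
  surf_hausdorff : hausdorff_space surf;
  surf_compact : compact [set: surf];
  surf_connected : connected [set: surf];
  chart : Type;
  dom : chart -> set surf;
  crd : chart -> surf -> 'rV[R]_2;
  pos : chart -> 'rV[R]_2 -> surf;
  chart_cover : forall x, exists c, dom c x;
  dom_open : forall c, open (dom c);
  img_open : forall c, open (crd c @` dom c);
  crdK : forall c x, dom c x -> pos c (crd c x) = x;
  crd_continuous : forall c, {within dom c, continuous (crd c)};
  pos_continuous : forall c, {within crd c @` dom c, continuous (pos c)};
  transition_smooth : forall c d,
    smooth_on (crd c @` (dom c `&` dom d)) (crd d \o pos c);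
  (* Cauchy-Riemann: the differential of a transition map is C-linear *)
  transition_holomorphic : forall c d x, dom c x -> dom d x ->
    'D_e_y (crd d \o pos c) (crd c x) =
    rot90 ('D_e_x (crd d \o pos c) (crd c x))
}.

Section surface_maps.
Context {R : realType} {F : riemann_surface R}.

Definition smooth_from_surface {W : normedModType R} (U : set F) (f : F -> W) :
    Prop :=
  forall c : chart F, smooth_on (crd c @` (dom c `&` U)) (f \o pos c).

Definition smooth_to_surface {V : normedModType R} (f : V -> F) : Prop :=
  continuous f /\
  forall c : chart F, smooth_on (f @^-1` dom c) (crd c \o f).

End surface_maps.

(* The smooth structure is given by a cover of F by local unit frames, any two
   of which differ by a smooth U(1)-valued function.  The Hermitian form is
   linear in its first argument; [frame e x] is meaningful for [fdom e x]
   only. *)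
Record hermitian_line_bundle (R : realType) (F : riemann_surface R) :=
  HermitianLineBundle {
  fib : F -> lmodType R[i];
  hdot : forall x, fib x -> fib x -> R[i];
  hdot_linear : forall x (a : R[i]) (u v w : fib x),
    hdot (a *: u + v) w = a * hdot u w + hdot v w;
  hdot_conj : forall x (u v : fib x), hdot v u = (hdot u v)^*;
  hdot_pos : forall x (u : fib x), u != 0 -> 0 < hdot u u;
  framing : Type;
  fdom : framing -> set F;
  frame : framing -> forall x, fib x;
  fdom_cover : forall x, exists e, fdom e x;
  fdom_open : forall e, open (fdom e);
  frame_unit : forall e x, fdom e x -> hdot (frame e x) (frame e x) = 1;
  frame_span : forall e x, fdom e x ->
    forall u : fib x, exists z : R[i], u = z *: frame e x;
  frame_smooth : forall e e', smooth_from_surface (fdom e `&` fdom e')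
    (fun x => reim (hdot (frame e' x) (frame e x)))
}.

Section unit_circle_bundle.
Context {R : realType} {F : riemann_surface R}.

Record circle_bundle (L : hermitian_line_bundle F) := CirclePoint {
  bproj : F;
  bvec : fib L bproj;
  bvec_unit : hdot bvec bvec = 1
}.

Variable L : hermitian_line_bundle F.

(* The coordinate z of a unit vector u = z *: frame e x; it is meaningful when
   [fdom e (bproj u)]. *)
Definition fcrd (e : framing L) (u : circle_bundle L) : 'rV[R]_2 :=
  reim (hdot (bvec u) (frame e (bproj u))).

(* The topology for which the local trivialisations (bproj, fcrd e) are
   homeomorphisms onto fdom e x S^1. *)
Definition circle_bundle_open (O : set (circle_bundle L)) : Prop :=
  forall (e : framing L) (u : circle_bundle L), O u -> fdom e (bproj u) ->
    \forall p \near (bproj u, fcrd e u),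
      forall u' : circle_bundle L, (bproj u', fcrd e u') = p -> O u'.

Lemma circle_bundle_openT : circle_bundle_open setT.
Proof. by move=> e u _ _; near=> p. Unshelve. all: by end_near. Qed.

Lemma circle_bundle_openI : setI_closed circle_bundle_open.
Proof.
move=> A B oA oB e u [Au Bu] eu.
by apply: filterS2 (oA e u Au eu) (oB e u Bu eu) => p hA hB u' hu'; split;
  [exact: hA|exact: hB].
Qed.

Lemma circle_bundle_open_bigU (I : Type) (f : I -> set (circle_bundle L)) :
  (forall i, circle_bundle_open (f i)) -> circle_bundle_open (\bigcup_i f i).
Proof.
move=> of_ e u [i _ fiu] eu.
by apply: filterS (of_ i e u fiu eu) => p h u' hu'; exists i => //; exact: h.
Qed.

HB.instance Definition _ := gen_eqMixin (circle_bundle L).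
HB.instance Definition _ := gen_choiceMixin (circle_bundle L).
HB.instance Definition _ := isOpenTopological.Build (circle_bundle L)
  circle_bundle_openT circle_bundle_openI circle_bundle_open_bigU.

Definition smooth_to_bundle {V : normedModType R} (f : V -> circle_bundle L) :
    Prop :=
  smooth_to_surface (@bproj L \o f) /\
  forall e : framing L,
    smooth_on ((@bproj L \o f) @^-1` fdom e) (fcrd e \o f).

Lemma rotate_unit (z : R[i]) (u : circle_bundle L) :
  z * z^* = 1 -> hdot (z *: bvec u) (z *: bvec u) = 1.
Proof.
have hZ x (a : R[i]) (v w : fib L x) : hdot (a *: v) w = a * hdot v w.
  have h0 : hdot 0 w = 0.
    have /eqP := hdot_linear 1 0 0 w.
    by rewrite scale1r addr0 mul1r -subr_eq subrr eq_sym => /eqP.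
  by rewrite -[a *: v]addr0 hdot_linear h0 addr0.
move=> hz; rewrite hZ hdot_conj hZ bvec_unit mulr1 //.
Qed.

Lemma expi_unit (t : R) :
  (cos t +i* sin t)%C * ((cos t +i* sin t)%C)^* = 1.
Proof.
apply/eqP; rewrite eq_complex /=; apply/andP; split; apply/eqP.
  by rewrite mulrN opprK -!expr2 cos2Dsin2.
by rewrite mulrN mulrC addNr.
Qed.

Definition fiber_loop (u : circle_bundle L) (t : R) : circle_bundle L :=
  CirclePoint (rotate_unit u (expi_unit (2 * pi * t))).

End unit_circle_bundle.

(* [form e c] is the coefficient vector, in the chart c, of the real 1-form A_e
   such that the connection D satisfies D (frame e) = 'i A_e (frame e).
   [form_chart] says that A_e is a 1-form on F, and [form_gauge] is the change
   of frame e' = g e, namely A_e' = A_e - 'i g^-1 dg. *)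
Record unitary_connection (R : realType) (F : riemann_surface R)
    (L : hermitian_line_bundle F) := UnitaryConnection {
  form : framing L -> chart F -> 'rV[R]_2 -> 'rV[R]_2;
  form_smooth : forall e c,
    smooth_on (crd c @` (dom c `&` fdom e)) (form e c);
  form_chart : forall e c d x, fdom e x -> dom c x -> dom d x -> forall v,
    dot2 (form e c (crd c x)) v =
    dot2 (form e d (crd d x)) ('D_v (crd d \o pos c) (crd c x));
  form_gauge : forall e e' c x, fdom e x -> fdom e' x -> dom c x -> forall v,
    let g := fun p : 'rV[R]_2 =>
      reim (hdot (frame e' (pos c p)) (frame e (pos c p))) in
    dot2 (form e' c (crd c x)) v =
    dot2 (form e c (crd c x)) v + wedge2 (g (crd c x)) ('D_v g (crd c x))
}.

Section connection.
Context {R : realType} {F : riemann_surface R} {L : hermitian_line_bundle F}.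
Variable A : unitary_connection L.

(* The value of the connection form alpha on the velocity of a curve g in the
   unit circle bundle, at time t.  Where u = z (frame e), alpha is the real
   1-form -'i (z^-1 dz) + bproj^* A_e = Im (z^* dz) + bproj^* A_e; it is 1 on the
   generator z |-> 'i z of the circle action. *)
Definition alpha_velocity (e : framing L) (c : chart F)
    (g : R -> circle_bundle L) (t : R) : R :=
  let x := crd c \o @bproj _ _ L \o g in
  let z := fcrd e \o g in
  wedge2 (z t) (derive1 z t) + dot2 (form A e c (x t)) (derive1 x t).

(* Omega = [curvature e c] dx /\ dy in the chart c; since
   d alpha = bproj^* (d A_e) = - bproj^* Omega, Omega = - d A_e. *)
Definition curvature (e : framing L) (c : chart F) (p : 'rV[R]_2) : R :=
  - ('D_e_x (fun q => form A e c q 0 1) p - 'D_e_y (fun q => form A e c q 0 0) p).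

End connection.

Record contact_circle_bundle (R : realType) := ContactCircleBundle {
  cbase : riemann_surface R;
  cline : hermitian_line_bundle cbase;
  cconn : unitary_connection cline;
  cneg : forall (e : framing cline) (c : chart cbase) (x : cbase),
    fdom e x -> dom c x -> curvature cconn e c (crd c x) < 0
}.

Definition ctotal (R : realType) (B : contact_circle_bundle R) :
  topologicalType := circle_bundle (cline B).

Section knots.
Context {R : realType} (B : contact_circle_bundle R).

(* An embedded circle is given by an embedding of R/Z, i.e. by a smooth
   1-periodic immersion of R which is injective modulo Z. *)
Definition knot (g : R -> circle_bundle (cline B)) : Prop :=
  [/\ smooth_to_bundle (g : R^o -> _),
      (forall s t, g s = g t <-> exists k : int, s - t = k%:~R) &
      forall e c t, fdom e (bproj (g t)) -> dom c (bproj (g t)) ->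
        derive1 (crd c \o @bproj _ _ _ \o g) t != 0 \/
        derive1 (fcrd e \o g) t != 0].

Definition legendrian_knot (g : R -> circle_bundle (cline B)) : Prop :=
  knot g /\
  forall e c t, fdom e (bproj (g t)) -> dom c (bproj (g t)) ->
    alpha_velocity (cconn B) e c g t = 0.

(* Isotopy of the (unparametrised) circles [range g0] and [range g1] through
   circles in the class P.  The isotopy parameter runs over R for smoothness
   purposes; only its values in [0, 1] matter, and every smooth isotopy over
   [0, 1] becomes of this form after a smooth change of parameter that is
   stationary near 0 and 1. *)
Definition isotopic_through (P : (R -> circle_bundle (cline B)) -> Prop)
    (g0 g1 : R -> circle_bundle (cline B)) : Prop :=
  exists G : R -> R -> circle_bundle (cline B),
    [/\ smooth_to_bundle (fun p : R^o * R^o => G p.1 p.2),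
        (forall s, 0 <= s <= 1 -> P (G s)),
        range (G 0) = range g0 &
        range (G 1) = range g1].

Definition smoothly_isotopic := isotopic_through knot.

Definition legendrian_isotopic := isotopic_through legendrian_knot.

End knots.

Section homology.
Context (R : realType).

Definition std_simplex (n : nat) : set 'rV[R]_n.+1 :=
  [set x | (forall i, 0 <= x 0 i) /\ \sum_i x 0 i = 1].

Definition face_fun n (i : 'I_n.+2) (x : 'rV[R]_n.+1) : 'rV[R]_n.+2 :=
  \row_j if unlift i j is Some k then x 0 k else 0.

Lemma face_fun_simplex n (i : 'I_n.+2) (x : 'rV[R]_n.+1) :
  std_simplex x -> std_simplex (face_fun i x).
Proof.
move=> [x0 x1]; split => [j|].
  by rewrite mxE; case: unliftP => [k _|_].
rewrite (bigD1_ord i) //= mxE unlift_none add0r -[RHS]x1.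
by apply: eq_bigr => k _; rewrite mxE liftK.
Qed.

Definition face n (i : 'I_n.+2) (p : set_type (@std_simplex n)) :
    set_type (@std_simplex n.+1) :=
  SigSub (mem_set (face_fun_simplex i (set_valP p))).

(* Chains on arbitrary functions on the standard simplex; the singular chains
   are those supported on continuous functions. *)
Definition simplex (n : nat) (X : Type) := set_type (@std_simplex n) -> X.

HB.instance Definition _ n X := gen_eqMixin (simplex n X).
HB.instance Definition _ n X := gen_choiceMixin (simplex n X).

Definition chain (n : nat) (X : Type) := {freeg (simplex n X) / int}.

Definition singular (n : nat) (X : topologicalType) (c : chain n X) : Prop :=
  forall s, s \in freeg.dom c -> continuous (s : _ -> X).

Definition chain_boundary (n : nat) (X : Type) (c : chain n.+1 X) : chain n X :=
  \sum_(s <- freeg.dom c) \sum_(i < n.+2)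
    << (-1) ^+ i * coeff s c *g (s \o @face n i : simplex n X) >>.

Definition homologous (n : nat) (X : topologicalType) (z z' : chain n X) :
    Prop :=
  exists c : chain n.+1 X, singular c /\ z - z' = chain_boundary c.

(* The 1-cycle of a continuous loop g, with g 0 = g 1. *)
Definition loop_cycle (X : Type) (g : R -> X) : chain 1 X :=
  << ((fun p => g (set_val p 0 1)) : simplex 1 X) >>.

End homology.

Section degree.
Context {R : realType} (B : contact_circle_bundle R).

Definition nontrivial_fiber_degree (g : R -> circle_bundle (cline B)) : Prop :=
  ~ homologous (X := ctotal B) (loop_cycle g) 0 /\
  exists (u : circle_bundle (cline B)) (k : int),
    homologous (X := ctotal B) (loop_cycle g) (loop_cycle (fiber_loop u) *~ k).

Definition nontrivial_base_class (g : R -> circle_bundle (cline B)) : Prop :=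
  ~ homologous (X := cbase B) (loop_cycle (@bproj _ _ (cline B) \o g)) 0.

End degree.

(* Main.v *)
From HB Require Import structures.
Require Import Defs.
From mathcomp Require Import all_boot all_order all_algebra.
From mathcomp Require Import complex freeg.
From mathcomp Require Import all_classical all_reals all_analysis.
From mathcomp Require Import ring lra.

Set Implicit Arguments.
Unset Strict Implicit.
Unset Printing Implicit Defensive.

Import Order.TTheory GRing.Theory Num.Theory.
Import numFieldNormedType.Exports.

Local Open Scope classical_set_scope.
Local Open Scope ring_scope.

(** Both parts are proved on one manifold: the circle bundle E of Euler number
    -2 over the torus R^2/Z^2, with the contact form 2 pi (dw + 2 x dy), where
    w is a coordinate of period 1 in the fibers.  The universal cover of E is
    R^3, and the map [pt x y w] is the covering.

    The invariant.  A Legendrian curve has contact form zero, so at a point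
    where its projection to the torus stood still its fiber coordinate would
    stand still too; hence the projection of a Legendrian knot is an immersed
    closed curve ([legendrian_velocity]).  The torus is parallelizable: its
    charts differ by translations, so the velocity of the projection is a
    well-defined nowhere zero vector of R^2, depending continuously on time and
    on the parameter of an isotopy.  Its number k of turns is therefore the same
    at both ends of a Legendrian isotopy ([isotopy_winding]).  An isotopy fixes
    only the images of the two end knots, so k has to be computed for every
    Legendrian parametrisation of a given circle.  Orientation reversal changes
    its sign, and only |k| is used.  When no two points of the knot share a
    direction, |k| = 1 ([injective_turn]).

    Part 1.  In the coordinate u = w + xy the contact form is
    2 pi (du + x dy - y dx), and a circle of radius r about the origin wound m
    times while u grows by 1 is Legendrian if and only if 2 pi m r^2 = 1.  The
    numbers of turns for m = 1 and m = 2 differ ([circ_turn1], [circ_turn2]),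
    while interpolating the two plane curves and keeping u gives a smooth
    isotopy, since u separates the points throughout.  Shrinking the plane
    curve to the origin is a homotopy to a fiber.

    Part 2.  The straight line x = w = 0 has velocity of constant direction, so
    k = 0 ([straight_turn]).  It is isotopic to the lift of a trochoid in the
    same direction with one loop per period, whose velocity takes every
    direction exactly once, so |k| = 1 ([trochoid_turn]).

    Homology.  A loop is shown not to be a boundary with a cocycle: each path
    lifts to R^3, and the integer part of a suitable function of the lift,
    evaluated at the two ends, has a difference that does not depend on the
    lift modulo n ([loop_not_null]).  For the base, the function is y and n = 0.
    For the fiber, whose class has order 2 in H_1(E), it is w + 2 floor(x) y and
    n = 2. *)

(** * Smooth functions *)

Section smooth_calculus.
Context {R : realType}.

Lemma iter_derive_near (V W : normedModType R) (f g : V -> W) vs (x : V) :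
  (\near x, f x = g x) -> \near x, iter_derive f vs x = iter_derive g vs x.
Proof.
elim: vs => [//|v vs IH] /IH /near_join.
by apply: filterS => y; exact: near_eq_derive.
Qed.

Lemma near_eq_continuous_at (T U : topologicalType) (f g : T -> U) (x : T) :
  (\forall y \near x, f y = g y) -> {for x, continuous f} ->
  {for x, continuous g}.
Proof.
move=> fg; rewrite /prop_for /continuous_at (nbhs_singleton fg); apply: cvg_trans.
by apply: near_eq_cvg; apply: filterS fg => y ->.
Qed.

Lemma smooth_on_local (V W : normedModType R) (U : set V) (f : V -> W) :
  (forall x, U x -> exists g, smooth_on [set: V] g /\ \near x, f x = g x) ->
  smooth_on U f.
Proof.
move=> loc vs x Ux; have [g [sg fg]] := loc x Ux.
have [cg dg] := sg vs x I.
have gf : \near x, iter_derive g vs x = iter_derive f vs x.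
  by apply: iter_derive_near; apply: filterS fg => y ->.
split=> [|v]; last exact: near_eq_derivable gf (dg v).
exact: near_eq_continuous_at gf cg.
Qed.

(** Iterated derivatives are never computed: it is enough to find a class of
    functions that is stable under directional derivatives. *)
Lemma smooth_coind (V W : normedModType R) (S : set (V -> W)) :
  (forall f, S f -> [/\ continuous f, forall x v, derivable f x v &
     forall v, S (fun x => 'D_v f x)]) ->
  forall f, S f -> smooth_on [set: V] f.
Proof.
move=> HS f Sf vs x _.
have : S (iter_derive f vs) by elim: vs => [//|v vs IH]; have [_ _] := HS _ IH; apply.
by move=> /HS[c d _]; split=> [|v]; [exact: c|exact: d].
Qed.

(** All maps of the construction have components in this class, which contains
    its own derivatives and hence consists of smooth functions. The first
    constructor covers constants and linear maps, whose derivatives do not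
    depend on the point. *)
Inductive elem (V : normedModType R) : (V -> R) -> Prop :=
| elem_lin l d : continuous l -> (forall x v, is_derive x v l (d v)) -> elem l
| elemD f g : elem f -> elem g -> elem (fun x => f x + g x)
| elemM f g : elem f -> elem g -> elem (fun x => f x * g x)
| elem_cos f : elem f -> elem (fun x => cos (f x))
| elem_sin f : elem f -> elem (fun x => sin (f x)).

(** Reduces derivatives along a vector to derivatives on the real line, where
    the chain rule is available. *)
Lemma derive_line (V W : normedModType R) (f : V -> W) x v :
  'D_v f x = 'D_1 (fun t : R => f (t *: v + x)) 0.
Proof.
rewrite /derive; set g1 := fun h => h^-1 *: _; set g2 := fun h => h^-1 *: _.
suff -> : g1 = g2 by [].
by rewrite funeqE /g1 /g2 => h /=; rewrite addr0 scale0r add0r [_%:A]mulr1.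
Qed.

Section elem.
Context {V : normedModType R}.
Implicit Types f g : V -> R.

Lemma elemC c : elem (fun _ : V => c).
Proof.
by apply: (@elem_lin _ _ (fun=> 0)); exact: cst_continuous.
Qed.

Lemma elemN f : elem f -> elem (fun x => - f x).
Proof.
move=> ef; rewrite (_ : (fun x => - f x) = (fun x => (-1) * f x)).
  by apply: elemM => //; exact: elemC.
by apply/funext => x; rewrite mulN1r.
Qed.

Lemma elemB f g : elem f -> elem g -> elem (fun x => f x - g x).
Proof. by move=> ef eg; apply: elemD => //; exact: elemN. Qed.

Lemma is_derive_comp1 f (h : R -> R) x v (df dh : R) :
  is_derive x v f df -> is_derive (f x) 1 h dh ->
  is_derive x v (fun y => h (f y)) (df * dh).
Proof.
move=> [dl <-] hd.
pose k := fun t : R => f (t *: v + x).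
have dk : is_derive (0 : R) 1 k ('D_v f x).
  by apply: DeriveDef; [exact: (derivable1P f x v).1 dl|rewrite [RHS]derive_line].
have hd' : is_derive (k 0) 1 h dh by rewrite /k scale0r add0r.
have [d1 e1] := is_derive1_comp hd' dk.
apply: DeriveDef; first exact: (derivable1P _ x v).2 d1.
by rewrite derive_line mulrC -e1.
Qed.

Lemma elemP f : elem f ->
  [/\ continuous f, forall x v, derivable f x v &
      forall v, elem (fun x => 'D_v f x)].
Proof.
elim=> {f}.
- move=> l d cl dl; split=> // v.
  rewrite (_ : (fun x => _) = fun=> d v); first exact: elemC.
  by apply/funext => x; case: (dl x v).
- move=> f g ef [cf df Ef] eg [cg dg Eg]; split.
  + by move=> x; apply: cvgD; [exact: cf|exact: cg].
  + by move=> x v; apply: derivableD.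
  + move=> v; rewrite (_ : (fun x => _) = fun x => 'D_v f x + 'D_v g x).
      exact: elemD.
    by apply/funext => x; rewrite deriveD.
- move=> f g ef [cf df Ef] eg [cg dg Eg]; split.
  + by move=> x; apply: cvgM; [exact: cf|exact: cg].
  + by move=> x v; apply: derivableM.
  + move=> v; rewrite (_ : (fun x => _) =
        fun x => f x * 'D_v g x + g x * 'D_v f x).
      by apply: elemD; apply: elemM.
    by apply/funext => x; rewrite deriveM.
- move=> f ef [cf df Ef].
  have H x v : is_derive x v (fun y => cos (f y)) ('D_v f x * - sin (f x)).
    by apply: is_derive_comp1; exact: derivableP.
  split=> [x|x v|v].
  + by apply: continuous_comp; [exact: cf|exact: continuous_cos].
  + by case: (H x v).
  + rewrite (_ : (fun x => _) = fun x => 'D_v f x * - sin (f x)).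
      by apply: elemM => //; apply: elemN; exact: elem_sin.
    by apply/funext => x; case: (H x v).
- move=> f ef [cf df Ef].
  have H x v : is_derive x v (fun y => sin (f y)) ('D_v f x * cos (f x)).
    by apply: is_derive_comp1; exact: derivableP.
  split=> [x|x v|v].
  + by apply: continuous_comp; [exact: cf|exact: continuous_sin].
  + by case: (H x v).
  + rewrite (_ : (fun x => _) = fun x => 'D_v f x * cos (f x)).
      by apply: elemM => //; exact: elem_cos.
    by apply/funext => x; case: (H x v).
Qed.

Lemma elem_continuous f : elem f -> continuous f.
Proof. by case/elemP. Qed.

Lemma elem_derivable f x v : elem f -> derivable f x v.
Proof. by case/elemP. Qed.

End elem.

Definition vec2 (x y : R) : 'rV[R]_2 := \row_(i < 2) if i == 0 then x else y.

Lemma vec2E (x y : R) : (vec2 x y 0 0 = x) * (vec2 x y 0 1 = y).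
Proof. by rewrite !mxE. Qed.

Lemma vec2P (p : 'rV[R]_2) : p = vec2 (p 0 0) (p 0 1).
Proof.
apply/rowP => i; rewrite mxE; case: i => -[|[|//]] Hi /=; congr (p _ _);
  exact/val_inj.
Qed.

Lemma vec2_eqP (p q : 'rV[R]_2) : p 0 0 = q 0 0 -> p 0 1 = q 0 1 -> p = q.
Proof. by move=> h0 h1; rewrite (vec2P p) (vec2P q) h0 h1. Qed.

Lemma vec2_derivable (V : normedModType R) (f g : V -> R) x v :
  derivable f x v -> derivable g x v -> derivable (fun z => vec2 (f z) (g z)) x v.
Proof.
move=> df dg; apply/derivable_mxP => i j.
have -> : (fun z => vec2 (f z) (g z) i j) = if j == 0 then f else g.
  by apply/funext => z; rewrite mxE; case: ifP.
by case: ifP.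
Qed.

Lemma vec2_derive (V : normedModType R) (f g : V -> R) x v :
  derivable f x v -> derivable g x v ->
  'D_v (fun z => vec2 (f z) (g z)) x = vec2 ('D_v f x) ('D_v g x).
Proof.
move=> df dg; rewrite derive_mx; last exact: vec2_derivable.
by apply: vec2_eqP; rewrite !mxE; congr ('D_v _ x); apply/funext => z; rewrite mxE.
Qed.

Lemma vec2_cvg (T : Type) (F : set_system T) {FF : Filter F} (f g : T -> R) a b :
  f @ F --> a -> g @ F --> b -> (fun z => vec2 (f z) (g z)) @ F --> vec2 a b.
Proof.
move=> fa gb; apply/cvgrPdist_lt => e e0; near=> z.
rewrite [ltLHS]/Num.Def.normr/= mx_normrE (bigmax_lt _ e0)//= => -[i j] _.
rewrite !mxE /=; case: ifP => _.
- by near: z; exact: (cvgrPdist_lt _ _).1 fa e e0.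
- by near: z; exact: (cvgrPdist_lt _ _).1 gb e e0.
Unshelve. all: by end_near. Qed.

(** Plane-valued maps are handled through their two components. *)
Definition smooth2 (V : normedModType R) (F : V -> 'rV[R]_2) :=
  exists f g, [/\ elem f, elem g & F = fun z => vec2 (f z) (g z)].

Lemma smooth2_on (V : normedModType R) (F : V -> 'rV[R]_2) (U : set V) :
  smooth2 F -> smooth_on U F.
Proof.
move=> sF vs x _; move: F sF vs x I.
apply: smooth_coind => F [f [g [ef eg ->]]].
have [cf df Ef] := elemP ef; have [cg dg Eg] := elemP eg.
split=> [x|x v|v].
- by apply: vec2_cvg; [exact: cf|exact: cg].
- exact: vec2_derivable.
- exists (fun x => 'D_v f x), (fun x => 'D_v g x); split=> //.
  by apply/funext => x; rewrite vec2_derive.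
Qed.

End smooth_calculus.

(** * Angles on the circle *)

Section circle.
Context {R : realType}.
Implicit Types (a b t x : R).

Lemma int_small (x : R) : x \is a Num.int -> `|x| < 1 -> x = 0.
Proof.
move=> xi; rewrite ltNge; apply: contraNeq => x0; exact: norm_intr_ge1.
Qed.

Lemma IVT_line (f : R -> R) a b v : continuous f -> a <= b ->
  (f a <= v <= f b) || (f b <= v <= f a) -> exists2 c, a <= c <= b & f c = v.
Proof.
move=> cf ab h; have [||c] := @IVT R f a b v ab.
- by apply: continuous_subspaceT => z; exact: cf.
- rewrite ge_min le_max; case/orP: h => /andP[-> ->] //=; by rewrite !orbT.
- by rewrite in_itv /= => cab e; exists c.
Qed.

Lemma int_continuous_const (f : R -> R) :
  continuous f -> (forall t, f t \is a Num.int) -> forall s t, f s = f t.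
Proof.
move=> cf fi.
suff H s t : s <= t -> f s = f t.
  by move=> s t; case: (leP s t) => [/H//|/ltW /H].
move=> st; apply/eqP; rewrite -subr_eq0; apply/eqP/int_small.
  by rewrite rpredB.
rewrite ltNge; apply/negP => f1.
have [v [vi hv]] : exists v, ~~ (v \is a Num.int) /\
    ((f s <= v <= f t) || (f t <= v <= f s)).
  have N x : x \is a Num.int -> ~~ (x + 2^-1 \is a Num.int).
    move=> xi; apply/negP => h; have : (2^-1 : R) \is a Num.int.
      by rewrite -(addKr x 2^-1) rpredD// rpredN.
    by move=> /int_small H; have : (2^-1 : R) = 0; [apply: H; rewrite ger0_norm; lra|lra].
  case: (leP (f s) (f t)) => h.
    exists (f s + 2^-1); split; first exact: N.
    by rewrite ler0_norm in f1; [apply/orP; left; lra|lra].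
  exists (f t + 2^-1); split; first exact: N.
  by rewrite ger0_norm in f1; [apply/orP; right; lra|lra].
have [c _ fc] := IVT_line cf st hv.
by move: vi; rewrite -fc fi.
Qed.

Lemma nonzero_sign (f : R -> R) a b : a <= b ->
  continuous f -> (forall t, a <= t <= b -> f t != 0) -> 0 < f a * f b.
Proof.
move=> ab cf f0; rewrite ltNge; apply/negP => h.
have ha : f a != 0 by apply: f0; rewrite lexx.
have hb : f b != 0 by apply: f0; rewrite lexx andbT.
have : (f a <= 0 <= f b) || (f b <= 0 <= f a) by nra.
by case/(IVT_line cf ab) => c /f0 /eqP.
Qed.

(** Angles are counted in full turns, so that equality of angles is congruence
    modulo integers. *)
Definition cosT (t : R) : R := cos (2 * pi * t).
Definition sinT (t : R) : R := sin (2 * pi * t).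

Lemma cosT2DsinT2 t : cosT t ^+ 2 + sinT t ^+ 2 = 1.
Proof. exact: cos2Dsin2. Qed.

Lemma cosTD a b : cosT (a + b) = cosT a * cosT b - sinT a * sinT b.
Proof. by rewrite /cosT mulrDr cosD. Qed.

Lemma sinTD a b : sinT (a + b) = sinT a * cosT b + cosT a * sinT b.
Proof. by rewrite /sinT mulrDr sinD. Qed.

Lemma cosTN a : cosT (- a) = cosT a.
Proof. by rewrite /cosT mulrN cosN. Qed.

Lemma sinTN a : sinT (- a) = - sinT a.
Proof. by rewrite /sinT mulrN sinN. Qed.

Lemma cosT0 : cosT 0 = 1. Proof. by rewrite /cosT mulr0 cos0. Qed.
Lemma sinT0 : sinT 0 = 0. Proof. by rewrite /sinT mulr0 sin0. Qed.

Lemma cosT_sinT_int t : t \is a Num.int -> cosT t = 1 /\ sinT t = 0.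
Proof.
move=> /intrP[m ->].
have H (n : nat) : cosT n%:R = 1 /\ sinT n%:R = 0.
  elim: n => [|n [IHc IHs]]; first by rewrite cosT0 sinT0.
  have e1 : cosT 1 = 1 by rewrite /cosT mulr1 mulr_natl cos2pi.
  have e2 : sinT 1 = 0 by rewrite /sinT mulr1 mulr_natl sin2pi.
  by rewrite -natr1 cosTD sinTD IHc IHs e1 e2; split; ring.
case: m => n; first exact: H.
by rewrite NegzE mulrNz cosTN sinTN; have [-> ->] := H n.+1; rewrite oppr0.
Qed.

Lemma cosT_periodic t m : m \is a Num.int -> cosT (t + m) = cosT t.
Proof. by move=> /cosT_sinT_int[h1 h2]; rewrite cosTD h1 h2; ring. Qed.

Lemma sinT_periodic t m : m \is a Num.int -> sinT (t + m) = sinT t.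
Proof. by move=> /cosT_sinT_int[h1 h2]; rewrite sinTD h1 h2; ring. Qed.

(** At half the angle the sine has no zero inside a period, which reads off
    the zeros of 1 - cos in [cosT_eq1]. *)
Lemma cosT_sinsq t : cosT t = 1 - 2 * sin (pi * t) ^+ 2.
Proof.
rewrite /cosT -mulrA mulr_natl cos_mulr2n.
by have := cos2Dsin2 (pi * t); set c := cos _; set s := sin _ => H; lra.
Qed.

Lemma cosT_eq1 t : cosT t = 1 -> t \is a Num.int.
Proof.
move=> h; have di : ((Num.floor t)%:~R : R) \is a Num.int by exact: intr_int.
have := floor_itv t; move: di; set n := (Num.floor t)%:~R => di.
rewrite intrD -/n => /andP[f1 f2].
have pi0 := pi_gt0 R.
suff -> : t = n by [].
apply/eqP; case: (eqVneq t n) => // tn.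
have : 0 < sin (pi * (t - n)).
  apply: sin_gt0_pi; have : 0 < t - n by rewrite lt_neqAle eq_sym subr_eq0 tn subr_ge0.
  by move=> h1; rewrite mulr_gt0//= gtr_pMr//; lra.
have : cosT (t - n) = 1 by rewrite cosT_periodic ?rpredN.
by rewrite cosT_sinsq; move: (sin _) => s; nra.
Qed.

Lemma cosT_sinT_inj a b : cosT a = cosT b -> sinT a = sinT b -> a - b \is a Num.int.
Proof.
move=> hc hs; apply: cosT_eq1; rewrite cosTD cosTN sinTN hc hs.
by rewrite mulrN opprK -!expr2 cosT2DsinT2.
Qed.

Lemma twopiK (x : R) : 2 * pi * (x / (2 * pi)) = x.
Proof. by rewrite mulrC divfK// lt0r_neq0// mulr_gt0// pi_gt0. Qed.

Lemma cosT_sinT_surj (u v : R) : u ^+ 2 + v ^+ 2 = 1 -> exists t, u = cosT t /\ v = sinT t.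
Proof.
move=> uv; have pi0 := pi_gt0 R.
have u1 : -1 <= u <= 1 by nra.
have E := twopiK.
case: (leP 0 v) => v0.
  exists (acos u / (2 * pi)); rewrite /cosT /sinT E acosK ?in_itv//= sin_acos//.
  split=> //; rewrite (_ : 1 - u ^+ 2 = v ^+ 2); last by lra.
  by rewrite sqrtr_sqr ger0_norm.
exists (- (acos u / (2 * pi))); rewrite /cosT /sinT mulrN E sinN cosN.
rewrite acosK ?in_itv//= sin_acos//.
split=> //; rewrite (_ : 1 - u ^+ 2 = v ^+ 2); last by lra.
by rewrite sqrtr_sqr ltr0_norm// opprK.
Qed.

(** The signed angle from (u, v) to (u', v'), for unit vectors whose scalar
    product is positive; unlike a choice of arguments of the two vectors, it
    is continuous. *)
Definition angle (u v u' v' : R) : R :=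
  atan ((u * v' - v * u') / (u * u' + v * v')) / (2 * pi).

Lemma angleP t u' v' : u' ^+ 2 + v' ^+ 2 = 1 -> 0 < cosT t * u' + sinT t * v' ->
  u' = cosT (t + angle (cosT t) (sinT t) u' v') /\
  v' = sinT (t + angle (cosT t) (sinT t) u' v').
Proof.
move=> h d0; have pi0 := pi_gt0 R.
have E := twopiK.
have := cosT2DsinT2 t; rewrite cosTD sinTD /angle.
move: (cosT t) (sinT t) d0 => c s; rewrite /cosT /sinT !E.
set d := c * u' + _; set w := c * v' - _ => d0 cs.
have dw : d ^+ 2 + w ^+ 2 = 1.
  rewrite -[RHS](mulr1 1) -{1}cs -h /d /w; ring.
have ec : cos (atan (w / d)) = d.
  rewrite cos_atan (_ : 1 + _ = d ^- 2); last first.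
    clearbody d w; rewrite -[RHS]mul1r -[X in _ = X * _]dw.
    by field; exact: lt0r_neq0.
  by rewrite sqrtrV ?exprn_ge0 ?ltW// sqrtr_sqr gtr0_norm// invrK.
have es : sin (atan (w / d)) = w.
  have cn : cos (atan (w / d)) != 0 by rewrite ec lt0r_neq0.
  have := atanK (w / d); rewrite /tan => /(congr1 ( *%R^~ (cos (atan (w / d))))).
  by rewrite mulfVK// ec mulfVK// lt0r_neq0.
by rewrite ec es /d /w; split; rewrite -[LHS]mulr1 -cs; ring.
Qed.

Definition clamp (x : R) : R := Num.max 0 (Num.min 1 x).
(** The retraction of the plane onto the unit square. Maps invariant under it
    are maps on the square that need no domain restriction. *)
Definition clamp2 (p : R * R) : R * R := (clamp p.1, clamp p.2).

Lemma clamp01 x : 0 <= clamp x <= 1.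
Proof. by rewrite /clamp le_max lexx /= ge_max ler01 ge_min lexx. Qed.

Lemma clamp_id x : 0 <= x <= 1 -> clamp x = x.
Proof. by move=> /andP[h1 h2]; rewrite /clamp min_r// max_r. Qed.

Lemma clampK x : clamp (clamp x) = clamp x.
Proof. by rewrite clamp_id// clamp01. Qed.

Lemma clamp2K p : clamp2 (clamp2 p) = clamp2 p.
Proof. by rewrite /clamp2 /= !clampK. Qed.

Lemma continuous_clamp : continuous clamp.
Proof.
move=> x.
have h : {for x, continuous ((fun=> 1 : R^o) \min (id : R -> R^o))}.
  by apply: continuous_min; [exact: cst_continuous|exact: cvg_id].
have h0 : {for x, continuous (fun=> 0 : R^o)} by exact: cst_continuous.
have H := continuous_max h0 h.
exact H.
Qed.

Lemma continuous_clamp2 : continuous clamp2.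
Proof.
move=> p; apply: (@cvg_pair _ _ _ _ (nbhs (clamp p.1)) (nbhs (clamp p.2))).
- by apply: continuous_comp; [exact: cvg_fst|exact: continuous_clamp].
- by apply: continuous_comp; [exact: cvg_snd|exact: continuous_clamp].
Qed.

End circle.

(** * Lifting unit vectors to angles over a square *)

Section lifting.
Context {R : realType}.

Lemma continuousD2 (T : topologicalType) (f g : T -> R) :
  continuous f -> continuous g -> continuous (fun x => f x + g x).
Proof. by move=> cf cg x; apply: cvgD; [exact: cf|exact: cg]. Qed.

Lemma continuousM2 (T : topologicalType) (f g : T -> R) :
  continuous f -> continuous g -> continuous (fun x => f x * g x).
Proof. by move=> cf cg x; apply: cvgM; [exact: cf|exact: cg]. Qed.

Lemma continuousN1 (T : topologicalType) (f : T -> R) :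
  continuous f -> continuous (fun x => - f x).
Proof. by move=> cf x; apply: cvgN; exact: cf. Qed.

Lemma continuousV1 (T : topologicalType) (f : T -> R) :
  continuous f -> (forall x, f x != 0) -> continuous (fun x => (f x)^-1).
Proof. by move=> cf f0 x; apply: cvgV; [exact: f0|exact: cf]. Qed.

Lemma continuous_comp2 (T U V : topologicalType) (f : T -> U) (g : U -> V) :
  continuous f -> continuous g -> continuous (fun x => g (f x)).
Proof. by move=> cf cg x; apply: continuous_comp; [exact: cf|exact: cg]. Qed.

(** Uniform continuity on the compact square, at the one scale that is needed. *)
Lemma unif_clamp (u : R * R -> R) : continuous u ->
  \forall d \near (0 : R)^'+, forall x, (`[0, 1] `*` `[0, 1]) x ->
    forall y, `|x.1 - y.1| < d -> `|x.2 - y.2| < d -> `|u x - u y| < 2^-1.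
Proof.
move=> cu.
have K : compact (`[(0:R), 1] `*` `[(0:R), 1]).
  by apply: compact_setX; exact: segment_compact.
move/compact_near_coveringP: K => /(_ R (0 : R)^'+
  (fun d x => forall y, `|x.1 - y.1| < d -> `|x.2 - y.2| < d ->
    `|u x - u y| < 2^-1) _); apply => x _.
have /cvgrPdist_lt /(_ 4^-1) := cu x; rewrite invr_gt0 => /(_ ltac:(lra)).
move=> /nbhs_ballP[/= e e0 He].
have e2 : 0 < e / 2 by lra.
near=> x' d => y h1 h2.
have [xx1 xx2] : ball x (e / 2) x' by near: x'; exact: nbhsx_ballx.
have de : d < e / 2 by near: d; exact: nbhs_right_lt.
have xe : ball x e x' by split; [apply: le_ball xx1|apply: le_ball xx2]; lra.
have ye : ball x e y.
  by split; rewrite [e]splitr; [apply: ball_triangle xx1 _|apply: ball_triangle xx2 _];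
    apply: lt_trans de.
have {xe}xe := He _ xe; have {ye}ye := He _ ye; rewrite /= in xe ye.
rewrite -(subrKA (u x)) (le_lt_trans (ler_normD _ _))// distrC.
by rewrite (_ : 2^-1 = 4^-1 + 4^-1); [exact: ltrD|lra].
Unshelve. all: by end_near. Qed.

(** Cut the segment from the origin to p into N equal steps, with N so large
    that two consecutive values of (u, v) form an acute angle. The sum of
    these N signed angles is continuous in p and lifts the change of (u, v)
    along the segment. *)
Lemma lift_unit (u v : R * R -> R) : continuous u -> continuous v ->
  (forall p, u p ^+ 2 + v p ^+ 2 = 1) ->
  (forall p, u (clamp2 p) = u p) -> (forall p, v (clamp2 p) = v p) ->
  exists th : R * R -> R, continuous th /\
    forall p, u p = cosT (th p) /\ v p = sinT (th p).
Proof.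
move=> cu cv uv uc vc.
have [d d0 Hd] : exists2 d : R, 0 < d & forall x, (`[0, 1] `*` `[0, 1]) x ->
    forall y, `|x.1 - y.1| < d -> `|x.2 - y.2| < d ->
    `|u x - u y| < 2^-1 /\ `|v x - v y| < 2^-1.
  near (0 : R)^'+ => d; exists d; first by near: d; exact: nbhs_right_gt.
  move=> x Kx y h1 h2; split.
    move: x Kx y h1 h2; near: d; exact: unif_clamp.
  move: x Kx y h1 h2; near: d; exact: unif_clamp.
pose N := (Num.trunc d^-1).+1.
have N0 : 0 < N%:R :> R by rewrite ltr0n.
have Nd : N%:R^-1 < d by rewrite invf_plt ?posrE// truncnS_gt.
pose X i (p : R * R) : R * R :=
  (i%:R / N%:R * clamp p.1, i%:R / N%:R * clamp p.2).
have cX i : continuous (X i).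
  move=> p; apply: (@cvg_pair _ _ _ _ (nbhs _) (nbhs _)).
    apply: cvgM; first exact: cvg_cst.
    by apply: continuous_comp; [exact: cvg_fst|exact: continuous_clamp].
  apply: cvgM; first exact: cvg_cst.
  by apply: continuous_comp; [exact: cvg_snd|exact: continuous_clamp].
(* Unit vectors whose components differ by less than 1/2 have a positive
   scalar product. *)
have dot i p : (i < N)%N ->
    0 < u (X i p) * u (X i.+1 p) + v (X i p) * v (X i.+1 p).
  move=> iN; have i01 : 0 <= (i%:R / N%:R : R) <= 1.
      apply/andP; split; first exact/divr_ge0.
    by rewrite ler_pdivrMr// mul1r ler_nat ltnW.
  have M a : 0 <= (i%:R / N%:R * clamp a : R) <= 1.
    have /andP[i0 i1] := i01; have /andP[a0 a1] := clamp01 a.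
    by rewrite mulr_ge0//= mulr_ile1.
  have step a : `|i%:R / N%:R * clamp a - i.+1%:R / N%:R * clamp a| < d.
    have /andP[a0 a1] := clamp01 a.
    rewrite -mulrBl -mulrBl -natr1 opprD addNKr mulN1r mulNr normrN.
    rewrite ger0_norm; last by rewrite mulr_ge0// invr_ge0 ltW.
    by apply: le_lt_trans Nd; rewrite ger_pMr ?invr_gt0.
  have [] := Hd (X i p) _ (X i.+1 p) (step _) (step _).
    by split; rewrite /= in_itv; exact: M.
  have := uv (X i p); have := uv (X i.+1 p).
  move: (u _) (u _) (v _) (v _) => a b c e h1 h2.
  by rewrite !ltr_norml => /andP[h3 h4] /andP[h5 h6]; nra.
have [t0 [ut0 vt0]] := cosT_sinT_surj (uv (0, 0)).
pose A i p := angle (u (X i p)) (v (X i p)) (u (X i.+1 p)) (v (X i.+1 p)).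
have H k p : (k <= N)%N -> u (X k p) = cosT (t0 + \sum_(i < k) A i p) /\
    v (X k p) = sinT (t0 + \sum_(i < k) A i p).
  elim: k => [|k IH] kN.
    by rewrite big_ord0 addr0 /X mul0r !mul0r.
  rewrite big_ord_recr /= addrA; have [h1 h2] := IH (ltnW kN).
  rewrite {2 4}/A h1 h2; apply: angleP; first exact: uv.
  by rewrite -h1 -h2; exact: dot.
exists (fun p => t0 + \sum_(i < N) A i p); split.
  apply: continuousD2; first exact: cst_continuous.
  have Hs (k : nat) : (k <= N)%N -> continuous (fun p => \sum_(i < k) A i p).
    elim: k => [_|k IH kN].
      by under eq_fun do rewrite big_ord0; exact: cst_continuous.
    under eq_fun do rewrite big_ord_recr /=.
    apply: continuousD2; first exact/IH/ltnW.
    have cu' i := continuous_comp2 (cX i) cu.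
    have cv' i := continuous_comp2 (cX i) cv.
    apply: continuousM2; last exact: cst_continuous.
    apply: continuous_comp2; last exact: continuous_atan.
    apply: continuousM2.
      by apply: continuousD2; [|apply: continuousN1]; apply: continuousM2.
    apply: continuousV1; last by move=> x; rewrite lt0r_neq0// dot.
    by apply: continuousD2; apply: continuousM2.
  exact: Hs.
move=> p; have := H N p (leqnn _).
by rewrite /X divff ?lt0r_neq0// !mul1r -/(clamp2 p) uc vc.
Unshelve. all: by end_near. Qed.

End lifting.

(** * The torus as a Riemann surface *)

Section torus_def.
Variable R : realType.

(** The quotient R^2/Z^2, each class being given by its representative in [0,
    1)^2; the topology below is the quotient topology. *)
Record torus := Torus {
  trep : 'rV[R]_2;
  trepP : (Num.floor (trep 0 0) == 0) && (Num.floor (trep 0 1) == 0) }.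

HB.instance Definition _ := gen_eqMixin torus.
HB.instance Definition _ := gen_choiceMixin torus.

Definition frac (x : R) : R := x - (Num.floor x)%:~R.

Lemma floor_frac x : Num.floor (frac x) == 0.
Proof.
by rewrite /frac -mulrNz floorDrz ?intr_int// intrKfloor subrr.
Qed.

Lemma tprojP (p : 'rV[R]_2) : let q := vec2 (frac (p 0 0)) (frac (p 0 1)) in
  (Num.floor (q 0 0) == 0) && (Num.floor (q 0 1) == 0).
Proof. by rewrite /= !vec2E !floor_frac. Qed.

(** The projections to and from the torus are locked, so that unification does
    not unfold their floor functions. *)
Fact tproj_key : unit. Proof. by []. Qed.
Definition tproj : 'rV[R]_2 -> torus :=
  locked_with tproj_key (fun p => Torus (tprojP p)).

Lemma trep_tproj (p : 'rV[R]_2) :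
  trep (tproj p) = vec2 (frac (p 0 0)) (frac (p 0 1)).
Proof. by rewrite /tproj unlock. Qed.

Definition torus_open (A : set torus) := open (tproj @^-1` A).

Lemma torus_openT : torus_open setT.
Proof. exact: openT. Qed.

Lemma torus_openI : setI_closed torus_open.
Proof. by move=> A B oA oB; apply: openI. Qed.

Lemma torus_open_bigU (I : Type) (f : I -> set torus) :
  (forall i, torus_open (f i)) -> torus_open (\bigcup_i f i).
Proof. by move=> fo; rewrite /torus_open preimage_bigcup; apply: bigcup_open => i _; exact: fo. Qed.

HB.instance Definition _ := isOpenTopological.Build torus
  torus_openT torus_openI torus_open_bigU.

End torus_def.
Arguments tproj {R}.

Section torus.
Context {R : realType}.
Local Notation V := 'rV[R]_2.
Local Notation T := (torus R).
Implicit Types (p q : 'rV[R]_2) (x y : T).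

Lemma trep_inj : injective (@trep R).
Proof.
move=> [p hp] [q hq] /= e; case: _ / e hq => hq; congr Torus.
exact: bool_irrelevance.
Qed.

Lemma ord2P (i : 'I_2) : i = 0 \/ i = 1.
Proof. by case: i => -[|[|//]] hi; [left|right]; exact/val_inj. Qed.

Definition latt (m : V) := (m 0 0 \is a Num.int) && (m 0 1 \is a Num.int).

Lemma latt0 : latt 0. Proof. by rewrite /latt !mxE rpred0. Qed.
Lemma lattD m n : latt m -> latt n -> latt (m + n).
Proof. by move=> /andP[h1 h2] /andP[h3 h4]; rewrite /latt !mxE !rpredD. Qed.
Lemma lattN m : latt m -> latt (- m).
Proof. by move=> /andP[h1 h2]; rewrite /latt !mxE !rpredN h1. Qed.
Lemma frac_int (a b : R) : a - b \is a Num.int -> frac a = frac b.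
Proof.
move=> h; rewrite /frac -{1 2}(subrK b a) floorDzr// intrD floorK//.
ring.
Qed.

Lemma latt_trep p : latt (trep (tproj p) - p).
Proof.
have H (a : R) : frac a - a \is a Num.int.
  by rewrite /frac addrAC subrr add0r rpredN intr_int.
by rewrite /latt trep_tproj !mxE /= !H.
Qed.

Lemma tproj_eq p q : tproj p = tproj q <-> latt (p - q).
Proof.
split=> [e|/andP[]].
  by rewrite -(subrKA (trep (tproj p))) {2}e; apply: lattD;
    rewrite ?latt_trep// -opprB lattN// latt_trep.
rewrite !mxE => h1 h2; apply: trep_inj; rewrite !trep_tproj (frac_int h1).
by rewrite (frac_int h2).
Qed.

Lemma trepK x : tproj (trep x) = x.
Proof.
apply: trep_inj; rewrite trep_tproj; apply: vec2_eqP; rewrite vec2E /frac;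
by case: x => p /= /andP[/eqP e0 /eqP e1]; rewrite ?e0 ?e1 subr0.
Qed.

Lemma tproj_continuous : continuous (@tproj R).
Proof. by apply/continuousP => A oA; exact: oA. Qed.

Lemma shift_continuous (m : V) : continuous (fun q : V => q + m).
Proof. by move=> q; exact: (cvgD cvg_id (cvg_cst _)). Qed.

(** The saturation of an open set is the union of its translates. *)
Lemma tproj_open (O : set V) : open O -> open (tproj @` O).
Proof.
move=> oO; change (open (tproj @^-1` (tproj @` O))).
rewrite (_ : tproj @^-1` _ = \bigcup_(m in [set m | latt m]) ((fun q => q + m) @^-1` O)).
  apply: bigcup_open => m _; apply: (@open_comp _ _ (fun q => q + m)) => // q _.
  exact: shift_continuous.
apply/seteqP; split=> [q [p Op /tproj_eq e]|q [m lm Oq]].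
  by exists (p - q) => //=; rewrite addrC subrK.
by exists (q + m) => //; apply/tproj_eq; rewrite addrC addKr.
Qed.

Lemma near_tproj (A : set T) q :
  (\forall q' \near q, A (tproj q')) -> nbhs (tproj q) A.
Proof.
move=> /nbhs_interior h; rewrite nbhsE /=.
exists (tproj @` (interior (tproj @^-1` A))).
  by split; [apply: tproj_open; exact: open_interior|exists q => //; exact: nbhs_singleton h].
by move=> _ [p /interior_subset h' <-].
Qed.

Lemma tproj_continuous_at (U : topologicalType) (f : T -> U) q :
  {for q, continuous (f \o tproj)} -> {for tproj q, continuous f}.
Proof. by move=> cf W /= Wf; apply: near_tproj; exact: cf. Qed.

(** The representative of t modulo 1 in [a - 1/2, a + 1/2); around a it
    depends continuously on the class of t. *)
Definition nearest (a t : R) : R := t - (Num.floor (t - a + 2^-1))%:~R.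

Lemma nearest_int (a t : R) : nearest a t - t \is a Num.int.
Proof. by rewrite /nearest addrAC subrr add0r rpredN intr_int. Qed.

Lemma nearestE (a t y : R) : `|y - a| < 2^-1 -> y - t \is a Num.int ->
  nearest a t = y.
Proof.
move=> ya yx; apply/eqP; rewrite -subr_eq0; apply/eqP/int_small.
  by rewrite -(subrKA t) rpredD// ?nearest_int// -opprB rpredN.
have := floor_itv (t - a + 2^-1); rewrite intrD /nearest.
move: (_%:~R) ya => n; rewrite !ltr_norml => /andP[h1 h2] /andP[h3 h4].
by apply/andP; split; lra.
Qed.

(** There is one chart for each centre a in R^2: it sends a class to its
    representative in the unit square around a, and is a chart on the interior
    of that square. *)
Fact tcrd_key : unit. Proof. by []. Qed.
Definition tcrd : V -> T -> V := locked_with tcrd_key (fun a x =>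
  vec2 (nearest (a 0 0) (trep x 0 0)) (nearest (a 0 1) (trep x 0 1))).

Lemma tcrd_nearest a x : tcrd a x =
  vec2 (nearest (a 0 0) (trep x 0 0)) (nearest (a 0 1) (trep x 0 1)).
Proof. by rewrite /tcrd unlock. Qed.

Definition box (a q : V) := `|q 0 0 - a 0 0| < 2^-1 /\ `|q 0 1 - a 0 1| < 2^-1.

Lemma box_center a : box a a.
Proof. by rewrite /box !subrr normr0; split; lra. Qed.

Lemma tcrd_latt a x : latt (tcrd a x - trep x).
Proof. by rewrite /latt tcrd_nearest !mxE /= !nearest_int. Qed.

Lemma latt_tcrd_tproj a q : latt (tcrd a (tproj q) - q).
Proof.
by rewrite -(subrKA (trep (tproj q))) lattD ?tcrd_latt ?latt_trep.
Qed.

Lemma tcrdE a q (y : V) : box a y -> latt (y - q) -> tcrd a (tproj q) = y.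
Proof.
move=> [h1 h2] l.
have /andP[l1 l2] : latt (y - trep (tproj q)).
  by rewrite -(subrKA q) lattD// -opprB lattN// latt_trep.
by rewrite tcrd_nearest; apply: vec2_eqP; rewrite vec2E; apply: nearestE => //; move: l1 l2; rewrite !mxE.
Qed.

Lemma tproj_tcrd a x : tproj (tcrd a x) = x.
Proof. by rewrite -[RHS]trepK; apply/tproj_eq; exact: tcrd_latt. Qed.

Lemma box_near a q : box a q -> \forall q' \near q, box a q'.
Proof.
have H i (c : R) : `|q 0 i - c| < 2^-1 ->
    \forall q' \near q, `|(q' : V) 0 i - c| < 2^-1.
  move=> h; have : (fun q' : V => `|q' 0 i - c|) @ q --> `|q 0 i - c|.
    exact: (cvg_norm (cvgB (@coord_continuous _ _ _ 0 i q) (cvg_cst c))).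
  by move=> /cvgr_lt; apply.
by move=> [h1 h2]; apply: filterS2 (H _ _ h1) (H _ _ h2).
Qed.

Definition tdom a : set T := [set x | box a (tcrd a x)].

(** In the plane, a chart is locally a translation by a lattice vector. The
    smoothness and holomorphy of transition maps, and the invariance of
    velocities, all come from this. *)
Lemma tcrd_near d q : tdom d (tproj q) ->
  \forall q' \near q, tdom d (tproj q') /\
    tcrd d (tproj q') = q' + (tcrd d (tproj q) - q).
Proof.
move=> dq; set m := tcrd d (tproj q) - q.
have lm : latt m by exact: latt_tcrd_tproj.
have : \forall q' \near q, box d (q' + m).
  have : box d (q + m) by rewrite /m addrC subrK.
  move=> /box_near h.
  have : (fun q' => q' + m) @ q --> q + m by exact: shift_continuous.
  by apply.
apply: filterS => q' b; have e : tcrd d (tproj q') = q' + m.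
  by apply: tcrdE => //; rewrite addrC addKr.
by split=> //; rewrite /tdom /= e.
Qed.

Lemma tdom_open a : open (tdom a).
Proof.
rewrite openE => x; rewrite -(trepK x) => /tcrd_near h.
by apply: near_tproj; apply: filterS h => q' [].
Qed.

Lemma tdom_cover x : exists a, tdom a x.
Proof.
have := @tcrdE (trep x) (trep x) (trep x) (box_center _).
rewrite trepK subrr latt0 => /(_ isT) e.
by exists (trep x); rewrite /tdom /= e; exact: box_center.
Qed.

Lemma tcrd_img a (U : set T) q : (tcrd a @` (tdom a `&` U)) q <-> box a q /\ U (tproj q).
Proof.
split=> [[x [dx Ux] <-]|[bq Uq]]; first by rewrite tproj_tcrd.
have e : tcrd a (tproj q) = q by apply: tcrdE => //; rewrite subrr latt0.
by exists (tproj q); rewrite // /tdom /= e.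
Qed.

Lemma tcrd_continuous_at a x : tdom a x -> {for x, continuous (tcrd a)}.
Proof.
rewrite -(trepK x) => /tcrd_near h; apply: tproj_continuous_at.
apply: (@near_eq_continuous_at _ _ (fun q' => q' + (tcrd a (tproj (trep x)) - trep x))).
  by apply: filterS h => q' [_ e] /=; rewrite e.
exact: shift_continuous.
Qed.

Lemma elem_coord i : elem (fun q : V => q 0 i).
Proof.
apply: (@elem_lin _ _ _ (fun v : V => v 0 i)); first exact: coord_continuous.
move=> x v; have := @derivable_id R V x v => /derivable_mxP d.
have := derive_id x v; rewrite derive_mx; last exact: derivable_id.
move=> /(congr1 (fun M : V => M 0 i)); rewrite mxE => e.
by apply: DeriveDef; [exact: d|exact: e].
Qed.

Lemma smooth2_shift (m : V) : smooth2 (fun q : V => q + m).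
Proof.
exists (fun q => q 0 0 + m 0 0), (fun q => q 0 1 + m 0 1); split.
- by apply: elemD; [exact: elem_coord|exact: elemC].
- by apply: elemD; [exact: elem_coord|exact: elemC].
- by apply/funext => q; apply: vec2_eqP; rewrite !mxE.
Qed.

Lemma tcrd_shift_derive d q v : tdom d (tproj q) -> 'D_v (tcrd d \o tproj) q = v.
Proof.
move=> /tcrd_near h.
rewrite (@near_eq_derive _ _ _ _ (fun q' => q' + (tcrd d (tproj q) - q))).
  by rewrite deriveD// derive_id derive_cst addr0.
by apply: filterS h => q' [].
Qed.

Lemma trep_periodic_continuous (g : R -> R) i :
  (forall t m, m \is a Num.int -> g (t + m) = g t) ->
  continuous g -> continuous (fun x : T => g (trep x 0 i)).
Proof.
move=> gp cg z; rewrite -(trepK z); apply: tproj_continuous_at.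
rewrite (_ : _ \o _ = fun q : V => g (q 0 i)).
  apply: continuous_comp; [exact: coord_continuous|exact: cg].
apply/funext => q /=; have /andP[l0 l1] := latt_trep q.
have li : (trep (tproj q) - q) 0 i \is a Num.int.
  by case: (ord2P i) => ->.
have e (m : V) : m 0 i = q 0 i + (m - q) 0 i by rewrite !mxE; ring.
by rewrite e gp.
Qed.

Lemma continuous_cosT : continuous (@cosT R).
Proof.
by apply: continuous_comp2 (@continuous_cos R) => t; apply: cvgM; [exact: cvg_cst|exact: cvg_id].
Qed.

Lemma continuous_sinT : continuous (@sinT R).
Proof.
by apply: continuous_comp2 (@continuous_sin R) => t; apply: cvgM; [exact: cvg_cst|exact: cvg_id].
Qed.

(** The cosines and sines of the two coordinates are continuous functions that
    separate points. *)
Lemma torus_hausdorff : hausdorff_space T.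
Proof.
move=> x y cl.
have H (f : T -> R) : continuous f -> f x = f y.
  move=> cf; apply: (@norm_hausdorff _ R) => A B Ax By.
  have [z [Az Bz]] := cl _ _ (cf x _ Ax) (cf y _ By).
  by exists (f z).
rewrite -(trepK x) -(trepK y); apply/tproj_eq; rewrite /latt !mxE.
by apply/andP; split; apply: cosT_sinT_inj;
  (apply: (H (fun x => cosT (trep x 0 _))) || apply: (H (fun x => sinT (trep x 0 _))));
  apply: trep_periodic_continuous => // t m; [exact: cosT_periodic|exact: continuous_cosT|exact: sinT_periodic|exact: continuous_sinT|exact: cosT_periodic|exact: continuous_cosT|exact: sinT_periodic|exact: continuous_sinT].
Qed.

Lemma torus_compact : compact [set: T].
Proof.
rewrite (_ : setT = tproj @` [set v : V | forall i, `[0 : R, 1]%classic (v 0 i)]).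
  apply: continuous_compact; last by apply: (@rV_compact R 2 (fun=> `[0 : R, 1]%classic)) => i; exact: segment_compact.
  by apply: continuous_subspaceT; exact: tproj_continuous.
apply/seteqP; split=> // x _; exists (trep x); last exact: trepK.
have F (t : R) : Num.floor t == 0 -> `[0 : R, 1]%classic t.
  move=> /eqP e; have := floor_itv t; rewrite e /= in_itv /=.
  by rewrite add0r => /andP[-> /ltW ->].
by move=> i; case: x => p /= /andP[h0 h1]; case: (ord2P i) => ->; exact: F.
Qed.

(** Every class lies on the image of a line through the origin. *)
Lemma torus_connected : connected [set: T].
Proof.
rewrite (_ : setT = \bigcup_(p in [set: V]) ((fun t : R => tproj (t *: p)) @` setT)).
  apply: bigcup_connected.
    by exists (tproj 0) => p _; exists 0; rewrite // scale0r.
  move=> p _; apply: connected_continuous_connected.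
    by apply/connected_intervalP => a b _ _ c.
  apply: continuous_subspaceT; apply: continuous_comp2 tproj_continuous => t.
  by apply: cvgZr_tmp; exact: cvg_id.
apply/seteqP; split=> // x _; exists (trep x) => //; exists 1 => //.
by rewrite scale1r trepK.
Qed.

Lemma torus_transition_smooth c d :
  smooth_on (tcrd c @` (tdom c `&` tdom d)) (tcrd d \o tproj).
Proof.
apply: smooth_on_local => q /tcrd_img[_ dq].
exists (fun q' => q' + (tcrd d (tproj q) - q)); split.
  exact/smooth2_on/smooth2_shift.
by apply: filterS (tcrd_near dq) => q' [].
Qed.

Lemma torus_img_open c : open (tcrd c @` tdom c).
Proof.
rewrite openE => q [x dx <-]; rewrite /interior /=.
apply: filterS (box_near dx) => q' b.
by have [y [h _] <-] := (tcrd_img c setT q').2 (conj b I); exists y.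
Qed.

Definition torus_surface : riemann_surface R.
refine (@RiemannSurface R T torus_hausdorff torus_compact torus_connected V
  tdom tcrd (fun=> tproj) tdom_cover tdom_open torus_img_open _ _ _
  torus_transition_smooth _).
- by move=> c x _; exact: tproj_tcrd.
- move=> c; apply: continuous_in_subspaceT => x; rewrite inE => dx.
  exact: tcrd_continuous_at.
- by move=> c; apply: continuous_subspaceT; exact: tproj_continuous.
- move=> c d x cx dx.
  have dx' : tdom d (tproj (tcrd c x)) by rewrite tproj_tcrd.
  rewrite !tcrd_shift_derive//; apply: vec2_eqP; rewrite !mxE /=.
    by rewrite oppr0.
  by [].
Defined.

End torus.

(** * A contact circle bundle over the torus *)

Section bundle.
Context {R : realType}.
Local Notation V := 'rV[R]_2.
Local Notation T := (torus_surface (R := R)).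

Lemma elem_cosT (W : normedModType R) (f : W -> R) : elem f -> elem (fun x => cosT (f x)).
Proof. by move=> ef; apply: elem_cos; apply: elemM => //; exact: elemC. Qed.

Lemma elem_sinT (W : normedModType R) (f : W -> R) : elem f -> elem (fun x => sinT (f x)).
Proof. by move=> ef; apply: elem_sin; apply: elemM => //; exact: elemC. Qed.

Lemma is_derive_twopi (t : R) : is_derive t 1 (fun t => 2 * pi * t) (2 * pi).
Proof.
have /= := @is_deriveZ R R R id (2 * pi) t 1 1 (is_derive_id _ _).
by rewrite /GRing.scale/= mulr1; exact.
Qed.

Lemma is_derive_cosT (t : R) : is_derive t 1 (@cosT R) (- (2 * pi * sinT t)).
Proof.
rewrite -mulrN; apply: (@is_derive_comp1 _ _ (fun t => 2 * pi * t) (@cos R)).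
exact: is_derive_twopi.
Qed.

Lemma is_derive_sinT (t : R) : is_derive t 1 (@sinT R) (2 * pi * cosT t).
Proof.
apply: (@is_derive_comp1 _ _ (fun t => 2 * pi * t) (@sin R)).
exact: is_derive_twopi.
Qed.

Definition circle_point (t : R) : V := vec2 (cosT t) (sinT t).

Lemma circle_point_int t m : m \is a Num.int -> circle_point (t + m) = circle_point t.
Proof. by move=> h; rewrite /circle_point cosT_periodic// sinT_periodic. Qed.

Lemma circle_point_derive (W : normedModType R) (f : W -> R) x v :
  derivable f x v -> 'D_v (fun z => circle_point (f z)) x =
    vec2 (- (2 * pi * sinT (f x)) * 'D_v f x) (2 * pi * cosT (f x) * 'D_v f x).
Proof.
move=> df.
have [hc ec] := is_derive_comp1 (derivableP df) (is_derive_cosT (f x)).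
have [hs es] := is_derive_comp1 (derivableP df) (is_derive_sinT (f x)).
by rewrite vec2_derive// ec es mulrC [X in vec2 _ X]mulrC.
Qed.

Lemma wedge_circle_point (W : normedModType R) (f : W -> R) x v : derivable f x v ->
  wedge2 (circle_point (f x)) ('D_v (fun z => circle_point (f z)) x) = 2 * pi * 'D_v f x.
Proof.
move=> df; rewrite circle_point_derive// /wedge2 !vec2E.
by rewrite -[RHS]mulr1 -(cosT2DsinT2 (f x)); ring.
Qed.

Definition expT (t : R) : R[i] := (cosT t +i* sinT t)%C.

Lemma reim_expT t : reim (expT t) = circle_point t.
Proof. by apply: vec2_eqP; rewrite !mxE. Qed.

Lemma expTD a b : expT (a + b) = expT a * expT b.
Proof. by rewrite /expT cosTD sinTD; apply/eqP; rewrite eq_complex /= !eqxx [X in _ == X]addrC eqxx. Qed.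

Lemma expTN a : expT (- a) = (expT a)^*.
Proof. by rewrite /expT cosTN sinTN. Qed.

Lemma expT_int m : m \is a Num.int -> expT m = 1.
Proof. by move=> /cosT_sinT_int[h1 h2]; rewrite /expT h1 h2. Qed.

Lemma expT_unit t : expT t * (expT t)^* = 1.
Proof. by rewrite -expTN -expTD subrr expT_int// rpred0. Qed.

Lemma expTB a b : expT (a - b) = expT a * (expT b)^*.
Proof. by rewrite expTD expTN. Qed.

Lemma expT_eq a b : a - b \is a Num.int -> expT a = expT b.
Proof. by move=> h; rewrite -(subrK b a) expTD expT_int// mul1r. Qed.

Lemma expT_inj a b : expT a = expT b -> a - b \is a Num.int.
Proof. by case=> h1 h2; exact: cosT_sinT_inj. Qed.

(** The fibers of the line bundle are all equal to C, and its twisting lies in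
    the frames: the frame over the chart a is turned by this angle with
    respect to the discontinuous frame 1. When the first coordinate of the
    chart grows by an integer m, the frame is turned by 2 m y, which gives
    Euler number -2. *)
Definition phase (a : V) (x : T) : R :=
  2 * (tcrd a x 0 0 - trep x 0 0) * tcrd a x 0 1.

Lemma coordD (p q : V) i : (p + q) 0 i = p 0 i + q 0 i.
Proof. by rewrite mxE. Qed.

Lemma coordN (p : V) i : (- p) 0 i = - p 0 i.
Proof. by rewrite mxE. Qed.

Lemma lattBP (p q : V) : latt (p - q) ->
  p 0 0 - q 0 0 \is a Num.int /\ p 0 1 - q 0 1 \is a Num.int.
Proof. by move=> /andP; rewrite !mxE. Qed.

(** The discontinuous representative cancels modulo integers, so that the
    change of frame only involves chart coordinates and is smooth. *)
Lemma phaseB e e' x : expT (phase e' x - phase e x) =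
  expT (2 * (tcrd e' x 0 0 - tcrd e x 0 0) * tcrd e x 0 1).
Proof.
apply: expT_eq; rewrite /phase.
have := lattBP (tcrd_latt e' x); have := lattBP (tcrd_latt e x).
set a := tcrd e' x 0 0; set b := tcrd e' x 0 1; set c := tcrd e x 0 0.
set d := tcrd e x 0 1; move: (trep x 0 0) (trep x 0 1) => r s [k0 k1] [l0 l1].
have -> : 2 * (a - r) * b - 2 * (c - r) * d - 2 * (a - c) * d =
  2 * (a - r) * ((b - s) - (d - s)) by ring.
by apply: rpredM; [apply: rpredM => //; exact: rpred_nat|exact: rpredB].
Qed.

Lemma frame_smooth_proof e e' : smooth_from_surface (tdom e `&` tdom e' : set T)
  (fun x => reim (expT (phase e' x) * (expT (phase e x))^*)).
Proof.
move=> c; apply: smooth_on_local => q /tcrd_img[_ [eq e'q]].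
exists (fun q' : V => circle_point (2 * (tcrd e' (tproj q) 0 0 - tcrd e (tproj q) 0 0) *
  (q' 0 1 + (tcrd e (tproj q) - q) 0 1))); split.
  apply: smooth2_on; eexists; eexists; split; last by [].
    apply: elem_cosT; apply: elemM; first exact: elemC.
    by apply: elemD; [exact: elem_coord|exact: elemC].
  apply: elem_sinT; apply: elemM; first exact: elemC.
  by apply: elemD; [exact: elem_coord|exact: elemC].
apply: filterS2 (tcrd_near eq) (tcrd_near e'q) => q' [_ h] [_ h'] /=.
rewrite -expTB phaseB reim_expT h h' !(coordD, coordN); congr (circle_point (2 * _ * _)); ring.
Qed.

Lemma conj_swap (u v : R[i]) : v * u^* = (u * v^*)^*.
Proof. by rewrite rmorphM /= conjCK mulrC. Qed.

Lemma frame_spanE (u f : R[i]) : f * f^* = 1 -> u = (u * f^*) * f.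
Proof. by move=> h; rewrite -mulrA [_^* * _]mulrC h mulr1. Qed.

Definition torus_line : hermitian_line_bundle T.
refine (@HermitianLineBundle R T (fun=> (R[i]^o : lmodType R[i]))
  (fun _ u v => u * v^*) _ _ _ V tdom (fun e x => expT (phase e x))
  tdom_cover tdom_open _ _ frame_smooth_proof).
- by move=> x a u v w; rewrite mulrDl -scalerAl.
- by move=> x u v; exact: conj_swap.
- by move=> x u u0; rewrite mul_conjC_gt0.
- by move=> e x _; exact: expT_unit.
- move=> e x _ u; exists ((u : R[i]) * (expT (phase e x))^*).
  exact: frame_spanE (expT_unit _).
Defined.

(** The form 4 pi x dy, with x read in the chart that goes with the frame. A
    change of frame adds an integer m to x, and the resulting term 4 pi m dy
    is the one that the gauge rule prescribes for a turn by 2 m y. *)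
Definition tform (e c : V) (q : V) : V := vec2 0 (4 * pi * tcrd e (tproj q) 0 0).

Lemma dot2_vec2 (a b : R) v : dot2 (vec2 a b) v = a * v 0 0 + b * v 0 1.
Proof.
have e1 : fintype.lift ord0 ord0 = 1 :> 'I_2 by exact/val_inj.
have e0 : (ord0 : 'I_2) = 0 by exact/val_inj.
by rewrite /dot2 !big_ord_recl big_ord0 addr0 e1 e0 !vec2E.
Qed.

Lemma tform_near e c q : tdom e (tproj q) -> \forall q' \near q,
  tform e c q' = vec2 0 (4 * pi * (q' 0 0 + (tcrd e (tproj q) - q) 0 0)).
Proof.
move=> /tcrd_near h0; apply: filterS h0 => q' [_ h]; by rewrite /tform h !coordD.
Qed.

Definition torus_conn : unitary_connection torus_line.
refine (@UnitaryConnection R T torus_line tform _ _ _).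
- move=> e c; apply: smooth_on_local => q /tcrd_img[_ eq]; eexists; split; last first.
    exact: tform_near.
  apply: smooth2_on; eexists; eexists; split; last by []; first exact: elemC.
  by apply: elemM; [exact: elemC|apply: elemD; [exact: elem_coord|exact: elemC]].
- move=> e c d x ex cx dx v; rewrite /= /tform !dot2_vec2 !tproj_tcrd.
  by rewrite tcrd_shift_derive ?tproj_tcrd// !mul0r.
- move=> e e' c x ex e'x cx v g; rewrite /= /tform !dot2_vec2 !tproj_tcrd !mul0r !add0r.
  set q := tcrd c x; have qx : tproj q = x := tproj_tcrd c x.
  have exq : tdom e (tproj q) by rewrite qx.
  have e'xq : tdom e' (tproj q) by rewrite qx.
  pose f (q' : V) := 2 * (tcrd e' x 0 0 - tcrd e x 0 0) *
    (q' 0 1 + (tcrd e x - q) 0 1).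
  have gf : \forall q' \near q, g q' = circle_point (f q').
    apply: filterS2 (tcrd_near exq) (tcrd_near e'xq) => q' [_ h] [_ h'] /=.
    rewrite /g /= -expTB phaseB reim_expT h h' /f qx !(coordD, coordN); congr (circle_point (2 * _ * _)); ring.
  rewrite (nbhs_singleton gf) (near_eq_derive _ gf).
  have df : is_derive q v f (2 * (tcrd e' x 0 0 - tcrd e x 0 0) * v 0 1).
    have dc : is_derive q v (fun q' : V => q' 0 1) (v 0 1).
      have d := @elem_derivable _ _ _ q v (elem_coord (1 : 'I_2)).
      apply: DeriveDef => //.
      have := derive_id q v; rewrite derive_mx; last exact: derivable_id.
      by move=> h; rewrite -[in RHS]h mxE.
    have dD : is_derive q v (fun q' : V => q' 0 1 + (tcrd e x - q) 0 1) (v 0 1).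
      by rewrite -[X in is_derive _ _ _ X]addr0; apply: is_deriveD.
    by have := @is_deriveZ _ _ _ _ (2 * (tcrd e' x 0 0 - tcrd e x 0 0)) _ _ _ dD.
  rewrite wedge_circle_point; last by case: df.
  by have [_ ->] := df; ring.
Defined.

Definition torus_contact : contact_circle_bundle R.
refine (@ContactCircleBundle R T torus_line torus_conn _).
move=> e c x ex cx; rewrite /curvature /=.
set q := tcrd c x; have qx : tproj q = x := tproj_tcrd c x.
have exq : tdom e (tproj q) by rewrite qx.
have h := tform_near c exq.
rewrite (@near_eq_derive _ _ _ _ (fun q' : V => 4 * pi * (q' 0 0 + (tcrd e (tproj q) - q) 0 0))); last first.
  by apply: filterS h => q' ->; rewrite vec2E.
rewrite (@near_eq_derive _ _ _ (fun q' => tform e c q' 0 0) (fun q' : V => 0)); last first.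
  by apply: filterS h => q' ->; rewrite vec2E.
have pi0 := pi_gt0 R.
have -> : 'D_e_y (fun=> 0 : R) q = 0 by exact: derive_cst.
have dc : is_derive q e_x (fun q' : V => q' 0 0) ((e_x : V) 0 0).
  have d := @elem_derivable _ _ _ q e_x (elem_coord (0 : 'I_2)).
  apply: DeriveDef => //.
  have := derive_id q (e_x : V); rewrite derive_mx; last exact: derivable_id.
  by move=> k; rewrite -[in RHS]k mxE.
have dD : is_derive q e_x (fun q' : V => q' 0 0 + (tcrd e (tproj q) - q) 0 0) ((e_x : V) 0 0).
  by rewrite -[X in is_derive _ _ _ X]addr0; apply: is_deriveD.
have [_ ->] := @is_deriveZ _ _ _ _ (4 * pi) _ _ _ dD.
by rewrite /GRing.scale /= mxE !eqxx /=; lra.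
Defined.

End bundle.

(** * Heisenberg coordinates on the total space *)

Section points.
Context {R : realType}.
Local Notation V := 'rV[R]_2.
Local Notation T := (torus_surface (R := R)).
Local Notation L := (torus_line (R := R)).
Local Notation B := (torus_contact (R := R)).
Local Notation E := (circle_bundle L).
Local Notation int := Num.int.

Definition vec (u : E) : R[i] := bvec u.

Lemma bundle_eq (u v : E) : bproj u = bproj v -> vec u = vec v -> u = v.
Proof.
case: u v => [x u hu] [y v hv] /= e; case: _ / e v hv => v hv.
rewrite /vec /= => e; case: _ / e hv => hv; congr CirclePoint.
exact: Prop_irrelevance.
Qed.

(** The covering of the bundle by R^3. The angle is chosen so that, in the
    frame over a chart where (x, y) is its own coordinate vector, the fiber
    coordinate is w. *)
Definition pt (x y w : R) : E :=
  @CirclePoint R T L (tproj (vec2 x y))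
    (expT (w + 2 * (x - trep (tproj (vec2 x y)) 0 0) * y)) (expT_unit _).

Lemma vec_pt x y w :
  vec (pt x y w) = expT (w + 2 * (x - trep (tproj (vec2 x y)) 0 0) * y).
Proof. by []. Qed.

(** The deck transformations form an integral Heisenberg group: a translation
    of x by m shears w by 2 m y. *)
Lemma pt_eq x y w x' y' w' : pt x y w = pt x' y' w' <->
  [/\ x - x' \is a int, y - y' \is a int & w' - w - 2 * (x - x') * y \is a int].
Proof.
have K (a b r : R) : a - r \is a int -> b \is a int -> 2 * (a - r) * b \is a int.
  by move=> h1 h2; apply: rpredM => //; apply: rpredM => //; exact: rpred_nat.
split=> [e|[h1 h2 h3]].
  have eb : tproj (vec2 x y) = tproj (vec2 x' y') := congr1 (@bproj _ _ _) e.
  have := congr1 vec e; rewrite !vec_pt eb => /expT_inj.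
  have /lattBP[] := (tproj_eq _ _).1 eb; rewrite !vec2E => h1 h2.
  have /lattBP[] := latt_trep (vec2 x' y'); rewrite vec2E.
  set r := trep _ 0 0 => h3 _ h4; split=> //.
  have -> : w' - w - 2 * (x - x') * y = - (w + 2 * (x - r) * y -
    (w' + 2 * (x' - r) * y') + 2 * (r - x') * (y - y')) by ring.
  by rewrite rpredN; apply: rpredD; [exact: h4|exact: K].
have eb : tproj (vec2 x y) = tproj (vec2 x' y').
  by apply/tproj_eq; rewrite /latt !(coordD, coordN) !vec2E h1.
apply: bundle_eq => //; rewrite !vec_pt eb; apply: expT_eq.
have /lattBP[] := latt_trep (vec2 x' y'); rewrite vec2E.
set r := trep _ 0 0 => h4 _.
have -> : w + 2 * (x - r) * y - (w' + 2 * (x' - r) * y') =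
  - (w' - w - 2 * (x - x') * y) - 2 * (r - x') * (y - y') by ring.
by apply: rpredB; [rewrite rpredN|exact: K].
Qed.

Lemma fcrd_pt e x y w : fcrd (e : framing L) (pt x y w) =
  circle_point (w - 2 * (tcrd e (tproj (vec2 x y)) 0 0 - x) * y).
Proof.
rewrite /fcrd /= -expTB reim_expT /phase.
have /lattBP[] := tcrd_latt e (tproj (vec2 x y)).
have /lattBP[] := latt_tcrd_tproj e (vec2 x y); rewrite !vec2E.
set a := tcrd _ _ 0 0; set b := tcrd _ _ 0 1; set r := trep _ 0 0.
move=> h1 h2 h3 h4.
rewrite (_ : w + 2 * (x - r) * y - _ =
   w - 2 * (a - x) * y + - (2 * (a - r) * (b - y))); last by ring.
rewrite circle_point_int// rpredN; apply: rpredM => //; apply: rpredM => //; exact: rpred_nat.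
Qed.

Section maps.
Variable U : normedModType R.
Variables X Y W : U -> R.
Hypotheses (eX : elem X) (eY : elem Y) (eW : elem W).

Let F p := vec2 (X p) (Y p).

Lemma vec2_continuous (S : topologicalType) (f g : S -> R) :
  continuous f -> continuous g -> continuous (fun z => vec2 (f z) (g z)).
Proof. by move=> cf cg z; apply: vec2_cvg; [exact: cf|exact: cg]. Qed.

Lemma tcrd_near_comp c p : tdom c (tproj (F p)) -> \forall p' \near p,
  tcrd c (tproj (F p')) = F p' + (tcrd c (tproj (F p)) - F p).
Proof.
move=> /tcrd_near h.
have cF := vec2_continuous (elem_continuous eX) (elem_continuous eY).
have {}h : nbhs p (F @^-1` [set q | tcrd c (tproj q) =
  q + (tcrd c (tproj (F p)) - F p)]) by apply: cF; apply: filterS h => q [].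
exact: h.
Qed.

Lemma fcrd_near e p : tdom e (tproj (F p)) -> \forall p' \near p,
  fcrd (e : framing L) (pt (X p') (Y p') (W p')) =
  circle_point (W p' - 2 * (tcrd e (tproj (F p)) - F p) 0 0 * Y p').
Proof.
move=> /tcrd_near_comp h0; apply: filterS h0 => p' h.
rewrite fcrd_pt h !(coordD, coordN) !vec2E; congr (circle_point (_ - 2 * _ * _)); ring.
Qed.

(** Locally all charts and frames change the coordinates by formulas in sums,
    products, cosines and sines. *)
Lemma smooth_pt : smooth_to_bundle (fun p => pt (X p) (Y p) (W p)).
Proof.
split=> [|e].
  split=> [|c].
    have cF := vec2_continuous (elem_continuous eX) (elem_continuous eY).
    exact: (continuous_comp2 cF (@tproj_continuous R)).
  apply: smooth_on_local => p cp; eexists; split; last first.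
    exact: tcrd_near_comp.
  apply: smooth2_on; exists (fun p' => X p' + (tcrd c (tproj (F p)) - F p) 0 0),
    (fun p' => Y p' + (tcrd c (tproj (F p)) - F p) 0 1); split.
  - by apply: elemD => //; exact: elemC.
  - by apply: elemD => //; exact: elemC.
  - by apply/funext => p'; apply: vec2_eqP; rewrite !coordD !vec2E.
apply: smooth_on_local => p ep; eexists; split; last exact: fcrd_near.
apply: smooth2_on; eexists; eexists; split; last by [].
- by apply: elem_cosT; apply: elemB => //; apply: elemM => //; exact: elemC.
- by apply: elem_sinT; apply: elemB => //; apply: elemM => //; exact: elemC.
Qed.

End maps.

Section curve.
Variables X Y W : R -> R.
Hypotheses (eX : elem X) (eY : elem Y) (eW : elem W).
Let g (t : R) : E := pt (X t) (Y t) (W t).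

Lemma crd_velocity c t : tdom c (bproj (g t)) ->
  derive1 (@crd R T c \o @bproj R T L \o g) t = vec2 (derive1 X t) (derive1 Y t).
Proof.
move=> cp; have h := tcrd_near_comp eX eY cp.
rewrite derive1E (near_eq_derive _ h) deriveD//.
- rewrite derive_cst addr0 vec2_derive ?derive1E//; exact: elem_derivable.
- by apply: vec2_derivable; exact: elem_derivable.
Qed.

Lemma fcrd_derivable t (m : R) : derivable (fun t' => W t' - 2 * m * Y t') t 1.
Proof.
by apply: elem_derivable; apply: elemB => //; apply: elemM => //; exact: elemC.
Qed.

Lemma derive_fibre t (m : R) : 'D_1 (fun t' => W t' - 2 * m * Y t') t =
  derive1 W t - 2 * m * derive1 Y t.
Proof.
rewrite !derive1E deriveB; first last.
- by apply: elem_derivable; apply: elemM => //; exact: elemC.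
- exact: elem_derivable.
have dY : derivable Y t 1 by exact: elem_derivable.
by have /= -> := @deriveZ R R R Y (2 * m) t 1 dY.
Qed.

Lemma knot_pt :
  (forall s t, g s = g t <-> exists k : ssrint.int, s - t = k%:~R) ->
  (forall t, [\/ derive1 X t != 0, derive1 Y t != 0 | derive1 W t != 0]) ->
  knot (B := B) g.
Proof.
move=> gi g0; split=> // [|e c t et ct]; first exact: smooth_pt.
rewrite (crd_velocity ct).
have [e0|] := eqVneq (vec2 (derive1 X t) (derive1 Y t)) 0; last by left.
right; have := congr1 (fun v : V => v 0 0) e0; have := congr1 (fun v : V => v 0 1) e0.
rewrite !vec2E !mxE => Y0 X0.
have W0 : derive1 W t != 0 by case: (g0 t) => //; rewrite ?X0 ?Y0 eqxx.
rewrite derive1E (near_eq_derive _ (fcrd_near W eX eY et)).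
rewrite circle_point_derive; last exact: fcrd_derivable.
rewrite derive_fibre Y0 mulr0 subr0; set a := (_ - _).
apply/eqP => h.
have := congr1 (fun v : V => v 0 0) h; have := congr1 (fun v : V => v 0 1) h.
rewrite !vec2E !mxE => /eqP h1 /eqP h2.
have := cosT2DsinT2 a.
have p0 : 2 * pi != 0 :> R by rewrite mulf_neq0// gt_eqF// pi_gt0.
move: h1 h2; rewrite mulf_eq0 (negbTE W0) orbF mulf_eq0 (negbTE p0) => /eqP ->.
rewrite mulf_eq0 (negbTE W0) orbF oppr_eq0 mulf_eq0 (negbTE p0) => /eqP ->.
by rewrite expr0n addr0 => /esym/eqP; rewrite oner_eq0.
Qed.

(** The integer by which the frame's chart shifts x enters both the fiber
    coordinate and the connection form, and cancels. *)
Lemma alpha_pt e c t : tdom e (bproj (g t)) -> tdom c (bproj (g t)) ->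
  alpha_velocity (cconn B) e c g t = 2 * pi * (derive1 W t + 2 * X t * derive1 Y t).
Proof.
move=> et ct; rewrite /alpha_velocity (crd_velocity ct).
have h := fcrd_near W eX eY et.
rewrite /comp (nbhs_singleton h) derive1E (near_eq_derive _ h).
set m := (tcrd _ _ - _) 0 0.
rewrite (wedge_circle_point (@fcrd_derivable t m)) derive_fibre.
rewrite /= /tform tproj_tcrd !dot2_vec2 !vec2E.
have -> : tcrd e (tproj (vec2 (X t) (Y t))) 0 0 = m + X t.
  by rewrite /m coordD coordN vec2E subrK.
ring.
Qed.

Lemma legendrian_pt : knot (B := B) g ->
  (forall t, derive1 W t + 2 * X t * derive1 Y t = 0) ->
  legendrian_knot (B := B) g.
Proof.
by move=> kg h; split=> // e c t et ct; rewrite alpha_pt// h mulr0.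
Qed.

End curve.

End points.

(** * Lifting maps of a square to the universal cover *)

Section bundle_topology.
Context {R : realType}.
Local Notation V := 'rV[R]_2.
Local Notation T := (torus_surface (R := R)).
Local Notation L := (torus_line (R := R)).
Local Notation B := (torus_contact (R := R)).
Local Notation E := (circle_bundle L).
Local Notation int := Num.int.

Lemma bproj_continuous : continuous (@bproj R T L).
Proof.
apply/continuousP => O oO.
change (circle_bundle_open (@bproj R T L @^-1` O)) => e u Ou eu.
have h : \forall p \near (bproj u, fcrd e u), O p.1.
  have : (fun p : T * V => p.1) @ (bproj u, fcrd e u) --> bproj u by exact: cvg_fst.
  by apply; apply: open_nbhs_nbhs.
by apply: filterS h => p Op u' e'; move: Op; rewrite -e'.
Qed.

(** Multiplication by exp (- 2 pi i s) on C = R^2. *)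
Definition unturn (s : R) (z : V) : V :=
  vec2 (cosT s * z 0 0 + sinT s * z 0 1) (cosT s * z 0 1 - sinT s * z 0 0).

Lemma reim_unturn (z : R[i]) s : reim (z * (expT s)^*) = unturn s (reim z).
Proof.
case: z => a b; apply: vec2_eqP; rewrite /unturn vec2E !mxE /=; ring.
Qed.

Lemma unturnN s z : unturn (- s) (unturn s z) = z.
Proof.
apply: vec2_eqP; rewrite /unturn !vec2E cosTN sinTN.
  by rewrite -[RHS]mul1r -(cosT2DsinT2 s); ring.
by rewrite -[RHS]mul1r -(cosT2DsinT2 s); ring.
Qed.

Lemma unturn_continuous_at (S : topologicalType) (f : S -> R) (g : S -> V) x :
  {for x, continuous f} -> {for x, continuous g} ->
  {for x, continuous (fun y => unturn (f y) (g y))}.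
Proof.
move=> cf cg.
have cc : {for x, continuous (fun y => cosT (f y))}.
  exact: (continuous_comp cf (@continuous_cosT R (f x))).
have cs : {for x, continuous (fun y => sinT (f y))}.
  exact: (continuous_comp cf (@continuous_sinT R (f x))).
have g0 : {for x, continuous (fun y => g y 0 0)}.
  exact: (continuous_comp cg (@coord_continuous R _ _ 0 0 (g x))).
have g1 : {for x, continuous (fun y => g y 0 1)}.
  exact: (continuous_comp cg (@coord_continuous R _ _ 0 1 (g x))).
apply: vec2_cvg.
  exact: (cvgD (cvgM cc g0) (cvgM cs g1)).
exact: (cvgB (cvgM cc g1) (cvgM cs g0)).
Qed.

Lemma fcrdE (e : framing L) (u : E) : fcrd e u = unturn (phase e (bproj u)) (reim (vec u)).
Proof. exact: reim_unturn. Qed.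

Lemma unturnD s t z : unturn (s + t) z = unturn s (unturn t z).
Proof. by apply: vec2_eqP; rewrite /unturn !vec2E cosTD sinTD; ring. Qed.

Lemma unturn_int m z : m \is a int -> unturn m z = z.
Proof. by move=> /cosT_sinT_int[h1 h2]; apply: vec2_eqP; rewrite /unturn !vec2E h1 h2; ring. Qed.

Lemma unturn_eq s t z : s - t \is a int -> unturn s z = unturn t z.
Proof. by move=> h; rewrite -[s](subrK t) unturnD unturn_int. Qed.

(** The angle from the frame over the chart e to the frame in which the first
    coordinate of x is a. It is continuous in (a, x) over the chart, unlike
    the angle to the reference frame. *)
Definition gap (e : V) (a : R) (x : T) : R := 2 * (a - tcrd e x 0 0) * tcrd e x 0 1.

Lemma fcrd_change (e : framing L) (u : E) (a b : R) :
  let x := bproj u in a - trep x 0 0 \is a int -> b - trep x 0 1 \is a int ->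
  unturn (2 * (a - trep x 0 0) * b) (reim (vec u)) = unturn (gap e a x) (fcrd e u).
Proof.
move=> x ha hb; rewrite fcrdE -unturnD; apply: unturn_eq; rewrite /gap /phase -/x.
have /lattBP[] := tcrd_latt e x.
set c := tcrd _ _ 0 0; set d := tcrd _ _ 0 1; set r := trep x 0 0 in ha *.
move=> h1 h2.
have -> : 2 * (a - r) * b - (2 * (a - c) * d + 2 * (c - r) * d) =
  2 * (a - r) * ((b - trep x 0 1) - (d - trep x 0 1)) by ring.
by apply: rpredM; [apply: rpredM => //; exact: rpred_nat|exact: rpredB].
Qed.

Lemma gap_continuous_at (S : topologicalType) e (f : S -> R) (g : S -> T) s :
  {for s, continuous f} -> {for s, continuous g} -> tdom e (g s) ->
  {for s, continuous (fun s => gap e (f s) (g s))}.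
Proof.
move=> cf cg ex.
have cc : {for s, continuous (fun s => tcrd e (g s))}.
  exact: (continuous_comp cg (tcrd_continuous_at ex)).
have g0 : {for s, continuous (fun y => tcrd e (g y) 0 0)}.
  exact: (continuous_comp cc (@coord_continuous R _ _ 0 0 _)).
have g1 : {for s, continuous (fun y => tcrd e (g y) 0 1)}.
  exact: (continuous_comp cc (@coord_continuous R _ _ 0 1 _)).
exact: (cvgM (cvgM (cvg_cst _) (cvgB cf g0)) g1).
Qed.

(** The topology of the bundle is given by conditions in every frame at once;
    the transition from the frame e1 to the frame e is a continuous turn. *)
Lemma fcrd_continuous_at (e : framing L) (u : E) : tdom e (bproj u) ->
  {for u, continuous (fcrd e)}.
Proof.
move=> eu W /= /nbhs_interior Wu.
pose O := [set u' : E | tdom e (bproj u') /\ W° (fcrd e u')].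
suff oO : open O.
  have Ou : O u by split=> //; exact: nbhs_singleton.
  by apply: filterS (open_nbhs_nbhs (conj oO Ou)) => u' [_ /interior_subset].
change (circle_bundle_open O) => e1 u1 [d1 W1] du1.
pose rho (p : T * V) := unturn (gap e1 (tcrd e p.1 0 0) p.1) p.2.
have E' (u' : E) : rho (bproj u', fcrd e1 u') = fcrd e u'.
  have /lattBP[l0 l1] := tcrd_latt e (bproj u').
  by rewrite /rho /= -(fcrd_change e1 l0 l1) fcrdE.
have crho : {for (bproj u1, fcrd e1 u1), continuous rho}.
  have cf : {for (bproj u1, fcrd e1 u1), continuous (fun p : T * V => p.1)}.
    exact: cvg_fst.
  have cs : {for (bproj u1, fcrd e1 u1), continuous (fun p : T * V => p.2)}.
    exact: cvg_snd.
  apply: unturn_continuous_at => //; apply: gap_continuous_at => //.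
  have cc : {for (bproj u1, fcrd e1 u1), continuous (fun p : T * V => tcrd e p.1)}.
    exact: (continuous_comp cf (tcrd_continuous_at d1)).
  exact: (continuous_comp cc (@coord_continuous R _ _ 0 0 _)).
have h1 : \forall p \near (bproj u1, fcrd e1 u1), W° (rho p).
  by apply: crho; rewrite /= E'; apply: open_nbhs_nbhs; split=> //; exact: open_interior.
have h2 : \forall p \near (bproj u1, fcrd e1 u1), tdom e p.1.
  have cf : (fun p : T * V => p.1) @ (bproj u1, fcrd e1 u1) --> bproj u1 by exact: cvg_fst.
  by apply: cf; apply: open_nbhs_nbhs; split=> //; exact: tdom_open.
apply: filterS2 h1 h2 => p k1 k2 u' e'; move: k1 k2.
by rewrite -e' E'.
Qed.

Lemma pt_continuous (S : topologicalType) (X Y W : S -> R) :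
  continuous X -> continuous Y -> continuous W ->
  continuous (fun s => pt (X s) (Y s) (W s)).
Proof.
move=> cX cY cW s O /=; rewrite nbhsE /= => -[Q [oQ Qs] QO].
suff : \forall s' \near s, Q (pt (X s') (Y s') (W s')).
  by apply: filterS => s'; exact: QO.
have [e ex] := tdom_cover (bproj (pt (X s) (Y s) (W s))).
have h := (oQ : circle_bundle_open Q) e _ Qs ex.
have cF : continuous (fun s => tproj (vec2 (X s) (Y s))).
  apply: continuous_comp2 (@tproj_continuous R).
  exact: vec2_continuous.
have cf : {for s, continuous (fun s => fcrd (e : framing L) (pt (X s) (Y s) (W s)))}.
  have -> : (fun s => fcrd (e : framing L) (pt (X s) (Y s) (W s))) =
     (fun s => circle_point (W s - 2 * (tcrd e (tproj (vec2 (X s) (Y s))) 0 0 - X s) * Y s)).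
    by apply/funext => s'; rewrite fcrd_pt.
  have cc : {for s, continuous (fun s => tcrd e (tproj (vec2 (X s) (Y s))))}.
    exact: (continuous_comp (cF s) (tcrd_continuous_at ex)).
  have g0 : {for s, continuous (fun s => tcrd e (tproj (vec2 (X s) (Y s))) 0 0)}.
    exact: (continuous_comp cc (@coord_continuous R _ _ 0 0 _)).
  have ca : {for s, continuous (fun s => W s - 2 * (tcrd e (tproj (vec2 (X s) (Y s))) 0 0 - X s) * Y s)}.
    exact: (cvgB (cW s) (cvgM (cvgM (cvg_cst _) (cvgB g0 (cX s))) (cY s))).
  apply: vec2_cvg.
    exact: (continuous_comp ca (@continuous_cosT R _)).
  exact: (continuous_comp ca (@continuous_sinT R _)).
case: h => -[A1 A2] /= [n1 n2] A12.
have m1 : nbhs s ((fun s => tproj (vec2 (X s) (Y s))) @^-1` A1) := cF s _ n1.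
have m2 := cf _ n2.
apply: filterS2 m1 m2 => s' a1 a2.
pose u := pt (X s') (Y s') (W s').
have a12 : (A1 `*` A2) (bproj u, fcrd (e : framing L) u) by split.
exact: (A12 _ a12 u erefl).
Qed.

(** A coordinate modulo 1 is a unit vector, so each coordinate is lifted by
    [lift_unit]. *)
Lemma lift_torus (h : R * R -> T) : continuous h -> (forall p, h (clamp2 p) = h p) ->
  exists X Y : R * R -> R, [/\ continuous X, continuous Y,
    (forall p, X (clamp2 p) = X p /\ Y (clamp2 p) = Y p) &
    forall p, h p = tproj (vec2 (X p) (Y p))].
Proof.
move=> ch hc.
have K i : exists X : R * R -> R, [/\ continuous X, forall p, X (clamp2 p) = X p &
    forall p, trep (h p) 0 i - X p \is a int].
  have cu : continuous (fun p => cosT (trep (h p) 0 i)).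
    apply: (continuous_comp2 ch (trep_periodic_continuous _ (@continuous_cosT R))).
    by move=> t m; exact: cosT_periodic.
  have cv : continuous (fun p => sinT (trep (h p) 0 i)).
    apply: (continuous_comp2 ch (trep_periodic_continuous _ (@continuous_sinT R))).
    by move=> t m; exact: sinT_periodic.
  have [||| th [cth Hth]] := lift_unit cu cv.
  - by move=> p; exact: cosT2DsinT2.
  - by move=> p; rewrite hc.
  - by move=> p; rewrite hc.
  exists (th \o clamp2); split.
  - exact: continuous_comp2 (@continuous_clamp2 R) cth.
  - by move=> p /=; rewrite clamp2K.
  - move=> p /=; have [e1 e2] := Hth (clamp2 p); rewrite hc in e1 e2.
    exact: cosT_sinT_inj.
have [X [cX pX HX]] := K 0; have [Y [cY pY HY]] := K 1.
exists X, Y; split=> // p.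
rewrite -{1}(trepK (h p)); apply/tproj_eq; rewrite /latt !(coordD, coordN) !vec2E.
by rewrite HX HY.
Qed.

Lemma vec_unit (u : E) : vec u * (vec u)^* = 1.
Proof. exact: (bvec_unit u). Qed.

Lemma reim_unit (z : R[i]) : z * z^* = 1 -> reim z 0 0 ^+ 2 + reim z 0 1 ^+ 2 = 1.
Proof.
case: z => a b /(congr1 (@complex.Re R)) /= h; rewrite !mxE /=.
by rewrite -h; ring.
Qed.

Lemma unturn_unit s (z : V) : z 0 0 ^+ 2 + z 0 1 ^+ 2 = 1 ->
  unturn s z 0 0 ^+ 2 + unturn s z 0 1 ^+ 2 = 1.
Proof. by move=> h; rewrite /unturn !vec2E -[RHS]mulr1 -{1}h -(cosT2DsinT2 s); ring. Qed.

Lemma reim_inj : injective (@reim R).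
Proof.
case=> a b [c d] h; have := congr1 (fun v : V => v 0 0) h.
by have := congr1 (fun v : V => v 0 1) h; rewrite !mxE /= => -> ->.
Qed.

Lemma pt_vec (u : E) x y w : bproj u = tproj (vec2 x y) ->
  unturn (2 * (x - trep (bproj u) 0 0) * y) (reim (vec u)) = circle_point w -> u = pt x y w.
Proof.
move=> eb er; apply: bundle_eq => //; rewrite vec_pt -eb; apply: reim_inj.
rewrite reim_expT -(unturnN (2 * (x - trep (bproj u) 0 0) * y) (reim (vec u))) er.
set s := 2 * _ * _; apply: vec2_eqP; rewrite /unturn /circle_point !vec2E ?cosTD ?sinTD cosTN sinTN; ring.
Qed.

(** Once the projection is lifted to the plane, turning the unit vectors back
    to the frame that follows the lift leaves a continuous map to the circle,
    which lifts to the third coordinate. *)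
Lemma lift_bundle (H : R * R -> E) : continuous H -> (forall p, H (clamp2 p) = H p) ->
  exists X Y W : R * R -> R, [/\ continuous X, continuous Y, continuous W &
    forall p, H p = pt (X p) (Y p) (W p)].
Proof.
move=> cH Hc.
have ch : continuous (fun p => bproj (H p)) by exact: continuous_comp2 cH bproj_continuous.
have hc p : bproj (H (clamp2 p)) = bproj (H p) by rewrite Hc.
have [X [Y [cX cY XYc hXY]]] := lift_torus ch hc.
pose z p := unturn (2 * (X p - trep (bproj (H p)) 0 0) * Y p) (reim (vec (H p))).
have hz p : X p - trep (bproj (H p)) 0 0 \is a int /\ Y p - trep (bproj (H p)) 0 1 \is a int.
  by have := hXY p; rewrite -{1}(trepK (bproj (H p))) => /esym/tproj_eq/lattBP; rewrite !vec2E.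
have cz : continuous z.
  move=> p; have [e ex] := tdom_cover (bproj (H p)).
  rewrite (_ : z = fun p => unturn (gap e (X p) (bproj (H p))) (fcrd (e : framing L) (H p))); last first.
    by apply/funext => q; have [h1 h2] := hz q; exact: fcrd_change.
  apply: (@unturn_continuous_at _ (fun p => gap e (X p) (bproj (H p)))
    (fun p => fcrd (e : framing L) (H p))).
    by apply: gap_continuous_at => //; [exact: cX|exact: ch].
  exact: (continuous_comp (cH p) (fcrd_continuous_at ex)).
have c0 : continuous (fun p => z p 0 0).
  exact: (continuous_comp2 cz (@coord_continuous R _ _ 0 0)).
have cz1 : continuous (fun p => z p 0 1).
  exact: (continuous_comp2 cz (@coord_continuous R _ _ 0 1)).
have zc p : z (clamp2 p) = z p by rewrite /z Hc; have [-> ->] := XYc p.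
have [||| W [cW HW]] := lift_unit c0 cz1.
- by move=> p; apply: unturn_unit; apply: reim_unit; exact: vec_unit.
- by move=> p; rewrite zc.
- by move=> p; rewrite zc.
exists X, Y, W; split=> // p; apply: pt_vec; first exact: hXY.
by rewrite -/(z p); have [h1 h2] := HW p; apply: vec2_eqP; rewrite /circle_point vec2E.
Qed.

End bundle_topology.

(** * Integer cocycles on singular 1-chains *)

Section lift_additive.
Context (A : ringType) (S : choiceType) (M : lmodType A) (f : S -> M).
(** Makes sum lemmas available for the linear extension of a function from
    generators to formal sums. *)
HB.instance Definition _ :=
  GRing.isAdditive.Build {freeg S / A} M (fglift f) (lift_is_additive f).
End lift_additive.

Section homology.
Context {R : realType}.

Lemma continuous_to_set_type (S X : topologicalType) (A : set X)
  (f : S -> set_type A) : continuous (fun s => set_val (f s)) -> continuous f.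
Proof.
move=> cf; apply/continuousP => O [Q oQ <-].
by move/continuousP: cf => /(_ _ oQ).
Qed.

Lemma simp1_subproof (t : R) : @std_simplex R 1 (vec2 (1 - clamp t) (clamp t)).
Proof.
have /andP[h0 h1] := clamp01 t.
split=> [i|]; first by rewrite mxE; case: ifP; rewrite ?subr_ge0.
by rewrite !big_ord_recl big_ord0 !mxE /= addr0 subrK.
Qed.

(** The interval and the square parametrise the simplices of dimension 1 and
    2; the square does so by collapsing its side where the first coordinate is
    0, and its other sides become the three faces. Lifting problems over
    simplices become lifting problems over squares. *)
Definition simp1 (t : R) : set_type (@std_simplex R 1) :=
  SigSub (mem_set (simp1_subproof t)).

Definition vec3 (a b c : R) : 'rV[R]_3 :=
  \row_(i < 3) (if i == 0 then a else if i == 1 then b else c).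

Lemma simp2_subproof (p : R * R) : @std_simplex R 2
  (vec3 (1 - clamp p.1) (clamp p.1 * (1 - clamp p.2)) (clamp p.1 * clamp p.2)).
Proof.
have /andP[h0 h1] := clamp01 p.1; have /andP[k0 k1] := clamp01 p.2.
split=> [i|].
  rewrite mxE; case: ifP => _; first by rewrite subr_ge0.
  by case: ifP => _; rewrite mulr_ge0// subr_ge0.
by rewrite !big_ord_recl big_ord0 !mxE /=; ring.
Qed.

Definition simp2 (p : R * R) : set_type (@std_simplex R 2) :=
  SigSub (mem_set (simp2_subproof p)).

Lemma simp1E t : set_val (simp1 t) = vec2 (1 - clamp t) (clamp t).
Proof. by []. Qed.

Lemma simp2E p : set_val (simp2 p) =
  vec3 (1 - clamp p.1) (clamp p.1 * (1 - clamp p.2)) (clamp p.1 * clamp p.2).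
Proof. by []. Qed.

Lemma faceE n (i : 'I_n.+2) (p : set_type (@std_simplex R n)) :
  set_val (face i p) = face_fun i (set_val p).
Proof. by []. Qed.

Lemma set_type_inj (X : Type) (A : set X) (x y : set_type A) :
  set_val x = set_val y -> x = y.
Proof. exact: val_inj. Qed.

Lemma simp1K (q : set_type (@std_simplex R 1)) : simp1 (set_val q 0 1) = q.
Proof.
apply: set_type_inj; have [q0 q1] := set_valP q.
pose v : 'rV[R]_2 := set_val q.
have h0 i : 0 <= v 0 i := q0 i.
have h1 : \sum_i v 0 i = 1 := q1.
have e1 : fintype.lift ord0 ord0 = 1 :> 'I_2 by exact/val_inj.
have s : v 0 0 + v 0 1 = 1.
  by move: h1; rewrite !big_ord_recl big_ord0 addr0 e1.
change (vec2 (1 - clamp (v 0 1)) (clamp (v 0 1)) = v).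
rewrite clamp_id; last by rewrite h0 /= -s lerDr h0.
by apply: vec2_eqP; rewrite vec2E// -s addrK.
Qed.

Lemma simp2_clamp p : simp2 (clamp2 p) = simp2 p.
Proof. by apply: set_type_inj; rewrite !simp2E /= !clampK. Qed.

Lemma ord3P (i : 'I_3) : [\/ i = 0, i = 1 | i = 2%:R].
Proof.
case: i => -[|[|[|//]]] h; [apply: Or31|apply: Or32|apply: Or33]; exact/val_inj.
Qed.

Lemma face_vec (i : 'I_3) (a b : R) : face_fun i (vec2 a b) =
  if i == 0 then vec3 0 a b else if i == 1 then vec3 a 0 b else vec3 a b 0.
Proof.
apply/rowP => j; rewrite /face_fun mxE; case: (unliftP i j) => [k ->|->].
  case: (ord3P i) => ->; rewrite !mxE /=;
  by case: (ord2P k) => ->; rewrite /= ?mxE.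
by case: (ord3P i) => ->; rewrite !mxE /=.
Qed.

Lemma simp2_face0 t : simp2 (1, t) = face 0 (simp1 t).
Proof.
apply: set_type_inj; rewrite simp2E faceE simp1E face_vec /= (@clamp_id _ 1) ?ler01 ?lexx//.
by rewrite subrr !mul1r.
Qed.

Lemma simp2_face1 t : simp2 (t, 1) = face 1 (simp1 t).
Proof.
apply: set_type_inj; rewrite simp2E faceE simp1E face_vec /= (@clamp_id _ 1) ?ler01 ?lexx//.
by rewrite subrr mulr0 mulr1.
Qed.

Lemma simp2_face2 t : simp2 (t, 0) = face 2%:R (simp1 t).
Proof.
apply: set_type_inj; rewrite simp2E faceE simp1E face_vec /= (@clamp_id _ 0) ?ler01 ?lexx//.
by rewrite subr0 mulr0 mulr1.
Qed.

Lemma simp2_vertex t : simp2 (0, t) = simp2 (0, 0).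
Proof.
by apply: set_type_inj; rewrite !simp2E /= (@clamp_id _ 0) ?ler01 ?lexx// !mul0r.
Qed.

Lemma vec3_cvg (S : topologicalType) (f g h : S -> R) :
  continuous f -> continuous g -> continuous h ->
  continuous (fun z => vec3 (f z) (g z) (h z)).
Proof.
move=> cf cg ch x; apply/cvgrPdist_lt => e e0; near=> z.
rewrite [ltLHS]/Num.Def.normr/= mx_normrE (bigmax_lt _ e0)//= => -[i j] _.
rewrite !mxE /=; case: ifP => _; last case: ifP => _.
- by near: z; exact: (cvgrPdist_lt _ _).1 (cf x) e e0.
- by near: z; exact: (cvgrPdist_lt _ _).1 (cg x) e e0.
- by near: z; exact: (cvgrPdist_lt _ _).1 (ch x) e e0.
Unshelve. all: by end_near. Qed.

Lemma simp2_continuous : continuous simp2.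
Proof.
apply: continuous_to_set_type.
have c1' : continuous (fun p : R * R => clamp p.1).
  by move=> p; apply: continuous_comp; [exact: cvg_fst|exact: continuous_clamp].
have c2' : continuous (fun p : R * R => clamp p.2).
  by move=> p; apply: continuous_comp; [exact: cvg_snd|exact: continuous_clamp].
have cc (f : R * R -> R) : continuous f -> continuous (fun p => 1 - f p).
  by move=> cf; apply: continuousD2; [exact: cst_continuous|exact: continuousN1].
apply: vec3_cvg; first exact: cc.
  by apply: continuousM2 => //; exact: cc.
exact: continuousM2.
Qed.

Lemma continuous_pair2 (S U W : topologicalType) (f : S -> U) (g : S -> W) :
  continuous f -> continuous g -> continuous (fun s => (f s, g s)).
Proof.
move=> cf cg x; apply: (@cvg_pair _ _ _ _ (nbhs (f x)) (nbhs (g x))).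
- exact: cf.
- exact: cg.
Qed.

Section cochain.
(** P plays the part of a covering, with lifts of squares as its only lifting
    property. A function K on Y, in general not continuous, gives a 1-cocycle
    on Y by differences of its values at end points; [lift_unique] says that
    modulo n it only depends on the projected path, so that it descends to X. *)
Context (X Y : topologicalType) (P : Y -> X) (K : Y -> int) (n : int).
Definition increment (q : R -> Y) : int := K (q 1) - K (q 0).
Hypothesis lift2 : forall H : R * R -> X, continuous H ->
  (forall p, H (clamp2 p) = H p) ->
  exists Q : R * R -> Y, continuous Q /\ forall p, P (Q p) = H p.
Hypothesis lift_unique : forall q q' : R -> Y, continuous q -> continuous q' ->
  (forall t, P (q t) = P (q' t)) ->
  (n %| increment q - increment q')%Z.

Definition lifts (s : simplex R 1 X) (q : R -> Y) :=
  continuous q /\ forall t, P (q t) = s (simp1 t).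

Definition sdeg (s : simplex R 1 X) : int :=
  if pselect (exists q, lifts s q) is left e
  then increment (sval (cid e)) else 0.

Lemma sdegE s q : lifts s q -> (n %| sdeg s - increment q)%Z.
Proof.
move=> [cq hq]; rewrite /sdeg; case: pselect => [e|[]]; last by exists q.
case: (cid e) => q' /= [cq' hq']; apply: lift_unique => // t.
by rewrite hq' hq.
Qed.

Definition cochain (c : chain R 1 X) : int := fglift (sdeg : _ -> int^o) c.

Lemma cochainU k s : cochain << k *g s >> = k * sdeg s.
Proof. by rewrite /cochain liftU. Qed.

Lemma cochain_sum (I : Type) (r : seq I) (F : I -> chain R 1 X) :
  cochain (\sum_(i <- r) F i) = \sum_(i <- r) cochain (F i).
Proof. by rewrite /cochain raddf_sum. Qed.

(** Lift the 2-simplex to Y over the square. The increments along the lifted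
    sides add up to 0, and the collapsed side contributes nothing modulo n
    because it lifts a constant path. *)
Lemma cochain_boundary (c : chain R 2 X) : singular c ->
  (n %| cochain (chain_boundary c))%Z.
Proof.
move=> sc; rewrite /chain_boundary cochain_sum.
rewrite big_seq; apply: rpred_sum => s sd.
rewrite cochain_sum !big_ord_recl big_ord0 !cochainU /=.
have cs := sc s sd.
have cH : continuous (s \o simp2) by exact: continuous_comp2 simp2_continuous cs.
have [Q [cQ hQ]] := lift2 cH (fun p => congr1 s (simp2_clamp p)).
have cl a : continuous (fun t : R => Q (a, t)).
  have cp : continuous (fun t : R => (a, t)).
    by apply: continuous_pair2 => t; [exact: cvg_cst|exact: cvg_id].
  exact: continuous_comp2 cp cQ.
have cr a : continuous (fun t : R => Q (t, a)).
  have cp : continuous (fun t : R => (t, a)).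
    by apply: continuous_pair2 => t; [exact: cvg_id|exact: cvg_cst].
  exact: continuous_comp2 cp cQ.
have h0 : lifts (s \o @face R 1 0 : simplex R 1 X) (fun t => Q (1, t)).
  by split=> // t; rewrite hQ /= simp2_face0.
have h1 : lifts (s \o @face R 1 1 : simplex R 1 X) (fun t => Q (t, 1)).
  by split=> // t; rewrite hQ /= simp2_face1.
have h2 : lifts (s \o @face R 1 2%:R : simplex R 1 X) (fun t => Q (t, 0)).
  by split=> // t; rewrite hQ /= simp2_face2.
have /= hv : (n %| increment (fun t => Q (0%R, t)) - increment (fun=> Q (0%R, 0%R)))%Z.
  apply: lift_unique => //.
    by move=> t; exact: cvg_cst.
  by move=> t; rewrite !hQ /= simp2_vertex.
have e1 : fintype.lift ord0 ord0 = 1 :> 'I_3 by exact/val_inj.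
have e2 : fintype.lift ord0 (fintype.lift ord0 ord0) = 2%:R :> 'I_3 by exact/val_inj.
rewrite e1 e2 (_ : (ord0 : 'I_3) = 0); last exact/val_inj.
have := sdegE h0; have := sdegE h1; have := sdegE h2; rewrite /increment in hv *.
set d0 := sdeg _; set d1 := sdeg _; set d2 := sdeg _ => k0 k1 k2.
set a := coeff s c.
rewrite /bump /= expr0 expr1 sqrrN expr1n.
have -> : 1 * a * d2 + (-1 * a * d1 + (1 * a * d0 + 0)) =
  a * ((d2 - (K (Q (1, 1)) - K (Q (1, 0)))) - (d1 - (K (Q (1, 1)) - K (Q (0, 1)))) +
   (d0 - (K (Q (1, 0)) - K (Q (0, 0)))) +
   (K (Q (0, 1)) - K (Q (0, 0)) - (K (Q (0, 0)) - K (Q (0, 0))))) by ring.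
by apply: dvdz_mull; apply: rpredD => //; apply: rpredD => //; exact: rpredB.
Qed.

(** A cocycle modulo n vanishes on boundaries. *)
Lemma loop_not_null (g : R -> X) (q : R -> Y) : continuous q ->
  (forall t, P (q t) = g t) -> ~~ (n %| increment q)%Z ->
  ~ homologous (loop_cycle g) 0.
Proof.
move=> cq hq nd [c [sc]]; rewrite subr0 => e.
have := cochain_boundary sc; rewrite -e cochainU mul1r => h.
pose s : simplex R 1 X := fun p => g (set_val p 0 1).
have ls : lifts s (fun t => q (clamp t)).
  split; first exact: continuous_comp2 (@continuous_clamp R) cq.
  by move=> t; rewrite hq /s /= vec2E.
have := sdegE ls; rewrite {1}/increment !clamp_id ?ler01 ?lexx// -/(increment q) => h'.
have h1 : (n %| sdeg s)%Z by exact: h.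
move/negP: nd; apply; rewrite -[increment q](subKr (sdeg s)).
exact: rpredB.
Qed.

End cochain.

(** Expresses the boundary as the extension of its values on simplices, which
    makes it additive. *)
Lemma chain_boundaryE (X : Type) (c : chain R 2 X) : chain_boundary c =
  fglift (fun s : simplex R 2 X => \sum_(i < 3)
    << (-1) ^+ i *g (s \o @face R 1 i : simplex R 1 X) >> : chain R 1 X) c.
Proof.
rewrite -[c in RHS]freeg_sumE raddf_sum; apply: eq_bigr => s _.
rewrite /= liftU scaler_sumr; apply: eq_bigr => i _.
apply/eqP/freeg_eqP => z; rewrite coeffZ !coeffU; ring.
Qed.

(** The diagonal cuts the square of the homotopy into two triangles, and their
    boundaries share it. *)
Lemma homotopic_homologous (X : topologicalType) (H : R * R -> X) :
  continuous H -> (forall s, H (s, 0) = H (s, 1)) ->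
  homologous (loop_cycle (fun t => H (0, t))) (loop_cycle (fun t => H (1, t))).
Proof.
move=> cH Hp.
pose s1 : simplex R 2 X := fun p => H (set_val p 0 2%:R, set_val p 0 1 + set_val p 0 2%:R).
pose s2 : simplex R 2 X := fun p => H (set_val p 0 1 + set_val p 0 2%:R, set_val p 0 2%:R).
exists (<< s1 >> - << s2 >>); split.
  have cv i : continuous (fun p : set_type (@std_simplex R 2) => set_val p 0 i).
    exact: (continuous_comp2 (@initial_continuous _ _ _) (@coord_continuous R _ _ 0 i)).
  have cadd i j : continuous (fun p : set_type (@std_simplex R 2) => set_val p 0 i + set_val p 0 j).
    exact: continuousD2.
  move=> s /domB; rewrite !domU1 mem_cat !mem_seq1 => /orP[]/eqP ->.
    have c : continuous (fun p : set_type (@std_simplex R 2) => (set_val p 0 2%:R, set_val p 0 1 + set_val p 0 2%:R)).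
      by apply: continuous_pair2; [exact: cv|exact: cadd].
    exact: continuous_comp2 c cH.
  have c : continuous (fun p : set_type (@std_simplex R 2) => (set_val p 0 1 + set_val p 0 2%:R, set_val p 0 2%:R)).
    by apply: continuous_pair2; [exact: cadd|exact: cv].
  exact: continuous_comp2 c cH.
rewrite chain_boundaryE raddfB /= !liftU !scale1r.
have B (s : simplex R 2 X) : \sum_(i < 3)
    << (-1) ^+ i *g (s \o @face R 1 i : simplex R 1 X) >> =
  << (s \o @face R 1 0 : simplex R 1 X) >> - << (s \o @face R 1 1 : simplex R 1 X) >>
  + << (s \o @face R 1 2%:R : simplex R 1 X) >> :> chain R 1 X.
  have e1 : fintype.lift ord0 ord0 = 1 :> 'I_3 by exact/val_inj.
  have e2 : fintype.lift ord0 (fintype.lift ord0 ord0) = 2%:R :> 'I_3 by exact/val_inj.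
  rewrite !big_ord_recl big_ord0 addr0 e1 e2 (_ : (ord0 : 'I_3) = 0); last exact/val_inj.
  by rewrite /bump /= expr0 expr1 sqrrN expr1n addrA freegUN.
have F (s : simplex R 2 X) i (f : R -> X) : (forall t, s (face i (simp1 t)) = f (clamp t)) ->
    (s \o @face R 1 i : simplex R 1 X) = (fun p => f (set_val p 0 1)).
  move=> h; apply/funext => p; have e := simp1K p.
  have : set_val (simp1 (set_val p 0 1)) 0 1 = clamp (set_val p 0 1).
    by rewrite simp1E vec2E.
  by rewrite e => ->; rewrite -{1}e /= h.
rewrite !B (F s1 0 (fun t => H (t, 1))); last first.
  by move=> t; rewrite /s1 !faceE !simp1E !face_vec !mxE /= subrK.
rewrite (F s1 1 (fun t => H (t, t))); last first.
  by move=> t; rewrite /s1 !faceE !simp1E !face_vec !mxE /= add0r.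
rewrite (F s1 2%:R (fun t => H (0, t))); last first.
  by move=> t; rewrite /s1 !faceE !simp1E !face_vec !mxE /= addr0.
rewrite (F s2 0 (fun t => H (1, t))); last first.
  by move=> t; rewrite /s2 !faceE !simp1E !face_vec !mxE /= subrK.
rewrite (F s2 1 (fun t => H (t, t))); last first.
  by move=> t; rewrite /s2 !faceE !simp1E !face_vec !mxE /= add0r.
rewrite (F s2 2%:R (fun t => H (t, 1))); last first.
  by move=> t; rewrite -Hp; rewrite /s2 !faceE !simp1E !face_vec !mxE /= addr0.
rewrite /loop_cycle.
move: << _ >> << _ >> << _ >> << _ >> => a b d f.
rewrite [b - a + f]addrC -addrA; congr (f + _).
by rewrite opprD opprB addrA subrKA addrAC subrr add0r.
Qed.

End homology.

(** * Two homologically nontrivial families of loops *)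

Section detection.
Context {R : realType}.
Local Notation V := 'rV[R]_2.
Local Notation T := (torus_surface (R := R)).
Local Notation L := (torus_line (R := R)).
Local Notation B := (torus_contact (R := R)).
Local Notation E := (circle_bundle L).

(** Two lifts of a path differ by a constant lattice vector, so the integer
    part of y has the same increment along both. *)
Lemma base_loop_not_null (X Y : R -> R) : continuous X -> continuous Y ->
  Y 1 = Y 0 + 1 ->
  ~ homologous (X := T) (loop_cycle (fun t => tproj (vec2 (X t) (Y t)))) 0.
Proof.
move=> cX cY Y1.
pose P (q : R * R) : T := tproj (vec2 q.1 q.2).
pose K (q : R * R) : int := Num.floor q.2.
apply: (@loop_not_null R T (R * R)%type P K 0 _ _ _ (fun t => (X t, Y t))) => //.
- move=> H cH Hc; have [X' [Y' [cX' cY' _ e]]] := lift_torus cH Hc.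
  exists (fun p => (X' p, Y' p)); split; first exact: continuous_pair2.
  by move=> p; rewrite e.
- move=> q q' cq cq' e.
  have c2 (r : R -> R * R) : continuous r -> continuous (fun t => (r t).2).
    by move=> cr; apply: continuous_comp2 cr _ => p; exact: cvg_snd.
  pose d t := (q t).2 - (q' t).2.
  have di t : d t \is a Num.int.
    by have := e t; rewrite /P => /tproj_eq/lattBP[_]; rewrite !vec2E.
  have cd : continuous d by apply: continuousD2; [exact: c2|apply: continuousN1; exact: c2].
  have d01 := int_continuous_const cd di 1 0.
  have F t : K (q t) = K (q' t) + Num.floor (d t).
    by rewrite /K -floorDrz// /d addrC subrK.
  by rewrite /increment !F d01 (_ : _ - _ = 0) ?dvdz0//; ring.
- exact: continuous_pair2.
- by rewrite /increment /K /= Y1 floorDrz// ?rpred1// floor1 addrAC subrr add0r.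
Qed.

(** A deck transformation changes w + 2 floor(x) y by an integer which, modulo 2,
    is constant along a path, while w itself changes by a multiple of y. Only
    the parity survives, in accordance with the fact that twice the fiber is a
    commutator of deck transformations. *)
Lemma fibre_loop_not_null (X Y W : R -> R) :
  continuous X -> continuous Y -> continuous W ->
  X 1 = X 0 -> Y 1 = Y 0 -> W 1 = W 0 + 1 ->
  ~ homologous (X := ctotal B) (loop_cycle (fun t => pt (X t) (Y t) (W t))) 0.
Proof.
move=> cX cY cW X1 Y1 W1.
pose P (q : R * R * R) : E := pt q.1.1 q.1.2 q.2.
pose A (q : R * R * R) : R := q.2 + 2 * (Num.floor q.1.1)%:~R * q.1.2.
pose K (q : R * R * R) : int := Num.floor (A q).
apply: (@loop_not_null R (ctotal B) (R * R * R)%type P K 2 _ _ _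
  (fun t => (X t, Y t, W t))) => //.
- move=> H cH Hc; have [X' [Y' [W' [cX' cY' cW' e]]]] := lift_bundle cH Hc.
  exists (fun p => (X' p, Y' p, W' p)); split.
    by apply: continuous_pair2 => //; exact: continuous_pair2.
  by move=> p; rewrite e.
- move=> q q' cq cq' e.
  have c1' (r : R -> R * R * R) : continuous r -> continuous (fun t => (r t).1).
    by move=> cr; apply: continuous_comp2 cr _ => p; exact: cvg_fst.
  have cx (r : R -> R * R * R) : continuous r -> continuous (fun t => (r t).1.1).
    by move=> cr; apply: continuous_comp2 (c1' _ cr) _ => p; exact: cvg_fst.
  have cy (r : R -> R * R * R) : continuous r -> continuous (fun t => (r t).1.2).
    by move=> cr; apply: continuous_comp2 (c1' _ cr) _ => p; exact: cvg_snd.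
  have cw (r : R -> R * R * R) : continuous r -> continuous (fun t => (r t).2).
    by move=> cr; apply: continuous_comp2 cr _ => p; exact: cvg_snd.
  pose m t := (q t).1.1 - (q' t).1.1.
  pose l t := (q t).1.2 - (q' t).1.2.
  pose k t := (q' t).2 - (q t).2 - 2 * m t * (q t).1.2.
  have mlk t : [/\ m t \is a Num.int, l t \is a Num.int & k t \is a Num.int].
    by have /pt_eq := e t.
  have cm : continuous m.
    by apply: continuousD2; [exact: cx|apply: continuousN1; exact: cx].
  have ck : continuous k.
    apply: continuousD2.
      by apply: continuousD2; [exact: cw|apply: continuousN1; exact: cw].
    apply: continuousN1; apply: continuousM2; last exact: cy.
    by apply: continuousM2 => //; exact: cst_continuous.
  have ki t : k t \is a Num.int by case: (mlk t).
  have k01 := int_continuous_const ck ki 1 0.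
  have F t : (2 %| K (q' t) - K (q t) - Num.floor (k t))%Z.
    have [m1 l1 k1] := mlk t.
    have hm : m t = (Num.floor (m t))%:~R by rewrite floorK.
    have hl : l t = (Num.floor (l t))%:~R by rewrite floorK.
    pose n := Num.floor (q' t).1.1.
    have hn : Num.floor (q t).1.1 = n + Num.floor (m t).
      by rewrite /n -floorDrz// /m addrC subrK.
    have -> : K (q' t) = K (q t) + Num.floor (k t + (- (2 * n * Num.floor (l t)))%:~R).
      rewrite /K -floorDrz; last by rewrite rpredD// intr_int.
      congr Num.floor; rewrite /A hn -/n.
      rewrite rmorphN !rmorphM /= rmorphD /= -hm -hl /k /l.
      by rewrite (_ : 2%:~R = 2) //; ring.
    rewrite floorDrz ?intr_int// intrKfloor.
    rewrite (_ : _ - _ = 2 * - (n * Num.floor (l t))); last by ring.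
    exact: dvdz_mulr.
  rewrite /increment.
  have -> : K (q 1) - K (q 0) - (K (q' 1) - K (q' 0)) =
     (K (q' 0) - K (q 0) - Num.floor (k 0)) - (K (q' 1) - K (q 1) - Num.floor (k 1)).
    by rewrite k01; ring.
  exact: rpredB.
- by apply: continuous_pair2 => //; exact: continuous_pair2.
- rewrite /increment /K /A /= X1 Y1 W1 [W 0 + 1]addrC -addrA floorDzr ?rpred1//.
  by rewrite floor1 addrK.
Qed.

End detection.

(** * Turning numbers of plane vector fields *)

Section winding.
Context {R : realType}.

(** Normalised, the field is a map from the square to the circle and lifts to
    an angle; the total turn from t = 0 to t = 1 is an integer that varies
    continuously with s. *)
Lemma winding (f g : R * R -> R) : continuous f -> continuous g ->
  (forall p, 0 <= p.1 <= 1 -> (f p != 0) || (g p != 0)) ->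
  (forall s, 0 <= s <= 1 -> f (s, 0) = f (s, 1) /\ g (s, 0) = g (s, 1)) ->
  exists (th : R * R -> R) (k : int), [/\ continuous th,
    forall s, 0 <= s <= 1 -> th (s, 1) - th (s, 0) = k%:~R &
    forall s t, 0 <= s <= 1 -> 0 <= t <= 1 -> exists2 r, 0 < r &
      f (s, t) = r * cosT (th (s, t)) /\ g (s, t) = r * sinT (th (s, t))].
Proof.
move=> cf cg fg0 per.
pose N p := Num.sqrt (f (clamp2 p) ^+ 2 + g (clamp2 p) ^+ 2).
have cfc : continuous (fun p => f (clamp2 p)).
  exact: continuous_comp2 (@continuous_clamp2 R) cf.
have cgc : continuous (fun p => g (clamp2 p)).
  exact: continuous_comp2 (@continuous_clamp2 R) cg.
have N0 p : 0 < f (clamp2 p) ^+ 2 + g (clamp2 p) ^+ 2.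
  have := fg0 (clamp2 p) (clamp01 _); rewrite lt0r => /orP h.
  by rewrite addr_ge0 ?sqr_ge0// andbT paddr_eq0 ?sqr_ge0// !sqrf_eq0 negb_and; apply/orP.
have Np p : 0 < N p by rewrite sqrtr_gt0.
have cN : continuous N.
  apply: continuous_comp2; last exact: sqrt_continuous.
  by apply: continuousD2; apply: continuousM2.
have cV : continuous (fun p => (N p)^-1).
  by apply: continuousV1 => // p; rewrite gt_eqF.
have Nc p : N (clamp2 p) = N p by rewrite /N clamp2K.
have [||||| th [cth Hth]] := @lift_unit R (fun p => f (clamp2 p) / N p) (fun p => g (clamp2 p) / N p).
- exact: continuousM2.
- exact: continuousM2.
- move=> p; rewrite !expr_div_n -mulrDl sqr_sqrtr ?ltW// divff// gt_eqF//.
- by move=> p; rewrite Nc clamp2K.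
- by move=> p; rewrite Nc clamp2K.
have c10 : clamp (1 : R) = 1 by rewrite clamp_id// ler01 lexx.
have c00 : clamp (0 : R) = 0 by rewrite clamp_id// ler01 lexx.
pose d s := th (s, 1) - th (s, 0).
have di s : d s \is a Num.int.
  have [h1 h2] := Hth (s, 1); have [h3 h4] := Hth (s, 0).
  have [e1 e2] := per (clamp s) (clamp01 s).
  have eN : N (s, 1) = N (s, 0) by rewrite /N /clamp2 /= c10 c00 e1 e2.
  apply: cosT_sinT_inj.
    by rewrite -h1 -h3 eN /clamp2 /= c10 c00 e1.
  by rewrite -h2 -h4 eN /clamp2 /= c10 c00 e2.
have cl a : continuous (fun s : R => th (s, a)).
  have cp : continuous (fun t : R => (t, a)).
    by apply: continuous_pair2 => t; [exact: cvg_id|exact: cvg_cst].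
  exact: continuous_comp2 cp cth.
have cd : continuous d by apply: continuousD2 => //; exact: continuousN1.
have /intrP[k hk] := di 0.
exists th, k; split=> //.
  by move=> s _; rewrite -hk; exact: (int_continuous_const cd di s 0).
move=> s t hs ht; exists (N (s, t)) => //.
have [h1 h2] := Hth (s, t); rewrite -h1 -h2 /clamp2 /= !clamp_id//.
by rewrite ![N _ * _]mulrC !divfK// gt_eqF.
Qed.

(** If the angle returned to its initial value, or passed through another
    whole turn before the end, the intermediate value theorem would produce
    two times with the same direction. *)
Lemma injective_turn (th : R -> R) (k : int) : continuous th ->
  th 1 - th 0 = k%:~R ->
  (forall t t', 0 <= t <= 1 -> 0 <= t' <= 1 -> th t - th t' \is a Num.int ->
    t - t' \is a Num.int) -> `|k| = 1.
Proof.
move=> cth e inj.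
have half (t : R) : 0 < t < 1 -> t \isn't a Num.int.
  move=> /andP[t0 t1]; apply/negP => ti.
  have h : t = 0 by apply: int_small => //; rewrite gtr0_norm.
  by move: t0; rewrite h ltxx.
have I0 : 0 <= (0 : R) <= 1 by rewrite lexx ler01.
have I1 : 0 <= (1 : R) <= 1 by rewrite lexx ler01.
(* For k = 0 the values halfway between th 0 and th (1/2) are taken on both
   halves of the interval. *)
have k0 : k != 0.
  apply/eqP => k0; rewrite k0 in e.
  have e01 : th 1 = th 0 by apply/eqP; rewrite -subr_eq0 e.
  have I2 : 0 <= (2^-1 : R) <= 1 by apply/andP; split; lra.
  have hh : th 2^-1 != th 0.
    apply/eqP => h; have := inj 2^-1 0 I2 I0; rewrite h subrr rpred0 subr0.
    by move=> /(_ isT); apply/negP; apply: half; apply/andP; split; lra.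
  pose v := (th 0 + th 2^-1) / 2.
  have b1 : (th 0 <= v <= th 2^-1) || (th 2^-1 <= v <= th 0).
    by rewrite /v; case: (leP (th 0) (th 2^-1)) => h; apply/orP; [left|right]; lra.
  have b2 : (th 2^-1 <= v <= th 1) || (th 1 <= v <= th 2^-1).
    by rewrite e01 orbC.
  have [|t1 /andP[p1 p2] v1] := IVT_line cth _ b1; first lra.
  have [|t2 /andP[q1 q2] v2] := IVT_line cth _ b2; first lra.
  have vn : v != th 2^-1 /\ v != th 0.
    by split; apply/eqP; rewrite /v => h; move/eqP: hh; apply; lra.
  have n1 : t1 != 2^-1 by apply/eqP => h; case: vn => /eqP h1 _; apply: h1; rewrite -v1 h.
  have n2 : t1 != 0 by apply/eqP => h; case: vn => _ /eqP h1; apply: h1; rewrite -v1 h.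
  have := inj t2 t1; rewrite v1 v2 subrr rpred0.
  have p3 : t1 < 2^-1 by rewrite lt_neqAle n1.
  have p4 : 0 < t1 by rewrite lt_neqAle eq_sym n2.
  have J2 : 0 <= t2 <= 1 by apply/andP; split; lra.
  have J1 : 0 <= t1 <= 1 by apply/andP; split; lra.
  by move=> /(_ J2 J1 isT); apply/negP; apply: half; apply/andP; split; lra.
(* For |k| > 1 one full turn is completed at an interior time c. *)
apply/eqP; apply: contraT => k1.
pose v := th 0 + (Num.sg k)%:~R.
have [c c01 thc] : exists2 c, 0 <= c <= 1 & th c = v.
  apply: IVT_line cth ler01 _.
  have [kp|kn|kz] := ltrgt0P k; last by rewrite kz eqxx in k0.
    rewrite gtr0_norm// in k1.
    have : (1 : R) <= k%:~R by rewrite -[1]/(1%:~R) ler_int.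
    by move=> h; rewrite /v gtr0_sg//; apply/orP; left; apply/andP; split; lra.
  have : k%:~R <= (-1 : R) by rewrite (_ : -1 = (-1)%:~R)// ler_int -ltzD1 addNr.
  by move=> h; rewrite /v ltr0_sg// rmorphN; apply/orP; right; apply/andP; split; lra.
have ic : c - 0 \is a Num.int.
  by apply: inj => //; rewrite thc /v addrAC subrr add0r intr_int.
have c0 : c != 0.
  apply/eqP => h; move: thc; rewrite h /v => /eqP.
  by rewrite -subr_eq0 opprD addNKr oppr_eq0 intr_eq0 sgr_eq0 (negbTE k0).
have c1' : c = 1.
  move: c01 => /andP[p q]; apply/eqP; rewrite eq_le q leNgt; apply/negP => h.
  have : c \isn't a Num.int by apply: half; rewrite lt_neqAle eq_sym c0 p.
  by rewrite subr0 in ic; rewrite ic.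
move: thc; rewrite c1' /v => h; move: e; rewrite h addrAC subrr add0r => /eqP.
rewrite eqr_int => /eqP h1; move: k1; by rewrite -h1 normr_sg k0.
Qed.

End winding.

(** * The turning number of a Legendrian knot *)

Section velocity.
Context {R : realType}.
Local Notation V := 'rV[R]_2.
Local Notation T := (torus_surface (R := R)).
Local Notation L := (torus_line (R := R)).
Local Notation B := (torus_contact (R := R)).
Local Notation E := (circle_bundle L).

Lemma derive_line_eq (U U' W : normedModType R) (f : U -> W) (g : U' -> W) x v y w :
  (forall h : R, f (h *: v + x) = g (h *: w + y)) -> 'D_v f x = 'D_w g y.
Proof.
move=> fg; rewrite derive_line [RHS]derive_line.
suff -> : (fun t : R => f (t *: v + x)) = (fun t : R => g (t *: w + y)) by [].
exact/funext.
Qed.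

(** The coordinates of a velocity do not depend on the chart, because charts
    differ by translations. *)
Lemma chart_velocity (U : normedModType R) (f : U -> T) p v (c d : V) :
  tdom c (f p) -> tdom d (f p) ->
  {for p, continuous (fun q => tcrd d (f q))} ->
  derivable (fun q => tcrd d (f q)) p v ->
  'D_v (fun q => tcrd c (f q)) p = 'D_v (fun q => tcrd d (f q)) p.
Proof.
move=> cp dp cd dd; set q0 := tcrd d (f p).
have e0 : tproj q0 = f p := tproj_tcrd d (f p).
have cq : tdom c (tproj q0) by rewrite e0.
have h : nbhs q0 [set q' | tcrd c (tproj q') = q' + (tcrd c (tproj q0) - q0)].
  by apply: filterS (tcrd_near cq) => q' [].
have h' : \forall p' \near p, tcrd d (f p') + (tcrd c (tproj q0) - q0) = tcrd c (f p').
  have h2 := cd _ h.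
  have {}h2 : nbhs p ((fun q => tcrd d (f q)) @^-1` [set q' | tcrd c (tproj q') = q' + (tcrd c (tproj q0) - q0)]) := h2.
  by apply: filterS h2 => p' /= <-; rewrite tproj_tcrd.
apply: etrans (esym (near_eq_derive v h')) _.
have [_] := is_deriveD (derivableP dd) (is_derive_cst (tcrd c (tproj q0) - q0) p v).
by rewrite addr0.
Qed.

Section isotopy.
Variable G : R -> R -> E.
Hypothesis sG : smooth_to_bundle (fun p : R^o * R^o => G p.1 p.2).
Local Notation U := (R^o * R^o)%type.
Let f (p : U) : T := bproj (G p.1 p.2).
Let dt : U := (0, 1).

(** The velocity of the projection, read at each point in the chart centred at
    its representative. Any fixed choice of charts would do. *)
Definition vel (p : U) : V := 'D_dt (fun q => tcrd (trep (f p)) (f q)) p.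

Lemma tdom_trep (x : torus R) : tdom (trep x) x.
Proof.
have := @tcrdE R (trep x) (trep x) (trep x) (box_center _).
by rewrite trepK subrr latt0 => /(_ isT) e; rewrite /tdom /= e; exact: box_center.
Qed.

Lemma fsm (c : V) : smooth_on (f @^-1` tdom c) (fun q => tcrd c (f q)).
Proof. by case: sG => -[_ h] _; exact: h. Qed.

Lemma f_continuous : continuous f.
Proof. by case: sG => -[]. Qed.

Lemma velE c p : tdom c (f p) -> vel p = 'D_dt (fun q => tcrd c (f q)) p.
Proof.
move=> cp; have [cc dd] := fsm [::] cp.
by apply: chart_velocity => //; exact: tdom_trep.
Qed.

(** Near p the velocity is a derivative in one fixed chart. *)
Lemma vel_continuous : continuous vel.
Proof.
move=> p; have [c cp] := tdom_cover (f p).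
have [cc _] := fsm [:: dt] cp.
apply: (@near_eq_continuous_at _ _ ('D_dt (fun q => tcrd c (f q)))); last exact: cc.
have h : \forall q \near p, tdom c (f q).
  by apply: f_continuous; apply: open_nbhs_nbhs; split=> //; exact: tdom_open.
by apply: filterS h => q cq; rewrite (velE cq).
Qed.

Lemma vel_slice c s t : tdom c (bproj (G s t)) ->
  vel (s, t) = derive1 (@crd R T c \o @bproj R T L \o G s) t.
Proof.
move=> cp; apply: etrans (velE (p := (s, t)) cp) _.
rewrite derive1E; apply: derive_line_eq => h /=.
by rewrite /f /= scaler0 add0r.
Qed.

End isotopy.

Lemma periodic_velocity (g : R -> E) (c : V) :
  (forall t, g (t + 1) = g t) ->
  derive1 (@crd R T c \o @bproj R T L \o g) 1 = derive1 (@crd R T c \o @bproj R T L \o g) 0.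
Proof.
move=> per; rewrite !derive1E; apply: derive_line_eq => h /=; by rewrite addr0 per.
Qed.

Lemma fcrd_unit (e : framing L) (u : E) : fcrd e u 0 0 ^+ 2 + fcrd e u 0 1 ^+ 2 = 1.
Proof. by rewrite fcrdE; apply: unturn_unit; apply: reim_unit; exact: vec_unit. Qed.

Lemma coord_derive (W : normedModType R) (F : W -> V) x v i : derivable F x v ->
  is_derive x v (fun q => F q 0 i) ('D_v F x 0 i).
Proof.
move=> dF; rewrite derive_mx// mxE; apply: derivableP.
by move/derivable_mxP: dF; exact.
Qed.

Lemma unit_velocity (z : R -> V) t : (forall t, z t 0 0 ^+ 2 + z t 0 1 ^+ 2 = 1) ->
  derivable z t 1 -> z t 0 0 * derive1 z t 0 0 + z t 0 1 * derive1 z t 0 1 = 0.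
Proof.
move=> zu dz; rewrite derive1E.
have d0 := coord_derive 0 dz; have d1 := coord_derive 1 dz.
have D := is_deriveD (is_deriveM d0 d0) (is_deriveM d1 d1).
have e : ((fun q => z q 0 0) * (fun q => z q 0 0) + (fun q => z q 0 1) * (fun q => z q 0 1)) = cst 1.
  by apply/funext => q /=; rewrite -(zu q) !expr2.
have := @derive_cst R R R 1 t 1; rewrite -e; have [_ ->] := D.
rewrite /GRing.scale /= => h; lra.
Qed.

(** If the base velocity vanished, the contact condition would reduce to z /\
    z' = 0 for the fiber coordinate z of length 1. As z is also orthogonal to
    z', this forces z' = 0, so the knot would not be immersed. *)
Lemma legendrian_velocity (g : R -> E) (c : V) t : legendrian_knot (B := B) g ->
  tdom c (bproj (g t)) -> derive1 (@crd R T c \o @bproj R T L \o g) t != 0.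
Proof.
move=> [[[[_ sg] sz] _ im] al] ct; apply/eqP => x0.
have [e et] := tdom_cover (bproj (g t)).
have := al e c t et ct; rewrite /alpha_velocity x0.
have -> : dot2 (Defs.form (cconn B) e c ((@crd R T c \o @bproj R T L \o g) t)) 0 = 0.
  by rewrite /dot2 big1// => i _; rewrite [X in _ * X]mxE mulr0.
rewrite addr0 => w0.
have [_ dz] := sz e [::] t et.
have := im e c t et ct; rewrite x0 eqxx => -[//|/eqP]; apply.
pose z := @fcrd R T L e \o g.
have zu q : z q 0 0 ^+ 2 + z q 0 1 ^+ 2 = 1 by exact: fcrd_unit.
have w1 : z t 0 0 * derive1 z t 0 1 - z t 0 1 * derive1 z t 0 0 = 0 := w0.
change (derive1 z t = 0).
have := unit_velocity zu (dz 1); have := zu t; move: w1 {w0}.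
move: (derive1 z t) (z t) => z' {zu dz}z w0 u0 d0.
(* Both components of z' are combinations of the wedge product and the scalar
   product of z and z'. *)
apply: vec2_eqP; rewrite mxE.
  rewrite -[LHS]mulr1 -u0 (_ : _ * _ = z 0 0 * (z 0 0 * z' 0 0 + z 0 1 * z' 0 1)
    - z 0 1 * (z 0 0 * z' 0 1 - z 0 1 * z' 0 0)); last by ring.
  by rewrite d0 w0; ring.
rewrite -[LHS]mulr1 -u0 (_ : _ * _ = z 0 1 * (z 0 0 * z' 0 0 + z 0 1 * z' 0 1)
  + z 0 0 * (z 0 0 * z' 0 1 - z 0 1 * z' 0 0)); last by ring.
by rewrite d0 w0; ring.
Qed.

(** Stated through a vector field v on the line, since no single chart need
    contain the whole knot. *)
Definition velocity_angle (h : R -> E) (th : R -> R) := exists v : R -> V,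
  [/\ continuous v,
    forall c t, tdom c (bproj (h t)) -> v t = derive1 (@crd R T c \o @bproj R T L \o h) t &
    forall t, 0 <= t <= 1 -> exists2 r, 0 < r &
      v t = vec2 (r * cosT (th t)) (r * sinT (th t))].

(** The end parametrisations h0, h1 have the images of g0, g1 but may differ
    from them by any reparametrisation. *)
Lemma isotopy_winding (g0 g1 : R -> E) : legendrian_isotopic (B := B) g0 g1 ->
  exists (h0 h1 : R -> E) (th0 th1 : R -> R) (k : int),
  [/\ legendrian_knot (B := B) h0 /\ legendrian_knot (B := B) h1,
     range h0 = range g0 /\ range h1 = range g1,
     continuous th0 /\ continuous th1,
     th0 1 - th0 0 = k%:~R /\ th1 1 - th1 0 = k%:~R &
     velocity_angle h0 th0 /\ velocity_angle h1 th1].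
Proof.
move=> [G [sG LG r0 r1]].
have cv := vel_continuous sG.
have cx : continuous (fun p : R * R => vel G p 0 0).
  exact: continuous_comp2 cv (@coord_continuous R _ _ 0 0).
have cy : continuous (fun p : R * R => vel G p 0 1).
  exact: continuous_comp2 cv (@coord_continuous R _ _ 0 1).
have [||th [k [cth hk hth]]] := winding cx cy.
- move=> [s t] /= hs; have [c ct] := tdom_cover (bproj (G s t)).
  have := legendrian_velocity (LG s hs) ct; rewrite -(vel_slice sG ct).
  apply: contraNT; rewrite negb_or !negbK => /andP[/eqP h0 /eqP h1].
  by apply/eqP; apply: vec2_eqP; rewrite mxE.
- move=> s hs; have [[_ gi _] _] := LG s hs.
  have per t : G s (t + 1) = G s t.
    by apply/gi; exists 1; rewrite addrAC subrr add0r.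
  have e10 : G s 1 = G s 0 by rewrite -(per 0) add0r.
  have [c ct] := tdom_cover (bproj (G s 0)).
  suff -> : vel G (s, 0) = vel G (s, 1) by [].
  rewrite (vel_slice sG ct) (@vel_slice G sG c s 1) ?e10//.
  by rewrite periodic_velocity.
have I0 : 0 <= (0 : R) <= 1 by rewrite lexx ler01.
have I1 : 0 <= (1 : R) <= 1 by rewrite lexx ler01.
have cl a : continuous (fun t : R => (a, t) : R * R).
  by apply: continuous_pair2 => t; [exact: cvg_cst|exact: cvg_id].
have K s : 0 <= s <= 1 -> velocity_angle (G s) (fun t => th (s, t)).
  move=> hs; exists (fun t => vel G (s, t)); split.
  - exact: continuous_comp2 (cl s) cv.
  - by move=> c t ct; rewrite (vel_slice sG ct).
  - move=> t ht; have [r rp [h0 h1]] := hth s t hs ht; exists r => //.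
    by apply: vec2_eqP; rewrite vec2E.
exists (G 0), (G 1), (fun t => th (0, t)), (fun t => th (1, t)), k; split=> //.
- by split; exact: LG.
- by split; exact: continuous_comp2 (cl _) cth.
- by rewrite !hk.
- by split; exact: K.
Qed.

End velocity.

(** * Legendrian parametrisations near the line x = 0 *)

Section straight_line.
Context {R : realType}.
Local Notation V := 'rV[R]_2.
Local Notation T := (torus_surface (R := R)).
Local Notation L := (torus_line (R := R)).
Local Notation B := (torus_contact (R := R)).
Local Notation E := (circle_bundle L).

(** If a coordinate stays close to the centre of a chart then the chart gives
    it back, whatever the other coordinate does. *)
Lemma tcrd_coord (c q : V) i a : `|a - c 0 i| < 2^-1 -> a - q 0 i \is a Num.int ->
  tcrd c (tproj q) 0 i = a.
Proof.
move=> ac aq; have := latt_trep q => /lattBP[l0 l1].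
have li : trep (tproj q) 0 i - q 0 i \is a Num.int by case: (ord2P i) => ->.
have e : tcrd c (tproj q) 0 i = nearest (c 0 i) (trep (tproj q) 0 i).
  by rewrite tcrd_nearest; case: (ord2P i) => ->; rewrite vec2E.
rewrite e; apply: nearestE => //.
by rewrite -(subrKA (q 0 i)); apply: rpredD => //; rewrite -opprB rpredN.
Qed.

Lemma tcrd_small0 (x y y0 : R) : `|x| < 2^-1 ->
  tcrd (vec2 0 y0) (tproj (vec2 x y)) 0 0 = x.
Proof. by move=> hx; apply: tcrd_coord; rewrite vec2E ?subr0// subrr rpred0. Qed.

Lemma tcrd_small1 (x y : R) : `|y| < 2^-1 ->
  tcrd (vec2 0 0) (tproj (vec2 x y)) 0 1 = y.
Proof. by move=> hx; apply: tcrd_coord; rewrite vec2E ?subr0// subrr rpred0. Qed.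

Lemma tdom_small (x y : R) : `|x| < 2^-1 -> tdom (vec2 0 y) (tproj (vec2 x y)).
Proof.
move=> hx; rewrite /tdom /= /box tcrd_small0// (@tcrd_coord _ _ 1 y); first last.
- by rewrite vec2E subrr rpred0.
- by rewrite vec2E subrr normr0; lra.
- by rewrite !vec2E subr0 subrr normr0; split=> //; lra.
Qed.

Section curve.
Variables (h : R -> E) (v : R -> V).
Hypothesis Lh : legendrian_knot (B := B) h.
Hypothesis hv : forall c t, tdom c (bproj (h t)) ->
  v t = derive1 (@crd R T c \o @bproj R T L \o h) t.

Lemma crd_derivable (c : V) t : tdom c (bproj (h t)) ->
  derivable (fun t => tcrd c (bproj (h t))) t 1.
Proof. by move=> ct; case: Lh => -[[[_ sg] _] _ _] _; have [_] := sg c [::] t ct; exact. Qed.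

Lemma fcrd_smooth (e : V) t : tdom e (bproj (h t)) ->
  {for t, continuous (fun t => fcrd (e : framing L) (h t))} /\
  derivable (fun t => fcrd (e : framing L) (h t)) t 1.
Proof.
by move=> et; case: Lh => -[[_ sz] _ _] _; have [c d] := sz e [::] t et; split; [exact: c|exact: d].
Qed.

Lemma coord_velocity (c : V) t i : tdom c (bproj (h t)) ->
  is_derive t 1 (fun t => tcrd c (bproj (h t)) 0 i) (v t 0 i).
Proof.
by move=> ct; rewrite (hv ct) derive1E; apply: coord_derive; exact: crd_derivable.
Qed.

(* A reparametrised knot is given only pointwise as [pt (x t) (y t) (w t)],
   without any regularity of x, y and w. As long as x is small, x and the
   class of w can be read off in charts, so they inherit regularity and the
   contact equation from the smoothness of h. *)
Section coordinates.
Variables x y w : R -> R.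
Hypothesis hE : forall t, h t = pt (x t) (y t) (w t).
Hypothesis x_small : forall t, `|x t| < 2^-1.

Let tdomE t : tdom (vec2 0 (y t)) (bproj (h t)).
Proof. by rewrite hE; exact: tdom_small. Qed.

Lemma x_velocity (t : R) : is_derive t 1 x (v t 0 0).
Proof.
rewrite (_ : x = fun t' => tcrd (vec2 0 (y t)) (bproj (h t')) 0 0).
  exact: coord_velocity.
by apply/funext => t'; rewrite hE /= tcrd_small0.
Qed.

Lemma fcrd_small y0 t : fcrd (vec2 0 y0 : framing L) (h t) = circle_point (w t).
Proof. by rewrite hE fcrd_pt tcrd_small0// subrr mulr0 mul0r subr0. Qed.

Lemma w_derivable (t : R) : {for t, continuous (circle_point \o w)} /\ derivable (circle_point \o w) t 1.
Proof.
rewrite (_ : circle_point \o w = fun t' => fcrd (vec2 0 (y t) : framing L) (h t')).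
  exact: fcrd_smooth.
by apply/funext => t'; rewrite fcrd_small.
Qed.

(** The contact condition in the frame over the chart centred at x = 0. The
    derivative of y does not make sense here and is replaced by the base
    velocity. *)
Lemma contact_coord t :
  wedge2 (circle_point (w t)) (derive1 (circle_point \o w) t) + 4 * pi * x t * v t 0 1 = 0.
Proof.
have [_ al] := Lh; have := al (vec2 0 (y t)) (vec2 0 (y t)) t (tdomE t) (tdomE t).
rewrite /alpha_velocity -(hv (tdomE t)).
have e : @fcrd R T L (vec2 0 (y t)) \o h = circle_point \o w.
  by apply/funext => t'; rewrite /= fcrd_small.
rewrite [X in wedge2 (X t) _]e [X in derive1 X t]e /=.
by rewrite /tform tproj_tcrd hE /= tcrd_small0// dot2_vec2 mul0r add0r.
Qed.

End coordinates.
End curve.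

Lemma cosT_half_turn : cosT (2^-1 : R) = -1.
Proof. by rewrite /cosT mulrAC divff// mul1r cospi. Qed.

(** The velocity is vertical, so twice its angle is half a turn modulo
    integers; being continuous, the angle is constant. *)
Lemma straight_turn (h : R -> E) (th : R -> R) (k : int) : legendrian_knot (B := B) h ->
  range h = range (fun t : R => pt 0 t 0 : E) -> continuous th ->
  th 1 - th 0 = k%:~R -> velocity_angle h th -> k = 0.
Proof.
move=> Lh rh cth hk [v [cv hv hth]].
have /choice[y hy] t : exists y, h t = pt 0 y 0.
  have : range h (h t) by exists t.
  by rewrite rh => -[y _ <-]; exists y.
have v0 t : v t 0 0 = 0.
  have x0 (s : R) : `|(0 : R)| < 2^-1 by rewrite normr0; lra.
  have [_ <-] := @x_velocity h v Lh hv (fun=> 0) y (fun=> 0) hy x0 t.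
  exact: derive_cst.
have c0 t : 0 <= t <= 1 -> cosT (th t) = 0.
  move=> ht; have [r rp /(congr1 (fun u : V => u 0 0))] := hth t ht.
  by rewrite vec2E v0 => /esym/eqP; rewrite mulf_eq0 gt_eqF//= => /eqP.
pose d t := 2 * th (clamp t) + 2^-1.
have di t : d t \is a Num.int.
  have c := c0 (clamp t) (clamp01 t).
  have hs := cosT2DsinT2 (th (clamp t)); rewrite c expr0n add0r in hs.
  apply: cosT_eq1; rewrite /d cosTD mulr_natl mulr2n cosTD sinTD c cosT_half_turn.
  by rewrite -[RHS]hs; ring.
have cd : continuous d.
  apply: continuousD2; last exact: cst_continuous.
  apply: continuousM2; first exact: cst_continuous.
  exact: continuous_comp2 (@continuous_clamp R) cth.
have := int_continuous_const cd di 1 0.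
rewrite /d !clamp_id ?ler01 ?lexx// => /addIr h1.
have e : th 1 = th 0 by lra.
by move: hk; rewrite e subrr => /esym/eqP; rewrite intr_eq0 => /eqP.
Qed.

End straight_line.

(** * Turning numbers of multiply wound circles *)

Section wound_circles.
Context {R : realType}.
Local Notation V := 'rV[R]_2.
Local Notation T := (torus_surface (R := R)).
Local Notation L := (torus_line (R := R)).
Local Notation B := (torus_contact (R := R)).
Local Notation E := (circle_bundle L).

(** The third coordinate plus xy is the parameter itself, and it is preserved
    by the identifications that keep x and y. *)
Lemma sheared_eq (X Y : R -> R) s t :
  (forall t, `|X t| < 2^-1) -> (forall t, `|Y t| < 2^-1) ->
  (forall t m, m \is a Num.int -> X (t + m) = X t /\ Y (t + m) = Y t) ->
  pt (X s) (Y s) (s - X s * Y s) = pt (X t) (Y t) (t - X t * Y t) <->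
  s - t \is a Num.int.
Proof.
move=> hX hY per; split=> [/pt_eq[h1 h2]|st].
  have small (a b : R) : `|a| < 2^-1 -> `|b| < 2^-1 -> a - b \is a Num.int -> a = b.
    move=> ha hb hi; apply/eqP; rewrite -subr_eq0; apply/eqP/int_small => //.
    by move: ha hb; rewrite !ltr_norml => /andP[? ?] /andP[? ?]; apply/andP; split; lra.
  rewrite (small _ _ (hX s) (hX t) h1) (small _ _ (hY s) (hY t) h2) subrr mulr0 mul0r subr0.
  by rewrite (_ : _ - _ = - (s - t)) ?rpredN//; ring.
have [hx hy] := per t _ st; rewrite addrC subrK in hx hy.
apply/pt_eq; rewrite hx hy; split; rewrite ?subrr ?rpred0//.
by rewrite (_ : _ - _ = - (s - t)) ?rpredN//; ring.
Qed.

Definition circX (r : R) (m : nat) (t : R) := r * sinT (m%:R * t).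
Definition circY (r : R) (m : nat) (t : R) := r * cosT (m%:R * t).
Definition circ r m (t : R) : E :=
  pt (circX r m t) (circY r m t) (t - circX r m t * circY r m t).

Lemma circ_small r m t : 0 < r < 2^-1 ->
  `|circX r m t| < 2^-1 /\ `|circY r m t| < 2^-1.
Proof.
move=> /andP[r0 r1]; rewrite /circX /circY !normrM (gtr0_norm r0).
by split; apply: le_lt_trans r1; rewrite ger_pMr//; [exact: sin_max|exact: cos_max].
Qed.

Lemma circ_per r m t n : n \is a Num.int ->
  circX r m (t + n) = circX r m t /\ circY r m (t + n) = circY r m t.
Proof.
move=> hn; rewrite /circX /circY mulrDr sinT_periodic ?cosT_periodic//;
  by apply: rpredM => //; exact: rpred_nat.
Qed.

Lemma circ_eq r m s t : 0 < r < 2^-1 -> circ r m s = circ r m t <-> s - t \is a Num.int.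
Proof.
move=> hr; apply: sheared_eq => [u|u|u n]; first by case: (circ_small m u hr).
  by case: (circ_small m u hr).
exact: circ_per.
Qed.

(* The function phi is an arbitrary choice of parameters on the circle, with
   no continuity assumed. *)
Section circle_angle.
Variables (r : R) (m : nat) (h : R -> E) (th phi : R -> R).
Hypothesis hr : 0 < r < 2^-1.
Hypothesis Lh : legendrian_knot (B := B) h.
Hypothesis hE : forall t, h t = circ r m (phi t).
Hypothesis cth : continuous th.
Hypothesis ang : velocity_angle h th.

Let r0 : r != 0. Proof. by rewrite gt_eqF//; case/andP: hr. Qed.

Lemma circ_tdom (t : R) : tdom (vec2 0 0) (bproj (h t)).
Proof.
have [hx hy] := circ_small m (phi t) hr.
rewrite hE /tdom /= /box tcrd_small0// tcrd_small1// !vec2E !subr0; by split.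
Qed.

Lemma circ_crd (t : R) : tcrd (vec2 0 0) (bproj (h t)) = vec2 (circX r m (phi t)) (circY r m (phi t)).
Proof.
have [hx hy] := circ_small m (phi t) hr.
by apply: vec2_eqP; rewrite hE vec2E ?tcrd_small0 ?tcrd_small1.
Qed.

Lemma circ_continuous : continuous (fun t => circX r m (phi t)) /\ continuous (fun t => circY r m (phi t)).
Proof.
have c (t : R) : {for t, continuous (fun t => tcrd (vec2 0 0) (bproj (h t)))}.
  by case: Lh => -[[[_ sg] _] _ _] _; have [] := sg (vec2 0 0 : V) [::] t (circ_tdom t).
split=> t.
  rewrite (_ : (fun t => _) = fun t => tcrd (vec2 0 0) (bproj (h t)) 0 0).
    exact: (continuous_comp (c t) (@coord_continuous R _ _ 0 0 _)).
  by apply/funext => s; rewrite circ_crd vec2E.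
rewrite (_ : (fun t => _) = fun t => tcrd (vec2 0 0) (bproj (h t)) 0 1).
  exact: (continuous_comp (c t) (@coord_continuous R _ _ 0 1 _)).
by apply/funext => s; rewrite circ_crd vec2E.
Qed.

(** The coordinate u = w + xy, modulo 1, is phi; it can be read from the fiber
    coordinate of h. *)
Lemma phase_continuous : continuous (fun t => cosT (phi t)) /\ continuous (fun t => sinT (phi t)).
Proof.
have [cX cY] := circ_continuous.
pose z t := unturn (- (circX r m (phi t) * circY r m (phi t))) (fcrd (vec2 0 0 : framing L) (h t)).
have zE t : z t = circle_point (phi t).
  have [hx hy] := circ_small m (phi t) hr.
  rewrite /z hE fcrd_pt tcrd_small0// subrr mulr0 mul0r subr0.
  set a := _ * _; apply: vec2_eqP; rewrite /unturn /circle_point !vec2E cosTN sinTN.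
    by rewrite cosTD sinTD cosTN sinTN -[RHS]mulr1 -(cosT2DsinT2 a); ring.
  by rewrite cosTD sinTD cosTN sinTN -[RHS]mulr1 -(cosT2DsinT2 a); ring.
have cz : continuous z.
  move=> t; apply: (@unturn_continuous_at R _ (fun t => - (circX r m (phi t) * circY r m (phi t)))
    (fun t => fcrd (vec2 0 0 : framing L) (h t))).
    by apply: continuousN1; exact: continuousM2.
  by have [] := @fcrd_smooth R h Lh (vec2 0 0) t (circ_tdom t).
split.
  rewrite (_ : (fun t => _) = fun t => z t 0 0).
    exact: (continuous_comp2 cz (@coord_continuous R _ _ 0 0)).
  by apply/funext => t; rewrite zE vec2E.
rewrite (_ : (fun t => _) = fun t => z t 0 1).
  exact: (continuous_comp2 cz (@coord_continuous R _ _ 0 1)).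
by apply/funext => t; rewrite zE vec2E.
Qed.

(** The curve stays on a circle about the origin, so its velocity is tangent
    to that circle, and the tangent at parameter phi has angle - m phi up to
    half a turn. *)
Lemma circ_orthogonal (t : R) : 0 <= t <= 1 -> sinT (th t + m%:R * phi t) = 0.
Proof.
move=> ht; have [v [cv hv hth]] := ang.
have d0 := coord_velocity Lh hv 0 (circ_tdom t).
have d1 := coord_velocity Lh hv 1 (circ_tdom t).
have D := is_deriveD (is_deriveM d0 d0) (is_deriveM d1 d1).
have e : ((fun t => tcrd (vec2 0 0) (bproj (h t)) 0 0) * (fun t => tcrd (vec2 0 0) (bproj (h t)) 0 0)
   + (fun t => tcrd (vec2 0 0) (bproj (h t)) 0 1) * (fun t => tcrd (vec2 0 0) (bproj (h t)) 0 1)) = cst (r ^+ 2).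
  apply/funext => q /=; rewrite /GRing.add /GRing.mul /= circ_crd !vec2E.
  by rewrite -[RHS]mulr1 -(cosT2DsinT2 (m%:R * phi q)) /circX /circY; ring.
have := @derive_cst R R R (r ^+ 2) t 1; rewrite -e; have [_ ->] := D.
have [rho rp ->] := hth t ht.
rewrite circ_crd !vec2E /GRing.scale /= /circX /circY sinTD => hh.
have : (2 * r * rho) * (sinT (th t) * cosT (m%:R * phi t) + cosT (th t) * sinT (m%:R * phi t)) = 0.
  by rewrite -[RHS]hh; ring.
move=> /eqP; rewrite mulf_eq0 => /orP[|/eqP//].
by rewrite !mulf_eq0 pnatr_eq0 (negbTE r0) (gt_eqF rp).
Qed.

(** The function th + m phi takes values in (1/2) Z and is continuous modulo
    1, hence constant modulo 1. Its cosine is continuous even where phi jumps,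
    and it keeps its sign. *)
Lemma circ_const s t : 0 <= s <= 1 -> 0 <= t <= 1 ->
  (th s + m%:R * phi s) - (th t + m%:R * phi t) \is a Num.int.
Proof.
suff H a b : a <= b -> 0 <= a -> b <= 1 -> (th a + m%:R * phi a) - (th b + m%:R * phi b) \is a Num.int.
  move=> /andP[s0 s1'] /andP[t0 t1']; case: (leP s t) => st; first exact: H.
  by rewrite -opprB rpredN; apply: H => //; exact: ltW.
move=> ab a0 b1.
pose f t := cosT (th t + m%:R * phi t).
have cf : continuous f.
  have [cX cY] := circ_continuous.
  have cc := continuous_comp2 cth (@continuous_cosT R).
  have cs := continuous_comp2 cth (@continuous_sinT R).
  rewrite (_ : f = fun t => cosT (th t) * (circY r m (phi t) * r^-1) - sinT (th t) * (circX r m (phi t) * r^-1)).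
    apply: continuousD2; [|apply: continuousN1]; apply: continuousM2 => //;
      by apply: continuousM2 => //; exact: cst_continuous.
  by apply/funext => u; rewrite /f cosTD /circX /circY; field.
have f2 u : 0 <= u <= 1 -> f u ^+ 2 = 1.
  by move=> hu; rewrite -(cosT2DsinT2 (th u + m%:R * phi u)) circ_orthogonal// expr0n addr0.
have ha : 0 <= a <= 1 by rewrite a0 (le_trans ab).
have hb : 0 <= b <= 1 by rewrite b1 (le_trans a0).
have sg : 0 < f a * f b.
  apply: nonzero_sign ab cf _ => u /andP[ua ub].
  have hu : 0 <= u <= 1 by rewrite (le_trans a0 ua) (le_trans ub b1).
  by rewrite -sqrf_eq0 f2// oner_eq0.
apply: cosT_sinT_inj; last by rewrite !circ_orthogonal.
rewrite -/(f a) -/(f b).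
have : f a ^+ 2 == f b ^+ 2 by rewrite !f2.
rewrite eqf_sqr => /orP[/eqP//|/eqP e]; move: sg.
by rewrite e mulNr -expr2 f2// ltr0N1.
Qed.

End circle_angle.

(** For m = 1 equal directions mean equal points of the circle. *)
Lemma circ_turn1 r (h : R -> E) (th phi : R -> R) (k : int) : 0 < r < 2^-1 ->
  legendrian_knot (B := B) h -> (forall t, h t = circ r 1 (phi t)) ->
  continuous th -> velocity_angle h th -> th 1 - th 0 = k%:~R -> `|k| = 1.
Proof.
move=> hr Lh hE cth ang hk; apply: (injective_turn cth hk) => s t hs ht hi.
have := circ_const hr Lh hE cth ang hs ht; rewrite !mul1r => hc.
have /(circ_eq 1 _ _ hr) : phi s - phi t \is a Num.int.
  rewrite (_ : _ - _ = (th s + phi s - (th t + phi t)) - (th s - th t)); last by ring.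
  exact: rpredB.
rewrite -!hE => e; have [[_ gi _] _] := Lh.
by have /gi[n ->] := e; exact: intr_int.
Qed.

(** For m = 2 the angle of the velocity is - 2 phi plus a constant, and phi
    itself advances by an integer over one period, so k is even. As phi is
    only continuous modulo 1, the function f tracks phi + th / 2, whose values
    lie in a coset of (1/2) Z. *)
Lemma circ_turn2 r (h : R -> E) (th phi : R -> R) (k : int) : 0 < r < 2^-1 ->
  legendrian_knot (B := B) h -> (forall t, h t = circ r 2 (phi t)) ->
  continuous th -> velocity_angle h th -> th 1 - th 0 = k%:~R -> `|k| != 1.
Proof.
move=> hr Lh hE cth ang hk.
have I0 : 0 <= (0 : R) <= 1 by rewrite lexx ler01.
have I1 : 0 <= (1 : R) <= 1 by rewrite lexx ler01.
pose a0 := phi 0 + th 0 / 2.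
pose f t := cosT (phi t + (th t / 2 - a0)).
have cf : continuous f.
  have [cc cs] := phase_continuous hr Lh hE.
  have ct : continuous (fun t => th t / 2 - a0).
    apply: continuousD2; last exact: cst_continuous.
    by apply: continuousM2 => //; exact: cst_continuous.
  rewrite (_ : f = fun t => cosT (phi t) * cosT (th t / 2 - a0) - sinT (phi t) * sinT (th t / 2 - a0)).
    by apply: continuousD2; [|apply: continuousN1]; apply: continuousM2 => //;
      [exact: continuous_comp2 ct (@continuous_cosT R)|exact: continuous_comp2 ct (@continuous_sinT R)].
  by apply/funext => t; rewrite /f cosTD.
have f0 t : 0 <= t <= 1 -> f t != 0.
  move=> ht; have := circ_const hr Lh hE cth ang ht I0 => hc.
  have [] := cosT_sinT_int hc.
  rewrite (_ : _ - _ = (phi t + (th t / 2 - a0)) + (phi t + (th t / 2 - a0))); last first.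
    by rewrite /a0; field.
  rewrite cosTD -/(f t) => e _; apply/eqP => f0; move: e; rewrite f0.
  by rewrite mul0r sub0r => e; have := sqr_ge0 (sinT (phi t + (th t / 2 - a0))); rewrite expr2; lra.
have sg := nonzero_sign ler01 cf f0.
have e0 : f 0 = 1 by rewrite /f /a0 (_ : _ + _ = 0) ?cosT0//; ring.
have phi01 : phi 1 - phi 0 \is a Num.int.
  apply/(circ_eq 2 _ _ hr); rewrite -!hE; have [[_ gi _] _] := Lh.
  by apply/gi; exists 1; rewrite subr0.
have e1 : f 1 = cosT (k%:~R / 2).
  rewrite /f (_ : _ + _ = k%:~R / 2 + (phi 1 - phi 0)) ?cosT_periodic//.
  by rewrite -hk /a0; field.
apply/eqP => k1; move: sg; rewrite e0 e1 mul1r.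
have -> : cosT (k%:~R / 2) = cosT (2^-1 : R).
  have [kp|kn] := leP 0 k; first by rewrite ger0_norm// in k1; rewrite k1 mul1r.
  by rewrite ltr0_norm// in k1; rewrite -cosTN -mulNr -rmorphN k1 mul1r.
by rewrite cosT_half_turn; lra.
Qed.

End wound_circles.

(** * The turning number of a trochoid *)

Section trochoid.
Context {R : realType}.
Local Notation V := 'rV[R]_2.
Local Notation T := (torus_surface (R := R)).
Local Notation L := (torus_line (R := R)).
Local Notation B := (torus_contact (R := R)).
Local Notation E := (circle_bundle L).

(** The bound 1/8 keeps x in the chart centred at 0 and w within a quarter of
    a turn. *)
Variable b : R.
Hypothesis hb : 0 < b <= 8^-1.

(** The velocity is (2 pi b sin, 1 - 2 cos), which runs once along an ellipse.
    The factor 2 > 1 makes it surround the origin, and the offset 1 in x is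
    then the one for which the integral of x dy over a period vanishes, so
    that w is periodic. *)
Definition trX (t : R) := - b * (1 + cosT t).
Definition trY (t : R) := t - sinT t / pi.
Definition trW (t : R) := - (b / pi) * (sinT t * (1 + cosT t)).

Let b0 : b != 0. Proof. by rewrite gt_eqF//; case/andP: hb. Qed.
Let pi0 : (pi : R) != 0. Proof. by rewrite gt_eqF// pi_gt0. Qed.

Lemma cosT_bounds (t : R) : -1 <= cosT t <= 1.
Proof. by rewrite /cosT cos_geN1 cos_le1. Qed.

Lemma sinT_bounds (t : R) : -1 <= sinT t <= 1.
Proof. by rewrite /sinT sin_geN1 sin_le1. Qed.

Lemma trX_small t : `|trX t| < 2^-1.
Proof.
have /andP[h1 h2] := hb; have /andP[h3 h4] := cosT_bounds t.
rewrite /trX ltr_norml; apply/andP; split; nra.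
Qed.

Lemma trW_small t : `|trW t| <= 4^-1 / pi.
Proof.
have /andP[h1 h2] := hb; have p0 := pi_gt0 R.
have : `|sinT t * (1 + cosT t)| <= 2.
  have /andP[h3 h4] := cosT_bounds t; have /andP[h5 h6] := sinT_bounds t.
  by rewrite ler_norml; apply/andP; split; nra.
rewrite /trW [`|- _ * _|]normrM normrN [`|b / pi|]normrM (gtr0_norm h1) (@gtr0_norm _ pi^-1) ?invr_gt0//.
move: `|sinT t * _| (normr_ge0 (sinT t * (1 + cosT t))) => q q0 q2.
rewrite mulrAC ler_pM2r ?invr_gt0//; nra.
Qed.

Section angle.
Variables (h : R -> E) (v : R -> V) (phi : R -> R).
Hypothesis Lh : legendrian_knot (B := B) h.
Hypothesis hv : forall c t, tdom c (bproj (h t)) ->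
  v t = derive1 (@crd R T c \o @bproj R T L \o h) t.
Hypothesis cv : continuous v.
Hypothesis hE : forall t, h t = pt (trX (phi t)) (trY (phi t)) (trW (phi t)).

Let x t := trX (phi t).
Let w t := trW (phi t).
Let C t := cosT (phi t).
Let S t := sinT (phi t).
Let xs t : `|x t| < 2^-1 := trX_small (phi t).
Let CS t : C t ^+ 2 + S t ^+ 2 = 1 := cosT2DsinT2 (phi t).

(** As w stays below a quarter of a turn, it is recovered from its circle
    point by an arctangent. *)
Lemma trw_derivable (t : R) : derivable w t 1.
Proof.
have [_ dz] := w_derivable Lh hE xs t.
have p0 := pi_gt0 R; have p2 := pi_ge2 R.
have wb s : - (pi / 2) < 2 * pi * w s < pi / 2.
  have := trW_small (phi s); rewrite ler_norml -/(w s) => /andP[h1 h2].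
  have e : 4^-1 / pi * (2 * pi) = 2^-1 :> R.
    by rewrite [2 * _]mulrC mulrA divfK//; lra.
  have h4 : w s * (2 * pi) <= 2^-1 by rewrite -e ler_pM2r// mulr_gt0.
  have h3 : - 2^-1 <= w s * (2 * pi) by rewrite -e -mulNr ler_pM2r// mulr_gt0.
  by rewrite [2 * pi * _]mulrC; apply/andP; split; lra.
have z0 s : 0 < cosT (w s) by apply: cos_gt0_pihalf; exact: wb.
have e0 : (fun q => (circle_point \o w) q 0 0) = (fun t => cosT (w t)).
  by apply/funext => s; rewrite /= /circle_point vec2E.
have e1 : (fun q => (circle_point \o w) q 0 1) = (fun t => sinT (w t)).
  by apply/funext => s; rewrite /= /circle_point vec2E.
have d0 : derivable (fun t => cosT (w t)) t 1 by rewrite -e0; case: (coord_derive 0 dz).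
have d1 : derivable (fun t => sinT (w t)) t 1 by rewrite -e1; case: (coord_derive 1 dz).
have dq : derivable (fun t => sinT (w t) * (cosT (w t))^-1) t 1.
  have zn : cosT (w t) != 0 by rewrite gt_eqF.
  have dV : derivable (fun t => (cosT (w t))^-1) t 1 := @derivableV R R (fun t => cosT (w t)) t 1 zn d0.
  exact: (@derivableM R R (fun t => sinT (w t)) (fun t => (cosT (w t))^-1) t 1 d1 dV).
have [da _] := is_derive_comp1 (derivableP dq) (is_derive1_atan _).
rewrite (_ : w = (fun t => (2 * pi)^-1 * atan (sinT (w t) * (cosT (w t))^-1))).
  have := @derivableZ R R R _ (2 * pi)^-1 t 1 da; exact.
apply/funext => s; rewrite -[sinT _ * _]/(tan (2 * pi * w s)) tanK ?in_itv//=.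
by rewrite mulKf// mulf_neq0.
Qed.

Lemma tr_contact (t : R) : derive1 w t + 2 * x t * v t 0 1 = 0.
Proof.
have := contact_coord Lh hv hE xs t.
rewrite derive1E (wedge_circle_point (@trw_derivable t)) -derive1E => hc.
have : 2 * pi * (derive1 w t + 2 * x t * v t 0 1) = 0.
  by rewrite -[RHS]hc /x; ring.
by move=> /eqP; rewrite !mulf_eq0 pnatr_eq0 (negbTE pi0) => /eqP.
Qed.

(** Eliminating the parameter, x and w satisfy the quartic equation pi^2 b^2
    w^2 = - 2 b x^3 - x^4. Its derivative, combined with the contact
    condition, determines the direction of the velocity wherever 1 + cos is
    nonzero. At the remaining point both sides vanish. *)
Lemma tr_parallel (t : R) : 2 * pi * b * S t * v t 0 1 = (1 - 2 * C t) * v t 0 0.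
Proof.
have dx := x_velocity Lh hv hE xs t.
have [X0|X0] := eqVneq (1 + C t) 0.
  have e1 : C t = -1 by lra.
  have e2 : S t = 0.
    by have := CS t; rewrite e1 => h1; apply/eqP; rewrite -sqrf_eq0; apply/eqP; lra.
  have e3 : v t 0 0 = 0.
    (* Here x attains its maximum 0. *)
    have [dxt <-] := dx; apply: derive_val; apply: (@derive1_at_max R x (t - 1) (t + 1) t).
    - lra.
    - by move=> s _; case: (x_velocity Lh hv hE xs s).
    - by rewrite in_itv /=; apply/andP; split; lra.
    - move=> s _; rewrite /x /trX -/(C t) X0 mulr0.
      by have /andP[h1 _] := cosT_bounds (phi s); have /andP[h2 _] := hb; nra.
  by rewrite e2 e3 !mulr0 mul0r.
have dw := derivableP (@trw_derivable t).
have Dw := is_deriveM dw dw.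
have Dx2 := is_deriveM dx dx.
have Dx3 := is_deriveM Dx2 dx.
have Dx4 := is_deriveM Dx3 dx.
have D3 := is_deriveZ (- 2 * b) Dx3.
have D := is_deriveB D3 Dx4.
have p0 := pi_gt0 R.
have DD := is_deriveB (is_deriveZ ((pi * b) ^+ 2) Dw) D.
have e : (((pi * b) ^+ 2 *: (w * w)) - ((- 2 * b) *: (x * x * x) - x * x * x * x)) = cst 0.
  apply/funext => s; change ((pi * b) ^+ 2 * (w s * w s) -
    ((- 2 * b) * (x s * x s * x s) - x s * x s * x s * x s) = 0).
  rewrite /x /w /trX /trW.
  have := cosT2DsinT2 (phi s); move: (cosT _) (sinT _) => c s' cs.
  have -> : (pi * b) ^+ 2 * (- (b / pi) * (s' * (1 + c)) * (- (b / pi) * (s' * (1 + c)))) =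
    b ^+ 4 * (s' ^+ 2 * (1 + c) ^+ 2).
    by move: pi0; generalize (pi : R) => P P0; field.
  have -> : s' ^+ 2 = 1 - c ^+ 2 by lra.
  ring.
have := @derive_cst R R R 0 t 1; rewrite -e; have [_ ->] := DD.
rewrite !mulrfctE /GRing.scale /= -derive1E.
have := tr_contact t => hc.
have -> : derive1 w t = - 2 * x t * v t 0 1 by lra.
move=> H.
have : 2 * b ^+ 3 * (1 + C t) ^+ 2 *
    ((1 - 2 * C t) * v t 0 0 - 2 * pi * b * S t * v t 0 1) = 0.
  rewrite -[RHS]H /x /w /trX /trW -/(C t) -/(S t).
  move: (C t) (S t) (v t 0 0) (v t 0 1) => c s u0 u1.
  by move: pi0; generalize (pi : R) => P P0; field.
move=> /eqP; rewrite mulf_eq0 (_ : (_ == 0) = false) /=; last first.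
  by apply/negbTE; rewrite !mulf_neq0 ?expf_neq0// pnatr_eq0.
by rewrite subr_eq0 => /eqP ->.
Qed.

Lemma x_continuous : continuous x.
Proof.
move=> t; have [dx _] := x_velocity Lh hv hE xs t.
by apply/differentiable_continuous/derivable1_diffP.
Qed.

Lemma w_continuous : continuous w.
Proof.
move=> t; apply/differentiable_continuous/derivable1_diffP.
exact: (@trw_derivable t).
Qed.

Lemma C_continuous : continuous C.
Proof.
rewrite (_ : C = fun t => - b^-1 * x t - 1).
  apply: continuousD2; last exact: cst_continuous.
  by apply: continuousM2; [exact: cst_continuous|exact: x_continuous].
by apply/funext => t; rewrite /x /trX -/(C t); field.
Qed.

(** Away from cos = - 1 the sine is w / (1 + cos) up to a constant; where cos
    = - 1 it tends to 0 because its square is 1 - cos^2. *)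
Lemma S_continuous : continuous S.
Proof.
move=> t; have cC := C_continuous.
have [C0|C0] := eqVneq (1 + C t) 0.
  have S0 : S t = 0.
    have := CS t; rewrite (_ : C t = -1); last by lra.
    by move=> h1; apply/eqP; rewrite -sqrf_eq0; apply/eqP; lra.
  apply/cvgrPdist_lt => e e0; rewrite S0.
  have cc : continuous (fun s => 1 - C s * C s).
    by apply: continuousD2; [exact: cst_continuous|apply: continuousN1; exact: continuousM2].
  have : (fun s => 1 - C s * C s) @ t --> (0 : R).
    have e1 : 1 - C t * C t = 0 by rewrite (_ : C t = -1); [ring|lra].
    by rewrite -e1; exact: cc.
  move=> /cvgrPdist_lt /(_ _ (exprn_gt0 2 e0)); apply: filterS => s.
  rewrite !sub0r !normrN => hs; rewrite -(@ltr_pXn2r _ 2) ?nnegrE ?normr_ge0 ?(ltW e0)//.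
  rewrite -normrX (_ : S s ^+ 2 = 1 - C s * C s)//.
  by have := CS s; rewrite !expr2; lra.
suff : {for t, continuous S} by [].
apply: (@near_eq_continuous_at _ _ (fun s => - (pi / b) * w s / (1 + C s))).
  have hn : \forall s \near t, 1 + C s != 0.
    have cc : continuous (fun s => 1 + C s).
      by apply: continuousD2 => //; exact: cst_continuous.
    by move/cvgr_neq0: (cc t); apply.
  apply: filterS hn => s hs0; rewrite /w /trW -/(C s) -/(S s).
  move: pi0 hs0; generalize (pi : R) => P P0; move: (C s) (S s) => c u hc0.
  by field; rewrite hc0 P0.
apply: cvgM.
  by apply: cvgM; [exact: cvg_cst|exact: w_continuous].
apply: cvgV => //; apply: cvgD; [exact: cvg_cst|exact: cC].
Qed.

End angle.

(** A ray from the origin meets the ellipse (s, 1 - 2 c) at most once, because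
    the origin lies inside. *)
Lemma ellipse_inj (c s c' s' k : R) : c ^+ 2 + s ^+ 2 = 1 -> c' ^+ 2 + s' ^+ 2 = 1 ->
  0 < k -> s = k * s' -> 1 - 2 * c = k * (1 - 2 * c') -> c = c' /\ s = s'.
Proof.
move=> h h' k0 hs hc.
have hc' : -1 <= c' <= 1 by apply/andP; split; nra.
have : (1 - k) * (3 + 5 * k - 4 * k * c') = 0.
  have e1 : c = (1 - k * (1 - 2 * c')) / 2 by lra.
  have e2 : s' ^+ 2 = 1 - c' ^+ 2 by lra.
  have h2 : ((1 - k * (1 - 2 * c')) / 2) ^+ 2 + k ^+ 2 * (1 - c' ^+ 2) = 1.
    by rewrite -e1 -e2 -exprMn -hs.
  lra.
move=> /eqP; rewrite mulf_eq0 => /orP[/eqP h1|/eqP h1].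
  have e : k = 1 by lra.
  by move: hs hc; rewrite e !mul1r => -> ?; split=> //; lra.
by move/andP: hc' => [h2 h3]; nra.
Qed.

Lemma trochoid_eq s t :
  cosT s = cosT t -> sinT s = sinT t -> pt (trX s) (trY s) (trW s) = pt (trX t) (trY t) (trW t) :> E.
Proof.
move=> hc hs; have hi := cosT_sinT_inj hc hs.
apply/pt_eq; rewrite /trX /trY /trW hc hs; split; rewrite ?subrr ?rpred0//.
  by rewrite (_ : _ - _ = s - t)//; ring.
by rewrite mulr0 mul0r subr0 rpred0.
Qed.

(** At parameter phi the velocity is a nonzero multiple, of constant sign, of
    the point of the ellipse with parameter phi. Equal directions therefore
    mean equal points of the ellipse, hence of the knot. *)
Lemma trochoid_turn (h : R -> E) (th phi : R -> R) (k : int) :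
  legendrian_knot (B := B) h ->
  (forall t, h t = pt (trX (phi t)) (trY (phi t)) (trW (phi t))) ->
  continuous th -> velocity_angle h th -> th 1 - th 0 = k%:~R -> `|k| = 1.
Proof.
move=> Lh hE cth [v [cv hv hth]] hk.
(* The scalar product of the velocity with the point of the ellipse: it is
   continuous and vanishes nowhere, so it has a constant sign. *)
pose f t := v t 0 0 * (2 * pi * b * sinT (phi t)) + v t 0 1 * (1 - 2 * cosT (phi t)).
have cf : continuous f.
  have cS := S_continuous Lh hv hE; have cC := C_continuous Lh hv hE.
  have cv0 : continuous (fun t => v t 0 0).
    exact: (continuous_comp2 cv (@coord_continuous R _ _ 0 0)).
  have cv1 : continuous (fun t => v t 0 1).
    exact: (continuous_comp2 cv (@coord_continuous R _ _ 0 1)).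
  apply: continuousD2; apply: continuousM2 => //.
    by apply: continuousM2 => //; exact: cst_continuous.
  apply: continuousD2; first exact: cst_continuous.
  by apply: continuousN1; apply: continuousM2 => //; exact: cst_continuous.
pose q t := (2 * pi * b * sinT (phi t)) ^+ 2 + (1 - 2 * cosT (phi t)) ^+ 2.
have a0 : 2 * pi * b != 0 by rewrite !mulf_neq0// pnatr_eq0.
have q0 t : 0 < q t.
  rewrite lt0r addr_ge0 ?sqr_ge0// andbT paddr_eq0 ?sqr_ge0// !sqrf_eq0.
  rewrite mulf_eq0 (negbTE a0) /=; apply/negP => /andP[/eqP hs /eqP hc].
  by have := cosT2DsinT2 (phi t); rewrite hs (_ : cosT _ = 2^-1); [lra|lra].
have par t : f t * (2 * pi * b * sinT (phi t)) = q t * v t 0 0 /\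
    f t * (1 - 2 * cosT (phi t)) = q t * v t 0 1.
  have := tr_parallel Lh hv hE t; rewrite /f /q.
  move: (2 * pi * b * sinT _) (1 - 2 * cosT _) (v t 0 0) (v t 0 1) => a c u0 u1 e.
  split.
    rewrite (_ : _ * _ = a ^+ 2 * u0 + (a * u1) * c); last by ring.
    by rewrite e; ring.
  rewrite (_ : _ * _ = (c * u0) * a + c ^+ 2 * u1); last by ring.
  by rewrite -e; ring.
have f0 t : 0 <= t <= 1 -> f t != 0.
  move=> ht; apply/eqP => f0; have [] := par t; rewrite f0 !mul0r.
  have [r rp ->] := hth t ht; rewrite !vec2E => /esym/eqP h1 /esym/eqP h2.
  move: h1 h2; rewrite !mulf_eq0 !(gt_eqF (q0 t)) !(gt_eqF rp) /= => /eqP h1 /eqP h2.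
  by have := cosT2DsinT2 (th t); rewrite h1 h2 expr0n addr0 => /esym/eqP; rewrite oner_eq0.
apply: (injective_turn cth hk) => s t hs ht hi.
suff e : h s = h t.
  by have [[_ gi _] _] := Lh; have /gi[n ->] := e; exact: intr_int.
have ce : cosT (th s) = cosT (th t) by rewrite -(cosT_periodic (th t) hi) addrC subrK.
have se : sinT (th s) = sinT (th t) by rewrite -(sinT_periodic (th t) hi) addrC subrK.
have [r rp vs] := hth s hs; have [r' rp' vt] := hth t ht.
have [p1 p2] := par s; have [p3 p4] := par t.
move: p1 p2 p3 p4; rewrite vs vt !vec2E ce se.
have sg : 0 < f s * f t.
  case: (leP s t) => st.
    apply: nonzero_sign st cf _ => u /andP[u1 u2]; apply: f0.
    by case/andP: hs => h1 _; case/andP: ht => _ h2; rewrite (le_trans h1 u1) (le_trans u2 h2).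
  rewrite mulrC; apply: nonzero_sign (ltW st) cf _ => u /andP[u1 u2]; apply: f0.
  by case/andP: ht => h1 _; case/andP: hs => _ h2; rewrite (le_trans h1 u1) (le_trans u2 h2).
move=> p1 p2 p3 p4.
(* The points of the ellipse at s and t have the same direction; kk is the ratio
   of their lengths. *)
pose kk := (q s * r * f t) / (q t * r' * f s).
have fs0 := f0 s hs; have ft0 := f0 t ht.
have k0 : 0 < kk.
  rewrite (_ : kk = (q s * r * (q t * r')) * (f s * f t) / (q t * r' * f s) ^+ 2).
    apply: divr_gt0; first by apply: mulr_gt0 => //; rewrite !mulr_gt0.
    rewrite lt0r sqr_ge0 andbT sqrf_eq0 mulf_eq0 (negbTE fs0) orbF.
    by rewrite mulf_neq0// gt_eqF.
  by rewrite /kk; field; rewrite fs0 !gt_eqF.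
have rat (u u' c : R) : f s * u = q s * (r * c) -> f t * u' = q t * (r' * c) -> u = kk * u'.
  have qr : q t * r' != 0 by rewrite mulf_neq0// gt_eqF.
  move=> e e'; apply: (mulfI fs0); apply: (mulfI qr).
  rewrite e (_ : q t * r' * (q s * (r * c)) = q s * r * (q t * (r' * c))); last by ring.
  rewrite -e' /kk; field; by rewrite fs0 !gt_eqF.
have e1 := rat _ _ _ p1 p3; have e2 := rat _ _ _ p2 p4.
have e3 : sinT (phi s) = kk * sinT (phi t).
  by apply: (mulfI a0); rewrite e1; ring.
have [h1 h2] := ellipse_inj (cosT2DsinT2 (phi s)) (cosT2DsinT2 (phi t)) k0 e3 e2.
by rewrite !hE; exact: trochoid_eq.
Qed.

End trochoid.

(** * The knots and their isotopies *)

Section knots.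
Context {R : realType}.
Local Notation V := 'rV[R]_2.
Local Notation T := (torus_surface (R := R)).
Local Notation L := (torus_line (R := R)).
Local Notation B := (torus_contact (R := R)).
Local Notation E := (circle_bundle L).

Lemma elem_id : elem (fun t : R => t).
Proof.
by apply: (@elem_lin _ _ _ id) => // t; exact: cvg_id.
Qed.

Lemma is_derive_linear (U : normedModType R) (l : U -> R) x v :
  (forall h : R, l (h *: v + x) = h * l v + l x) -> is_derive x v l (l v).
Proof.
move=> hl.
have D := is_deriveD (is_deriveZ (l v) (is_derive_id (0 : R) 1)) (is_derive_cst (l x) (0 : R) 1).
have e : (fun h : R => l (h *: v + x)) = (l v *: id + cst (l x)).
  by apply/funext => h; rewrite hl mulrC.
have [d1 d2] := D; apply: DeriveDef.
  by apply/derivable1P; rewrite e.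
by rewrite derive_line e d2 addr0 /GRing.scale /= mulr1.
Qed.

Lemma elem_fst : elem (fun p : R^o * R^o => p.1).
Proof.
apply: (@elem_lin _ _ _ (fun p => p.1)) => [p|x v]; first exact: cvg_fst.
exact: is_derive_linear.
Qed.

Lemma elem_snd : elem (fun p : R^o * R^o => p.2).
Proof.
apply: (@elem_lin _ _ _ (fun p => p.2)) => [p|x v]; first exact: cvg_snd.
exact: is_derive_linear.
Qed.

Lemma is_derive_sinTM (a : R) (m : R) (t : R) :
  is_derive t 1 (fun t => a * sinT (m * t)) (2 * pi * m * (a * cosT (m * t))).
Proof.
have d1 : is_derive t 1 (fun t => m * t) m.
  have := is_deriveZ m (is_derive_id t 1); rewrite /GRing.scale /= mulr1; exact.
have [D1 D2] := is_deriveZ a (is_derive_comp1 d1 (is_derive_sinT (m * t))).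
by apply: DeriveDef; [exact: D1|rewrite [LHS]D2 /GRing.scale /=; ring].
Qed.

Lemma is_derive_cosTM (a : R) (m : R) (t : R) :
  is_derive t 1 (fun t => a * cosT (m * t)) (- (2 * pi * m * (a * sinT (m * t)))).
Proof.
have d1 : is_derive t 1 (fun t => m * t) m.
  have := is_deriveZ m (is_derive_id t 1); rewrite /GRing.scale /= mulr1; exact.
have [D1 D2] := is_deriveZ a (is_derive_comp1 d1 (is_derive_cosT (m * t))).
by apply: DeriveDef; [exact: D1|rewrite [LHS]D2 /GRing.scale /=; ring].
Qed.

(* In the coordinate u = w + xy these curves have u = t, which makes them
   embedded for all small periodic X and Y. *)
Section sheared.
Variables X Y : R -> R.
Hypotheses (eX : elem X) (eY : elem Y).
Hypotheses (sX : forall t, `|X t| < 2^-1) (sY : forall t, `|Y t| < 2^-1).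
Hypothesis per : forall t m, m \is a Num.int -> X (t + m) = X t /\ Y (t + m) = Y t.
Let W (t : R) := t - X t * Y t.

Let eW : elem W.
Proof. by apply: elemB; [exact: elem_id|exact: elemM]. Qed.

Lemma sheared_derive (t : R) :
  derive1 W t = 1 - (X t * derive1 Y t + Y t * derive1 X t).
Proof.
have dX : derivable X t 1 by exact: elem_derivable.
have dY : derivable Y t 1 by exact: elem_derivable.
have [_] := is_deriveB (is_derive_id t 1) (is_deriveM (derivableP dX) (derivableP dY)).
by rewrite !derive1E => <-.
Qed.

Lemma sheared_knot : knot (B := B) (fun t => pt (X t) (Y t) (W t)).
Proof.
apply: knot_pt => // [s t|t].
  rewrite (sheared_eq s t sX sY per); split=> [/intrP//|[k ->]]; exact: intr_int.
have [X0|X0] := eqVneq (derive1 X t) 0; last by apply: Or31.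
have [Y0|Y0] := eqVneq (derive1 Y t) 0; last by apply: Or32.
by apply: Or33; rewrite sheared_derive X0 Y0 !mulr0 addr0 subr0 oner_neq0.
Qed.

(** The contact form is du + x dy - y dx up to a factor, and du = dt. *)
Lemma sheared_legendrian :
  (forall t, derive1 X t * Y t - X t * derive1 Y t = 1) ->
  legendrian_knot (B := B) (fun t => pt (X t) (Y t) (W t)).
Proof.
move=> h; apply: legendrian_pt => //; first exact: sheared_knot.
by move=> t; rewrite sheared_derive; have := h t; lra.
Qed.

(** Shrinking (X, Y) to the origin with u fixed is a homotopy from the curve
    to a fiber. *)
Lemma sheared_fibre_degree :
  nontrivial_fiber_degree (B := B) (fun t => pt (X t) (Y t) (W t)).
Proof.
have cX := elem_continuous eX; have cY := elem_continuous eY.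
have [X1 Y1] := per 0 (rpred1 _); rewrite add0r in X1 Y1.
split.
  apply: fibre_loop_not_null => //; first exact: elem_continuous.
  by rewrite /W X1 Y1; ring.
exists (pt 0 0 0), 1; rewrite mulr1z.
pose H (p : R * R) : ctotal B :=
  pt ((1 - p.1) * X p.2) ((1 - p.1) * Y p.2) (p.2 - (1 - p.1) ^+ 2 * (X p.2 * Y p.2)).
have cf : continuous (fun p : R * R => p.1) by move=> p; exact: cvg_fst.
have cs : continuous (fun p : R * R => p.2) by move=> p; exact: cvg_snd.
have c1f : continuous (fun p : R * R => 1 - p.1).
  by apply: continuousD2; [exact: cst_continuous|exact: continuousN1].
have cX2 := continuous_comp2 cs cX; have cY2 := continuous_comp2 cs cY.
have cH : continuous H.
  apply: pt_continuous; [exact: continuousM2|exact: continuousM2|].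
  apply: continuousD2 => //; apply: continuousN1; apply: continuousM2; last exact: continuousM2.
  exact: continuousM2.
have := @homotopic_homologous R (ctotal B) H cH.
have -> : (fun t => H (0, t)) = (fun t => pt (X t) (Y t) (W t)).
  by apply/funext => t; rewrite /H /W /= subr0 expr1n !mul1r.
have -> : (fun t => H (1, t)) = fiber_loop (pt 0 0 0).
  apply/funext => t; rewrite /H /= subrr expr0n !mul0r subr0.
  apply: bundle_eq => //; rewrite vec_pt mulr0 addr0.
  by rewrite /vec /= mulr0 addr0 (@expT_int _ 0) ?rpred0// [RHS]mulr1.
apply; move=> s; rewrite /H /= X1 Y1; apply/pt_eq.
rewrite !subrr mulr0 mul0r rpred0; split=> //.
by rewrite subr0 (_ : _ - _ = 1) ?rpred1//; ring.
Qed.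

End sheared.

Lemma elem_circX (r : R) m : elem (circX r m).
Proof. by apply: elemM; [exact: elemC|apply: elem_sinT; apply: elemM; [exact: elemC|exact: elem_id]]. Qed.

Lemma elem_circY (r : R) m : elem (circY r m).
Proof. by apply: elemM; [exact: elemC|apply: elem_cosT; apply: elemM; [exact: elemC|exact: elem_id]]. Qed.

(** The radius at which the circle wound m times encloses the signed area that
    the contact condition requires for one turn of the fiber: 2 pi m r^2 = 1. *)
Definition rad (m : nat) : R := Num.sqrt (2 * pi * m%:R)^-1.

Lemma pi_gt2 : 2 < pi :> R.
Proof.
rewrite lt_neqAle pi_ge2 andbT; apply/eqP => h.
have := @cos_pihalf R; rewrite -h divff// => c0.
by have := @cos1_gt0 R; rewrite c0 ltxx.
Qed.

Lemma rad_gt0 m : (0 < m)%N -> 0 < 2 * pi * m%:R :> R.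
Proof. by move=> m0; rewrite !mulr_gt0 ?ltr0n// pi_gt0. Qed.

Lemma rad_small m : (0 < m)%N -> 0 < rad m < 2^-1.
Proof.
move=> m0; have p2 := pi_gt2; have q0 := rad_gt0 m0.
have m1 : 1 <= m%:R :> R by rewrite ler1n.
rewrite sqrtr_gt0 invr_gt0 q0 /= -(@ltr_pXn2r _ 2) ?nnegrE ?sqrtr_ge0 ?invr_ge0//.
rewrite sqr_sqrtr ?invr_ge0 ?ltW// exprVn ltf_pV2 ?posrE//.
by rewrite expr2; nra.
Qed.

Lemma circ_legendrian m : (0 < m)%N -> legendrian_knot (B := B) (circ (rad m) m).
Proof.
move=> m0; have hr := rad_small m0.
apply: sheared_legendrian => [||t|t|t|t]; try (by case: (circ_small m t hr)).
- exact: elem_circX.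
- exact: elem_circY.
- exact: circ_per.
have [_ eX] := is_derive_sinTM (rad m) m%:R t.
have [_ eY] := is_derive_cosTM (rad m) m%:R t.
rewrite !derive1E [X in X * _]eX [X in _ - _ * X]eY /circX /circY.
rewrite (_ : _ - _ = 2 * pi * m%:R * rad m ^+ 2 * (cosT (m%:R * t) ^+ 2 + sinT (m%:R * t) ^+ 2)); last by ring.
rewrite cosT2DsinT2 mulr1 sqr_sqrtr ?invr_ge0 ?ltW ?rad_gt0//.
by rewrite divff// gt_eqF// rad_gt0.
Qed.

Lemma circ_fibre_degree m : (0 < m)%N ->
  nontrivial_fiber_degree (B := B) (circ (rad m) m).
Proof.
move=> m0; have hr := rad_small m0.
apply: sheared_fibre_degree => [||t n]; [exact: elem_circX|exact: elem_circY|].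
exact: circ_per.
Qed.

(** Linear interpolation between the two plane curves, with u = t throughout. *)
Lemma circ_isotopic : smoothly_isotopic (B := B) (circ (rad 1) 1) (circ (rad 2) 2).
Proof.
have hr1 := rad_small (isT : (0 < 1)%N); have hr2 := rad_small (isT : (0 < 2)%N).
pose X (s t : R) := (1 - s) * circX (rad 1) 1 t + s * circX (rad 2) 2 t.
pose Y (s t : R) := (1 - s) * circY (rad 1) 1 t + s * circY (rad 2) 2 t.
have conv (a b s : R) : 0 <= s <= 1 -> `|a| < 2^-1 -> `|b| < 2^-1 ->
    `|(1 - s) * a + s * b| < 2^-1.
  move=> /andP[s0 s1'] ha hb; pose c := Num.max `|a| `|b|.
  have hc : c < 2^-1 by rewrite gt_max ha.
  have ac : `|a| <= c by rewrite le_max lexx.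
  have bc : `|b| <= c by rewrite le_max lexx orbT.
  apply: le_lt_trans (ler_normD _ _) _; rewrite !normrM (ger0_norm s0) ger0_norm; last by lra.
  by apply: le_lt_trans hc; nra.
exists (fun s t => pt (X s t) (Y s t) (t - X s t * Y s t)); split.
- have e1 : elem (fun p : R^o * R^o => 1 - p.1).
    by apply: elemB; [exact: elemC|exact: elem_fst].
  have em (m : nat) : elem (fun p : R^o * R^o => m%:R * p.2).
    by apply: elemM; [exact: elemC|exact: elem_snd].
  have eX : elem (fun p : R^o * R^o => X p.1 p.2).
    have ec (r : R) m : elem (fun p : R^o * R^o => circX r m p.2).
      by apply: elemM; [exact: elemC|apply: elem_sinT; exact: em].
    exact: (elemD (elemM e1 (ec _ _)) (elemM elem_fst (ec _ _))).
  have eY : elem (fun p : R^o * R^o => Y p.1 p.2).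
    have ec (r : R) m : elem (fun p : R^o * R^o => circY r m p.2).
      by apply: elemM; [exact: elemC|apply: elem_cosT; exact: em].
    exact: (elemD (elemM e1 (ec _ _)) (elemM elem_fst (ec _ _))).
  apply: (smooth_pt eX eY); apply: elemB; first exact: elem_snd.
  exact: elemM.
- move=> s hs; apply: sheared_knot => [||t|t|t n hn].
  + by apply: elemD; apply: elemM; [exact: elemC|exact: elem_circX|exact: elemC|exact: elem_circX].
  + by apply: elemD; apply: elemM; [exact: elemC|exact: elem_circY|exact: elemC|exact: elem_circY].
  + by apply: conv => //; [case: (circ_small 1 t hr1)|case: (circ_small 2 t hr2)].
  + by apply: conv => //; [case: (circ_small 1 t hr1)|case: (circ_small 2 t hr2)].
  + by rewrite /X /Y; have [-> ->] := circ_per (rad 1) 1 t hn; have [-> ->] := circ_per (rad 2) 2 t hn.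
- suff e : (fun t => pt (X 0 t) (Y 0 t) (t - X 0 t * Y 0 t)) = circ (rad 1) 1 by rewrite -e.
  by apply/funext => t; rewrite /X /Y subr0 !mul1r !mul0r !addr0.
- suff e : (fun t => pt (X 1 t) (Y 1 t) (t - X 1 t * Y 1 t)) = circ (rad 2) 2 by rewrite -e.
  by apply/funext => t; rewrite /X /Y subrr !mul1r !mul0r !add0r.
Qed.

Lemma circ_not_isotopic : ~ legendrian_isotopic (B := B) (circ (rad 1) 1) (circ (rad 2) 2).
Proof.
move=> /isotopy_winding[h0 [h1 [th0 [th1 [k [[L0 L1] [r0 r1] [c0 c1'] [k0 k1] [a0 a1]]]]]]].
have lift (h : R -> E) m : range h = range (circ (rad m) m) ->
    exists phi : R -> R, forall t, h t = circ (rad m) m (phi t).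
  move=> rh; suff /choice[phi hphi] : forall t, exists u, h t = circ (rad m) m u by exists phi.
  move=> t; have : range h (h t) by exists t.
  by rewrite rh => -[u _ <-]; exists u.
have [phi0 E0] := lift _ _ r0; have [phi1 E1'] := lift _ _ r1.
have n1 := circ_turn1 (rad_small (isT : (0 < 1)%N)) L0 E0 c0 a0 k0.
have := circ_turn2 (rad_small (isT : (0 < 2)%N)) L1 E1' c1' a1 k1.
by rewrite n1 eqxx.
Qed.

Section trochoid_knot.
Let b : R := 8^-1.
Let hb : 0 < b <= 8^-1. Proof. by rewrite /b lexx andbT invr_gt0. Qed.

(** The straight line for s = 0 and the lift of the trochoid for s = 1; in
    between, these are smooth knots only. *)
Definition troch (s t : R) : E := pt (s * trX b t) (t - s * (sinT t / pi)) (s * trW b t).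

Let X (s t : R) := s * trX b t.
Let Y (s t : R) := t - s * (sinT t / pi).
Let W (s t : R) := s * trW b t.

Let pi0 : (pi : R) != 0. Proof. by rewrite gt_eqF// pi_gt0. Qed.

Section elem_in_two_variables.
Variables (U : normedModType R) (s t : U -> R).
Hypotheses (es : elem s) (et : elem t).

Lemma troch_elem : [/\ elem (fun p => X (s p) (t p)), elem (fun p => Y (s p) (t p)) &
  elem (fun p => W (s p) (t p))].
Proof.
have ec := elem_cosT et; have esin := elem_sinT et.
have e1c : elem (fun p => 1 + cosT (t p)) by apply: elemD => //; exact: elemC.
split.
- by apply: elemM => //; apply: elemM => //; exact: elemC.
- by apply: elemB => //; apply: elemM => //; apply: elemM => //; exact: elemC.
- by apply: elemM => //; apply: elemM; [exact: elemC|exact: elemM].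
Qed.

End elem_in_two_variables.

Lemma trX_derive (s t : R) : derive1 (X s) t = s * (2 * pi * b * sinT t).
Proof.
have D := is_deriveD (is_derive_cst (1 : R) t (1 : R)) (is_derive_cosT t).
have [_ e] := is_deriveZ s (is_deriveZ (- b) D).
by rewrite derive1E [LHS]e /GRing.scale /=; ring.
Qed.

Lemma trY_derive (s t : R) : derive1 (Y s) t = 1 - s * (2 * cosT t).
Proof.
have D := is_deriveZ (s * pi^-1) (is_derive_sinT t).
have [_ e] := is_deriveB (is_derive_id t 1) D.
rewrite derive1E (_ : Y s = id - (s * pi^-1) \*: @sinT R).
  by rewrite [LHS]e /GRing.scale /=; move: pi0; generalize (pi : R) => P P0; field.
by apply/funext => u; rewrite /Y [sinT u / pi]mulrC mulrA.
Qed.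

Lemma trW_derive (s t : R) : derive1 (W s) t =
  - (s * (2 * b * (2 * cosT t ^+ 2 + cosT t - 1))).
Proof.
have D := is_deriveD (is_derive_cst (1 : R) t (1 : R)) (is_derive_cosT t).
have [_ e] := is_deriveZ s (is_deriveZ (- (b / pi)) (is_deriveM (is_derive_sinT t) D)).
rewrite derive1E [LHS]e /GRing.scale /= (_ : (cst 1 + @cosT R) t = 1 + cosT t)//.
have -> : 2 * cosT t ^+ 2 + cosT t - 1 = cosT t ^+ 2 + cosT t - sinT t ^+ 2.
  by rewrite -[X in _ - X](cosT2DsinT2 t); ring.
by move: pi0; generalize (pi : R) => P P0; field.
Qed.

(** Coordinates x and w move by less than 1, so that two parameters of one
    point give the same x and w; for s > 0 these determine the cosine and the
    sine. *)
Lemma troch_knot s : 0 <= s <= 1 -> knot (B := B) (troch s).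
Proof.
move=> /andP[s0 s1'].
have [eX eY eW] := troch_elem (elemC s) elem_id.
have h1 := @cosT_bounds R; have h2 := @sinT_bounds R.
have p2 := @pi_gt2.
apply: (knot_pt eX eY eW) => [u t|t]; last first.
  rewrite trX_derive trY_derive trW_derive.
  have [->|sn] := eqVneq s 0; first by apply: Or32; rewrite mul0r subr0 oner_neq0.
  have sp : 0 < s by rewrite lt_neqAle eq_sym sn.
  have a0 : 2 * pi * b != 0 by rewrite !mulf_neq0// ?pnatr_eq0// gt_eqF//; case/andP: hb.
  have [st|st] := eqVneq (sinT t) 0; last by apply: Or31; apply: mulf_neq0 => //; exact: mulf_neq0.
  have /eqP : cosT t ^+ 2 = 1 ^+ 2 by rewrite expr1n -(cosT2DsinT2 t) st expr0n addr0.
  rewrite eqf_sqr => /orP[]/eqP ->.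
    apply: Or33; rewrite oppr_eq0 mulf_neq0// /b; apply/eqP; lra.
  by apply: Or32; apply/eqP; lra.
split=> [/pt_eq|[k ek]]; last first.
  have hi : u - t \is a Num.int by rewrite ek intr_int.
  have ec : cosT u = cosT t by rewrite -(cosT_periodic t hi) addrC subrK.
  have es : sinT u = sinT t by rewrite -(sinT_periodic t hi) addrC subrK.
  apply/pt_eq; rewrite /X /Y /W /trX /trW ec es !subrr mulr0 mul0r subr0 rpred0; split=> //.
  by rewrite (_ : _ - _ = u - t)//; ring.
rewrite /X /Y /W => -[a1 a2 a3].
have bX : `|s * trX b u - s * trX b t| < 1.
  have /andP[b1 b2] := h1 u; have /andP[b3 b4] := h1 t.
  rewrite (_ : _ - _ = s * b * (cosT t - cosT u)); last by rewrite /trX; ring.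
  rewrite normrM (ger0_norm (mulr_ge0 s0 _)) ?(ltW (proj1 (andP hb)))//.
  have : `|cosT t - cosT u| <= 2 by rewrite ler_norml; apply/andP; split; lra.
  by move: `|_| (normr_ge0 (cosT t - cosT u)) => q q0 q2; rewrite /b; nra.
have xe : s * trX b u = s * trX b t.
  by apply/eqP; rewrite -subr_eq0; apply/eqP/int_small.
move: a3; rewrite xe subrr mulr0 mul0r subr0 => a3.
have bW : `|s * trW b t - s * trW b u| < 1.
  have q1 := trW_small hb t; have q2 := trW_small hb u.
  have q3 : 4^-1 / pi <= 4^-1 :> R by rewrite ger_pMr ?invr_gt0// invf_le1 ?pi_gt0//; lra.
  rewrite -mulrBr normrM (ger0_norm s0).
  have := ler_normB (trW b t) (trW b u).
  by move: `|_ - _| (normr_ge0 (trW b t - trW b u)) => q q0 q4; nra.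
have we : s * trW b t = s * trW b u.
  by apply/eqP; rewrite -subr_eq0; apply/eqP/int_small.
have [sz|sn] := eqVneq s 0.
  by move: a2; rewrite sz !mul0r !subr0 => /intrP[k hk]; exists k.
have b0 : b != 0 by rewrite gt_eqF//; case/andP: hb.
have ec : cosT u = cosT t.
  by move: xe => /(mulfI sn)/(mulfI _) H; have := H; rewrite oppr_eq0 => /(_ b0); lra.
suff es : sinT u = sinT t by have /intrP[k hk] := cosT_sinT_inj ec es; exists k.
have c := cosT2DsinT2 u; have c' := cosT2DsinT2 t.
have [z|z] := eqVneq (1 + cosT t) 0.
  have e1 : cosT t = -1 by lra.
  have H (x : R) : x ^+ 2 = 0 -> x = 0 by move=> hx; apply/eqP; rewrite -sqrf_eq0 hx.
  have su : sinT u = 0 by apply: H; move: c; rewrite ec e1; lra.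
  have st : sinT t = 0 by apply: H; move: c'; rewrite e1; lra.
  by rewrite su st.
move: we => /(mulfI sn); rewrite /trW => /(mulfI _); rewrite oppr_eq0 mulf_neq0 ?invr_eq0// => /(_ isT).
by rewrite ec => /(mulIf z).
Qed.

Lemma troch_legendrian s : 0 <= s <= 1 -> (s = 0 \/ s = 1) ->
  legendrian_knot (B := B) (troch s).
Proof.
move=> hs s01; have [eX eY eW] := troch_elem (elemC s) elem_id.
apply: (legendrian_pt eX eY eW); first exact: troch_knot.
move=> t; rewrite trY_derive trW_derive /X /trX.
by case: s01 => ->; ring.
Qed.

Lemma troch_isotopic : smoothly_isotopic (B := B) (troch 0) (troch 1).
Proof.
exists troch; split=> // [|s hs]; last exact: troch_knot.
have [eX eY eW] := troch_elem elem_fst elem_snd.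
exact: (smooth_pt eX eY).
Qed.

Lemma troch_not_isotopic : ~ legendrian_isotopic (B := B) (troch 0) (troch 1).
Proof.
move=> /isotopy_winding[h0 [h1 [th0 [th1 [k [[L0 L1] [r0 r1] [c0 c1'] [k0 k1] [a0 a1]]]]]]].
have e0 : troch 0 = fun t => pt 0 t 0.
  by apply/funext => t; rewrite /troch !mul0r subr0.
rewrite e0 in r0; have kz := straight_turn L0 r0 c0 k0 a0.
have /choice[phi hphi] : forall t, exists u, h1 t = pt (trX b u) (trY u) (trW b u).
  move=> t; have : range h1 (h1 t) by exists t.
  by rewrite r1 => -[u _ <-]; exists u; rewrite /troch /trY !mul1r.
have := trochoid_turn hb L1 hphi c1' a1 k1.
by rewrite kz normr0 => /eqP; rewrite eq_sym oner_eq0.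
Qed.

Lemma troch_base_class s : nontrivial_base_class (B := B) (troch s).
Proof.
have [eX eY eW] := troch_elem (elemC s) elem_id.
apply: (@base_loop_not_null R (X s) (Y s)); [exact: elem_continuous eX|exact: elem_continuous eY|].
have i1 : (1 : R) \is a Num.int by exact: rpred1.
have e : sinT (1 : R) = sinT 0 by rewrite -(sinT_periodic 0 i1) add0r.
by rewrite /Y e; ring.
Qed.

End trochoid_knot.

End knots.

Theorem proposition1p2 (R : realType) :
  (exists (B : contact_circle_bundle R) (g0 g1 : R -> circle_bundle (cline B)),
     legendrian_knot g0 /\ legendrian_knot g1 /\
     smoothly_isotopic g0 g1 /\ ~ legendrian_isotopic g0 g1 /\
     nontrivial_fiber_degree g0 /\ nontrivial_fiber_degree g1)
  /\
  (exists (B : contact_circle_bundle R) (g0 g1 : R -> circle_bundle (cline B)),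
     legendrian_knot g0 /\ legendrian_knot g1 /\
     smoothly_isotopic g0 g1 /\ ~ legendrian_isotopic g0 g1 /\
     nontrivial_base_class g0 /\ nontrivial_base_class g1).
Proof.
split; exists torus_contact.
  exists (circ (rad 1) 1), (circ (rad 2) 2).
  split; first exact: circ_legendrian.
  split; first exact: circ_legendrian.
  split; first exact: circ_isotopic.
  split; first exact: circ_not_isotopic.
  by split; exact: circ_fibre_degree.
exists (troch 0), (troch 1).
split; first by apply: troch_legendrian; [rewrite lexx ler01|left].
split; first by apply: troch_legendrian; [rewrite lexx ler01|right].
split; first exact: troch_isotopic.
split; first exact: troch_not_isotopic.
by split; exact: troch_base_class.
Qed.
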